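(* Let $v(0)\in\mathcal N^*$ and let $v(t)$ be the solution of the critical equations with initial condition $v(0)$. Then the gelation time $t_{gel}:=\inf\{t:m_1(t)=+\infty\}$ equals $1/m_1(0)$; there is a positive continuous function $\varphi_{crit}:[t_{gel},\infty)\to(0,\infty)$ with $\Phi(t)=\int_{t_{gel}}^t\varphi_{crit}(s)\,ds$ for $t\ge t_{gel}$, where $\Phi(t)=m_0(0)-m_0(t)$; and for all $t\ge t_{gel}$, $$\lim_{K\to\infty}K^{1/2}\sum_{k=K}^\infty v_k(t)=\sqrt{\frac{2\varphi_{crit}(t)}{\pi}}.$$
   Context: $\mathcal N$: sequences $v=(v_k)_{k\ge1}$ of nonnegative reals with $\sum_kv_k<\infty$; $\mathcal N^*$: those with finitely many nonzero terms; $m_0=\sum_kv_k$, $m_1=\sum_kkv_k$ (possibly $+\infty$). Critical equations: $v(t)\in\mathcal N$ for $t\ge0$ with $v_k(t)=v_k(0)+\int_0^t\big(\tfrac k2\sum_{l=1}^{k-1}v_l(s)v_{k-l}(s)-kv_k(s)m_0(s)\big)ds$ for all $k\ge1$, and $\Phi(t):=m_0(0)-m_0(t)$ nondecreasing with values in $[0,m_0(0))$; the solution is unique. *)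

(* Defs.v *)
From Stdlib Require Import Reals.
From Coquelicot Require Export Coquelicot.
Open Scope R_scope.

(* A sequence (v_k)_{k>=1} is represented as u : nat -> R, using only the
   entries u k for k >= 1 (the entry u 0 is ignored everywhere). *)

Definition in_N (u : nat -> R) : Prop :=
  (forall k, (1 <= k)%nat -> 0 <= u k) /\ ex_series (fun k => u (S k)).

Definition in_Nstar (u : nat -> R) : Prop :=
  in_N u /\ exists N : nat, forall k, (N <= k)%nat -> u k = 0.

Definition m0 (u : nat -> R) : R := Series (fun k => u (S k)).

(* m_1 = sum_{k>=1} k v_k in [0, +oo] (limit of nondecreasing partial sums) *)
Definition m1 (u : nat -> R) : Rbar :=
  Lim_seq (fun n => sum_n (fun k => INR (S k) * u (S k)) n).

Definition Phi (v : R -> nat -> R) (t : R) : R := m0 (v 0) - m0 (v t).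

Definition critical_solution (v : R -> nat -> R) : Prop :=
  (forall t, 0 <= t -> in_N (v t)) /\
  (forall t k, 0 <= t -> (1 <= k)%nat ->
     is_RInt (fun s =>
                INR k / 2 * sum_n_m (fun l => v s l * v s (k - l)%nat) 1 (k - 1)
                - INR k * v s k * m0 (v s))
             0 t (v t k - v 0 k)) /\
  (forall s t, 0 <= s -> s <= t -> Phi v s <= Phi v t) /\
  (forall t, 0 <= t -> 0 <= Phi v t /\ Phi v t < m0 (v 0)).

(* Gelation time inf{ t >= 0 : m_1(t) = +oo } (in Rbar; +oo if the set is empty) *)
Definition t_gel (v : R -> nat -> R) : Rbar :=
  Glb_Rbar (fun t => 0 <= t /\ m1 (v t) = p_infty).

(* Main.v *)
(* Put G(t, x) = sum_k v_k(t) e^{-kx} and let M be the primitive of m_0.  In the frame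
   moving with M the critical equations become the inviscid Burgers equation, whose
   characteristics, followed backwards, give
     G(t, x) = G(0, x + M(t) - t G(t, x)).
   At x = 0 this reads m_0(t) = G(0, theta) with theta = M(t) - t m_0(t).  The right-hand
   side forces theta to minimise y |-> y + t G(0, y) over y >= 0, so theta = 0 up to
   t = 1 / m_1(0), and afterwards t = - 1 / G_x(0, theta).  Expanding the characteristic
   equation to second order at theta gives m_0(t) - G(t, x) ~ sqrt (2 phi x) with
   phi = 1 / (t^3 G_xx(0, theta)), and Karamata's Tauberian theorem converts this into
   the tail asymptotics.  The constant Gamma(1/2) = sqrt PI enters by comparison with
   the coefficients C(2n, n) / 4^n of (1 - z)^{-1/2}, through Wallis' formula. *)
Require Import Defs.
From Stdlib Require Import Reals Lra Lia ZArith Classical_Prop.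
From Coquelicot Require Import Coquelicot.
Open Scope R_scope.
Set Bullet Behavior "Strict Subproofs".

(** * Wallis' sequence *)

(** Multiplying v_k by exp(k M) absorbs the possible jumps and leaves a genuine derivative. The
    series G is not differentiated in t either: its truncations are, with an error of order n exp(-n
    x), and a Gronwall argument is run on the limit. Nor is theta known to be continuous, so its
    minimality cannot simply be continued in time. To the right of theta it comes from the points x
    > 0 and the convexity of y + t G(0, y); to the left it needs a comparison argument in t. Finite
    support makes G(0, .) a finite sum of exponentials, smooth and convex on the whole line. The
    Tauberian step uses no approximation theorem: 1 - (1 - X)^m at X = r^k drops from 1 to 0 around
    r^k = 1/m and is an explicit substitute for the indicator of k <= n. *)

Lemma sum_n_ge_0 (a : nat -> R) (n : nat) : (forall k, 0 <= a k) -> 0 <= sum_n a n.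
Proof.
  intros H. induction n as [|n IH].
  - rewrite sum_O. apply H.
  - rewrite sum_Sn. apply Rplus_le_le_0_compat; [ exact IH | apply H ].
Qed.

Lemma Series_ge_0 (a : nat -> R) : (forall n, 0 <= a n) -> 0 <= Series a.
Proof.
  intros H. unfold Series.
  assert (L : Rbar_le (Lim_seq (fun _ => 0)) (Lim_seq (sum_n a))).
  { apply Lim_seq_le_loc. exists O. intros n _. apply sum_n_ge_0, H. }
  rewrite Lim_seq_const in L.
  destruct (Lim_seq (sum_n a)); simpl in *; lra.
Qed.

(* [wallis n] is [C(2n, n) / 4 ^ n]. *)
Fixpoint wallis (n : nat) : R :=
  match n with
  | O => 1
  | S n => wallis n * ((2 * INR n + 1) / (2 * INR n + 2))
  end.

Lemma wallis_pos (n : nat) : 0 < wallis n.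
Proof.
  induction n as [|n IH]; simpl; [ lra | ].
  pose proof (pos_INR n).
  apply Rmult_lt_0_compat; [ exact IH | apply Rdiv_lt_0_compat; lra ].
Qed.

Lemma wallis_S_le (n : nat) : wallis (S n) <= wallis n.
Proof.
  simpl. pose proof (wallis_pos n). pose proof (pos_INR n).
  rewrite <- (Rmult_1_r (wallis n)) at 2.
  apply Rmult_le_compat_l; [ lra | ].
  apply Rle_div_l; lra.
Qed.

Lemma wallis_le_1 (n : nat) : wallis n <= 1.
Proof.
  induction n as [|n IH]; [ simpl; lra | ].
  pose proof (wallis_S_le n); lra.
Qed.

Definition sin_int (n : nat) : R := RInt (fun x => sin x ^ n) 0 (PI / 2).

Lemma ex_RInt_sin_pow (n : nat) : ex_RInt (fun x => sin x ^ n) 0 (PI / 2).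
Proof.
  apply (ex_RInt_continuous (V := R_CompleteNormedModule)). intros x _.
  apply (ex_derive_continuous (V := R_NormedModule)). auto_derive. trivial.
Qed.

Lemma sin_int_SS (n : nat) :
  (INR n + 2) * sin_int (S (S n)) = (INR n + 1) * sin_int n.
Proof.
  (* Integration by parts: the integrand is the derivative of [- cos x * sin x ^ S n], which
     vanishes at both ends. *)
  assert (H : is_RInt (fun x => (INR n + 2) * sin x ^ (S (S n))
                                - (INR n + 1) * sin x ^ n) 0 (PI / 2)
             ((fun x => - cos x * sin x ^ (S n)) (PI / 2)
              - (fun x => - cos x * sin x ^ (S n)) 0)).
  { apply (is_RInt_derive (V := R_CompleteNormedModule)
             (fun x => - cos x * sin x ^ (S n))
             (fun x => (INR n + 2) * sin x ^ (S (S n)) - (INR n + 1) * sin x ^ n)).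
    - intros x _. auto_derive; [ trivial | ].
      assert (E : cos x * cos x = 1 - sin x * sin x)
        by (pose proof (sin2_cos2 x) as Q; unfold Rsqr in Q; lra).
      change (Init.Nat.pred (S n)) with n.
      replace (match n with O => 1 | S _ => INR n + 1 end) with (INR n + 1)
        by (destruct n; simpl; lra).
      transitivity (sin x ^ n * (sin x * sin x) - (INR n + 1) * sin x ^ n * (cos x * cos x)).
      + simpl. ring.
      + rewrite E; simpl; ring.
    - intros x _. apply (ex_derive_continuous (V := R_NormedModule)).
      auto_derive. trivial. }
  cbv beta in H. rewrite cos_PI2, sin_0, pow_i in H by lia.
  apply (is_RInt_unique (V := R_CompleteNormedModule)) in H.
  rewrite (RInt_minus (V := R_CompleteNormedModule)
             (fun x => (INR n + 2) * sin x ^ (S (S n)))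
             (fun x => (INR n + 1) * sin x ^ n)) in H.
  2: exact (ex_RInt_scal _ _ _ (INR n + 2) (ex_RInt_sin_pow (S (S n)))).
  2: exact (ex_RInt_scal _ _ _ (INR n + 1) (ex_RInt_sin_pow n)).
  rewrite (RInt_scal (V := R_CompleteNormedModule) (fun x => sin x ^ (S (S n)))) in H
    by apply ex_RInt_sin_pow.
  rewrite (RInt_scal (V := R_CompleteNormedModule) (fun x => sin x ^ n)) in H
    by apply ex_RInt_sin_pow.
  unfold minus, plus, opp, scal in H; simpl in H; unfold mult in H; simpl in H.
  fold (sin_int n) in H.
  change (RInt _ 0 (PI / 2)) with (sin_int (S (S n))) in H. lra.
Qed.

Lemma sin_int_0 : sin_int 0 = PI / 2.
Proof.
  unfold sin_int. rewrite (RInt_ext _ (fun _ => 1)) by (intros; reflexivity).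
  rewrite RInt_const. unfold scal; simpl; unfold mult; simpl. ring.
Qed.

Lemma sin_int_1 : sin_int 1 = 1.
Proof.
  unfold sin_int. apply (is_RInt_unique (V := R_CompleteNormedModule)).
  replace 1 with (- cos (PI / 2) - - cos 0) by (rewrite cos_PI2, cos_0; ring).
  apply (is_RInt_derive (V := R_CompleteNormedModule) (fun x => - cos x)).
  - intros x _. auto_derive; [ trivial | ring ].
  - intros x _. apply (ex_derive_continuous (V := R_NormedModule)).
    auto_derive. trivial.
Qed.

Lemma sin_int_S_le (n : nat) : sin_int (S n) <= sin_int n.
Proof.
  apply RInt_le; try apply ex_RInt_sin_pow.
  - pose proof PI_RGT_0; lra.
  - intros x Hx. simpl. rewrite <- (Rmult_1_l (sin x ^ n)) at 2.
    apply Rmult_le_compat_r; [ | apply SIN_bound ].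
    apply pow_le. apply sin_ge_0; pose proof PI_RGT_0; lra.
Qed.

Lemma sin_int_even (n : nat) : sin_int (2 * n) = wallis n * (PI / 2).
Proof.
  induction n as [|n IH].
  - simpl. rewrite sin_int_0. ring.
  - replace (2 * S n)%nat with (S (S (2 * n))) by lia.
    pose proof (sin_int_SS (2 * n)) as H. rewrite IH, mult_INR in H. simpl INR in H.
    pose proof (pos_INR n). simpl wallis.
    apply (Rmult_eq_reg_l (2 * INR n + 2)); [ | lra ].
    transitivity ((2 * INR n + 1) * (wallis n * (PI / 2))); [ lra | field; lra ].
Qed.

(** By the two-step recurrence, this product does not change from [n] to [n + 1]. *)
Lemma sin_int_mul_S (n : nat) : (INR n + 1) * (sin_int n * sin_int (S n)) = PI / 2.
Proof.
  induction n as [|n IH].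
  - rewrite sin_int_0, sin_int_1. simpl. ring.
  - rewrite S_INR. transitivity (sin_int (S n) * ((INR n + 2) * sin_int (S (S n)))); [ ring | ].
    rewrite sin_int_SS, <- IH. ring.
Qed.

(** In the invariant product at the indices 2n - 1 and 2n, the odd factor is replaced by
    [sin_int (2 * n)], which is respectively smaller and larger. *)
Lemma wallis_sqr_bounds (n : nat) :
  PI * INR n * (wallis n * wallis n) <= 1 <= PI * (INR n + 1 / 2) * (wallis n * wallis n).
Proof.
  pose proof PI_RGT_0 as HPI. pose proof (pos_INR n).
  pose proof (sin_int_even n) as E. pose proof (wallis_pos n) as W.
  assert (H0 : 0 < sin_int (2 * n)) by (rewrite E; apply Rmult_lt_0_compat; lra).
  split.
  - destruct n as [|n]; [ simpl; lra | ].
    replace (2 * S n)%nat with (S (S (2 * n))) in * by lia.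
    pose proof (sin_int_mul_S (S (2 * n))) as P.
    pose proof (sin_int_S_le (S (2 * n))) as L.
    rewrite S_INR, mult_INR in P. simpl (INR 2) in P. rewrite S_INR in *.
    assert (sin_int (S (S (2 * n))) * sin_int (S (S (2 * n)))
            <= sin_int (S (2 * n)) * sin_int (S (S (2 * n))))
      by (apply Rmult_le_compat_r; lra).
    assert ((2 * INR n + 1 + 1) * (sin_int (S (S (2 * n))) * sin_int (S (S (2 * n)))) <= PI / 2).
    { rewrite <- P. apply Rmult_le_compat_l; [ | lra ]. pose proof (pos_INR n); lra. }
    rewrite E in *. apply (Rmult_le_reg_l (PI / 2)); [ lra | ].
    eapply Rle_trans; [ | eapply Rle_trans; [ exact H2 | ] ]; right; field.
  - pose proof (sin_int_mul_S (2 * n)) as P.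
    pose proof (sin_int_S_le (2 * n)) as L.
    rewrite mult_INR in P. simpl (INR 2) in P.
    assert (sin_int (2 * n) * sin_int (S (2 * n)) <= sin_int (2 * n) * sin_int (2 * n))
      by (apply Rmult_le_compat_l; lra).
    assert (PI / 2 <= (2 * INR n + 1) * (sin_int (2 * n) * sin_int (2 * n))).
    { rewrite <- P. apply Rmult_le_compat_l; lra. }
    rewrite E in *. apply (Rmult_le_reg_l (PI / 2)); [ lra | ].
    eapply Rle_trans; [ | eapply Rle_trans; [ exact H2 | ] ]; right; field.
Qed.

(** The square of [wallis n] times n + 1 is nonincreasing and equals 1 at n = 0. This is the form of
    bound that the Tauberian estimate asks of its sequence. *)
Lemma wallis_le_inv_sqrt (n : nat) : wallis n <= 1 / sqrt (INR n + 1).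
Proof.
  assert (Q : (INR n + 1) * (wallis n * wallis n) <= 1).
  { induction n as [|n IH]; [ simpl; lra | ].
    rewrite S_INR. simpl wallis. pose proof (pos_INR n).
    eapply Rle_trans; [ | exact IH ].
    replace ((INR n + 1 + 1) * (wallis n * ((2 * INR n + 1) / (2 * INR n + 2)) *
               (wallis n * ((2 * INR n + 1) / (2 * INR n + 2)))))
      with ((INR n + 2) * ((2 * INR n + 1) * (2 * INR n + 1))
              / ((2 * INR n + 2) * (2 * INR n + 2)) * (wallis n * wallis n)) by (field; lra).
    apply Rmult_le_compat_r; [ apply Rle_0_sqr | ].
    apply Rle_div_l; nra. }
  pose proof (pos_INR n). pose proof (wallis_pos n).
  assert (S0 : 0 < sqrt (INR n + 1)) by (apply sqrt_lt_R0; lra).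
  apply Rle_div_r; [ exact S0 | ].
  apply Rsqr_incr_0_var; [ | lra ].
  unfold Rsqr. pose proof (sqrt_sqrt (INR n + 1) ltac:(lra)) as T.
  replace (wallis n * sqrt (INR n + 1) * (wallis n * sqrt (INR n + 1)))
    with (sqrt (INR n + 1) * sqrt (INR n + 1) * (wallis n * wallis n)) by ring.
  rewrite T. lra.
Qed.

Lemma lt_CV_radius_of_bounded (a : nat -> R) (C z : R) :
  (forall n, Rabs (a n) <= C) -> Rabs z < 1 -> Rbar_lt (Rabs z) (CV_radius a).
Proof.
  intros Ha Hz.
  apply Rbar_lt_le_trans with 1; [ exact Hz | ].
  apply (CV_radius_bounded a). exists C. intros n.
  rewrite pow1, Rmult_1_r. apply Ha.
Qed.

(** The ratio of consecutive coefficients says that f = [PSeries wallis] solves 2 (1 - x) f' = f, so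
    that f^2 (1 - x) is constant. *)
Lemma PSeries_wallis (z : R) : 0 <= z < 1 -> PSeries wallis z = 1 / sqrt (1 - z).
Proof.
  intros Hz.
  assert (Hb : forall n, Rabs (wallis n) <= 1)
    by (intros n; rewrite Rabs_pos_eq; [ apply wallis_le_1 | left; apply wallis_pos ]).
  assert (R1 : forall x, Rabs x < 1 -> Rbar_lt (Rabs x) (CV_radius wallis))
    by (intros; eapply lt_CV_radius_of_bounded; eauto).
  assert (ODE : forall x, Rabs x < 1 ->
            (1 - x) * PSeries (PS_derive wallis) x = PSeries wallis x / 2).
  { intros x Hx.
    assert (E1 : ex_pseries (PS_derive wallis) x)
      by (apply CV_radius_inside; rewrite CV_radius_derive; auto).
    assert (E0 : ex_pseries wallis x) by (apply CV_radius_inside; auto).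
    assert (E2 : PSeries wallis x / 2 = PSeries (PS_minus (PS_derive wallis) (PS_incr_1 (PS_derive wallis))) x).
    { transitivity (PSeries (PS_scal (1/2) wallis) x).
      - rewrite PSeries_scal. field.
      - apply PSeries_ext. intros n. unfold PS_minus, PS_plus, PS_opp, PS_scal, PS_incr_1, PS_derive.
        unfold plus, opp, scal; cbn -[INR wallis]; unfold mult; cbn -[INR wallis].
        destruct n as [|n].
        + unfold zero; simpl. field.
        + rewrite (S_INR (S n)). change (wallis (S (S n))) with
            (wallis (S n) * ((2 * INR (S n) + 1) / (2 * INR (S n) + 2))).
          pose proof (pos_INR (S n)). field. lra. }
    rewrite E2, PSeries_minus; [ rewrite PSeries_incr_1; ring | exact E1 | ].
    apply ex_pseries_incr_1. exact E1. }
  set (H := fun x => PSeries wallis x * PSeries wallis x * (1 - x)).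
  assert (HH : H z = H 0).
  { destruct (proj1 Hz) as [Hz0 | <-]; [ | reflexivity ].
    apply eq_sym. apply (eq_is_derive (V := R_NormedModule) H 0 z); [ | exact Hz0 ].
    intros t Ht. unfold H.
    assert (Rabs t < 1) by (rewrite Rabs_pos_eq; lra).
    pose proof (is_derive_PSeries wallis t (R1 t H0)) as D.
    evar_last.
    { apply (is_derive_mult (fun x => PSeries wallis x * PSeries wallis x) (fun x => 1 - x)).
      - apply (is_derive_mult (PSeries wallis) (PSeries wallis)); [ exact D | exact D | ].
        intros; apply Rmult_comm.
      - auto_derive; [ trivial | reflexivity ].
      - intros; apply Rmult_comm. }
    unfold plus, zero, mult; simpl. pose proof (ODE t H0) as O. 
    replace (PSeries wallis t) with (2 * ((1 - t) * PSeries (PS_derive wallis) t)) by lra.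
    ring. }
  (* The constant quantity determines the square only; positivity selects the root. *)
  assert (P : 0 < PSeries wallis z).
  { apply Rlt_le_trans with 1; [ lra | ].
    rewrite PSeries_decr_1 by (apply CV_radius_inside, R1; rewrite Rabs_pos_eq; lra).
    simpl (wallis 0). 
    assert (0 <= PSeries (PS_decr_1 wallis) z).
    { apply Series_ge_0. intros n.
      apply Rmult_le_pos; [ left; apply wallis_pos | apply pow_le; lra ]. }
    nra. }
  unfold H in HH. rewrite PSeries_0 in HH. simpl in HH.
  assert (S0 : 0 < sqrt (1 - z)) by (apply sqrt_lt_R0; lra).
  pose proof (sqrt_sqrt (1 - z) ltac:(lra)) as S2.
  apply (Rmult_eq_reg_r (sqrt (1 - z))); [ | lra ].
  replace (1 / sqrt (1 - z) * sqrt (1 - z)) with 1 by (field; lra).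
  rewrite <- S2 in HH at 1.
  assert (0 < PSeries wallis z * sqrt (1 - z)) by (apply Rmult_lt_0_compat; assumption).
  nra.
Qed.

(** * Karamata's Tauberian theorem with exponent 1/2 *)

Lemma sum_n_R_S (a : nat -> R) (n : nat) : sum_n a (S n) = sum_n a n + a (S n).
Proof. rewrite sum_Sn. reflexivity. Qed.

Lemma sum_n_R_ext (a b : nat -> R) (n : nat) :
  (forall k, (k <= n)%nat -> a k = b k) -> sum_n a n = sum_n b n.
Proof. apply (sum_n_ext_loc (G := R_AbelianMonoid)). Qed.

Lemma sum_n_le_compat (a b : nat -> R) (n : nat) :
  (forall k, (k <= n)%nat -> a k <= b k) -> sum_n a n <= sum_n b n.
Proof.
  intros H. induction n as [|n IH].
  - rewrite !sum_O. apply H; lia.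
  - rewrite !sum_n_R_S. apply Rplus_le_compat; [ apply IH; intros; apply H; lia | apply H; lia ].
Qed.

Lemma Rabs_sum_n_le (a : nat -> R) (n : nat) :
  Rabs (sum_n a n) <= sum_n (fun k => Rabs (a k)) n.
Proof.
  induction n as [|n IH].
  - rewrite !sum_O. lra.
  - rewrite !sum_n_R_S. eapply Rle_trans; [ apply Rabs_triang | lra ].
Qed.

Lemma sum_n_R_mult_l (c : R) (a : nat -> R) (n : nat) :
  sum_n (fun k => c * a k) n = c * sum_n a n.
Proof. exact (sum_n_mult_l c a n). Qed.

Lemma sum_n_R_plus (a b : nat -> R) (n : nat) :
  sum_n (fun k => a k + b k) n = sum_n a n + sum_n b n.
Proof. exact (sum_n_plus a b n). Qed.

Lemma Series_split (a : nat -> R) (n : nat) :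
  ex_series a -> Series a = sum_n a n + Series (fun k => a (S n + k)%nat).
Proof.
  intros H. rewrite (Series_incr_n a (S n)) by (lia || exact H).
  rewrite sum_n_Reals. reflexivity.
Qed.

Lemma ex_series_geom_bound (a : nat -> R) (C r : R) :
  0 <= r < 1 -> (forall n, Rabs (a n) <= C * r ^ n) -> ex_series a.
Proof.
  intros Hr H. apply (ex_series_le (V := R_CompleteNormedModule) a (fun n => C * r ^ n)).
  - exact H.
  - apply (ex_series_scal (V := R_NormedModule) C). apply ex_series_geom.
    rewrite Rabs_pos_eq; lra.
Qed.

Lemma Rabs_Series_geom_bound (a : nat -> R) (C r : R) :
  0 <= r < 1 -> (forall n, Rabs (a n) <= C * r ^ n) -> Rabs (Series a) <= C / (1 - r).
Proof.
  intros Hr H.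
  assert (E : ex_series (fun n => C * r ^ n)).
  { apply (ex_series_scal (V := R_NormedModule) C). apply ex_series_geom.
    rewrite Rabs_pos_eq; lra. }
  eapply Rle_trans; [ apply Series_Rabs | ].
  - apply (ex_series_le (V := R_CompleteNormedModule) _ (fun n => C * r ^ n)); [ | exact E ].
    intros n. change (Rabs (Rabs (a n)) <= C * r ^ n). rewrite Rabs_Rabsolu. apply H.
  - eapply Rle_trans; [ apply Series_le; [ | exact E ] | ].
    + intros n. split; [ apply Rabs_pos | apply H ].
    + rewrite Series_scal_l, Series_geom by (rewrite Rabs_pos_eq; lra). right. reflexivity.
Qed.

Lemma pow_unit_interval (x : R) (n : nat) : 0 <= x <= 1 -> 0 <= x ^ n <= 1.
Proof.
  intros H. split; [ apply pow_le; lra | ].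
  rewrite <- (pow1 n). apply pow_incr. exact H.
Qed.

Lemma one_sub_pow_le (y : R) (m : nat) : 0 <= y <= 1 -> 1 - (1 - y) ^ m <= INR m * y.
Proof.
  intros H. induction m as [|m IH]; [ simpl; lra | ].
  rewrite S_INR. simpl. pose proof (pow_unit_interval (1 - y) m ltac:(lra)). nra.
Qed.

Lemma exp_le (x y : R) : x <= y -> exp x <= exp y.
Proof. intros [H | ->]; [ left; apply exp_increasing; exact H | lra ]. Qed.

Lemma exp_neg_le (u : R) : 0 <= u <= 1 -> exp (- u) <= 1 - u / 2.
Proof.
  intros H. pose proof (exp_pos (- u)). pose proof (exp_ineq1_le u).
  assert (exp (- u) * exp u = 1) by (rewrite <- exp_plus, Rplus_opp_l; apply exp_0).
  nra.
Qed.

(** Induction works for the stronger factor 1 + m y. With y = r^k and m = r^(-n) the bound reads (1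
    - r^k)^m <= r^(n-k). *)
Lemma one_sub_pow_mul_le (y : R) (m : nat) :
  0 <= y <= 1 -> (1 - y) ^ m * (INR m * y) <= 1.
Proof.
  intros H.
  assert (B : (1 - y) ^ m * (1 + INR m * y) <= 1).
  { induction m as [|m IH]; [ simpl; lra | ].
    rewrite S_INR. simpl. pose proof (pow_unit_interval (1 - y) m ltac:(lra)).
    pose proof (pos_INR m).
    assert ((1 - y) * (1 + (INR m + 1) * y) <= 1 + INR m * y) by nra.
    apply Rle_trans with ((1 - y) ^ m * (1 + INR m * y)); [ | exact IH ].
    replace ((1 - y) * (1 - y) ^ m * (1 + (INR m + 1) * y))
      with ((1 - y) ^ m * ((1 - y) * (1 + (INR m + 1) * y))) by ring.
    apply Rmult_le_compat_l; lra. }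
  pose proof (pow_unit_interval (1 - y) m ltac:(lra)). lra.
Qed.

(** F(r) = o((1 - r)^(-1/2)) as r tends to 1 from below, that is, negligible against the generating
    function of [wallis]. *)
Definition abel_negligible (F : R -> R) : Prop :=
  forall eps, 0 < eps -> exists d, 0 < d < 1 /\
    forall r, 1 - d < r < 1 -> sqrt (1 - r) * Rabs (F r) <= eps.

Lemma abel_negligible_plus (F G H : R -> R) :
  abel_negligible F -> abel_negligible G ->
  (forall r, 0 < r < 1 -> Rabs (H r) <= Rabs (F r) + Rabs (G r)) -> abel_negligible H.
Proof.
  intros HF HG HH eps He.
  destruct (HF (eps / 2)) as [d1 [D1 F1]]; [ lra | ].
  destruct (HG (eps / 2)) as [d2 [D2 F2]]; [ lra | ].
  exists (Rmin d1 d2). split; [ unfold Rmin; destruct Rle_dec; lra | ].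
  intros r Hr. pose proof (Rmin_l d1 d2). pose proof (Rmin_r d1 d2).
  specialize (F1 r ltac:(lra)). specialize (F2 r ltac:(lra)).
  specialize (HH r ltac:(lra)). pose proof (sqrt_pos (1 - r)). nra.
Qed.

(** * Partial sums of a sequence with negligible Abel means *)

Section KaramataSums.

Variable e : nat -> R.
Variable C : R.
Hypothesis He : forall n, Rabs (e n) <= C / sqrt (INR n + 1).
Hypothesis Hsmall : abel_negligible (fun r => Series (fun n => e n * r ^ n)).

Lemma karamata_const_nonneg : 0 <= C.
Proof.
  pose proof (He 0) as H. simpl in H. rewrite Rplus_0_l, sqrt_1 in H.
  pose proof (Rabs_pos (e 0)). lra.
Qed.

Lemma karamata_bounded (n : nat) : Rabs (e n) <= C.
Proof.
  eapply Rle_trans; [ apply He | ]. pose proof karamata_const_nonneg. pose proof (pos_INR n).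
  assert (1 <= sqrt (INR n + 1)) by (rewrite <- sqrt_1 at 1; apply sqrt_le_1_alt; lra).
  apply Rle_div_l; nra.
Qed.

Lemma karamata_pow_ex (r : R) (m i : nat) :
  0 < r < 1 -> ex_series (fun n => e n * ((r ^ n) ^ S i * (1 - r ^ n) ^ m)).
Proof.
  intros Hr. apply (ex_series_geom_bound _ C r); [ lra | ].
  intros n. pose proof (pow_unit_interval r n ltac:(lra)) as P.
  pose proof (pow_unit_interval (r ^ n) i P). pose proof (pow_unit_interval (1 - r ^ n) m ltac:(lra)).
  rewrite Rabs_mult. apply Rmult_le_compat; try apply Rabs_pos; [ apply karamata_bounded | ].
  rewrite Rabs_pos_eq by (simpl; repeat apply Rmult_le_pos; lra).
  assert ((r ^ n) ^ i * (1 - r ^ n) ^ m <= 1) by nra. simpl. nra.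
Qed.

(** For m = 0 the series is the Abel mean at [r ^ S i], and 1 - r <= 1 - r^(i+1) <= (i+1)(1 - r)
    transfers the estimate. Expanding one factor 1 - r^n lowers m and raises i. The exponent [S i]
    excludes the constant term, for which the series need not converge. *)
Lemma karamata_pow (m i : nat) :
  abel_negligible (fun r => Series (fun n => e n * ((r ^ n) ^ S i * (1 - r ^ n) ^ m))).
Proof.
  revert i. induction m as [|m IH]; intros i.
  - intros eps Heps. destruct (Hsmall eps Heps) as [d [Hd H]].
    pose proof (pos_INR i) as Hi.
    exists (d / (INR i + 1)).
    assert (d / (INR i + 1) <= d) by (apply Rle_div_l; nra).
    assert (0 < d / (INR i + 1)) by (apply Rdiv_lt_0_compat; lra).
    split; [ lra | ].
    intros r Hr.
    assert (Hri : 1 - d < r ^ S i < 1).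
    { pose proof (one_sub_pow_le (1 - r) (S i) ltac:(lra)) as B.
      replace (1 - (1 - r)) with r in B by ring. rewrite S_INR in B.
      assert (INR i + 1 > 0) by lra.
      assert ((INR i + 1) * (1 - r) < (INR i + 1) * (d / (INR i + 1)))
        by (apply Rmult_lt_compat_l; lra).
      replace ((INR i + 1) * (d / (INR i + 1))) with d in * by (field; lra).
      split; [ lra | ]. simpl. pose proof (pow_unit_interval r i ltac:(lra)). nra. }
    rewrite (Series_ext _ (fun n => e n * (r ^ S i) ^ n)).
    2: { intros n. rewrite <- !pow_mult. simpl ((1 - _) ^ 0). rewrite Rmult_1_r.
         rewrite Nat.mul_comm. reflexivity. }
    eapply Rle_trans; [ | apply (H (r ^ S i) Hri) ].
    apply Rmult_le_compat_r; [ apply Rabs_pos | ].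
    apply sqrt_le_1_alt. simpl. pose proof (pow_unit_interval r i ltac:(lra)). nra.
  - apply (abel_negligible_plus _ _ _ (IH i) (IH (S i))).
    intros r Hr.
    rewrite (Series_ext _ (fun n => e n * ((r ^ n) ^ S i * (1 - r ^ n) ^ m)
                                    - e n * ((r ^ n) ^ S (S i) * (1 - r ^ n) ^ m)))
      by (intros n; simpl; ring).
    rewrite Series_minus by (apply karamata_pow_ex; exact Hr).
    eapply Rle_trans; [ apply Rabs_triang | rewrite Rabs_Ropp; lra ].
Qed.

Lemma karamata_step_ex (r : R) (m : nat) :
  0 < r < 1 -> ex_series (fun n => e n * (1 - (1 - r ^ n) ^ m)).
Proof.
  intros Hr. apply (ex_series_geom_bound _ (C * INR m) r); [ lra | ].
  intros n. pose proof (pow_unit_interval r n ltac:(lra)) as P.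
  pose proof (pow_unit_interval (1 - r ^ n) m ltac:(lra)).
  rewrite Rabs_mult, Rmult_assoc.
  apply Rmult_le_compat; try apply Rabs_pos; [ apply karamata_bounded | ].
  rewrite Rabs_pos_eq by lra. apply one_sub_pow_le; lra.
Qed.

(** 1 - (1 - X)^m is the sum of X (1 - X)^j over j < m. *)
Lemma karamata_step (m : nat) :
  abel_negligible (fun r => Series (fun n => e n * (1 - (1 - r ^ n) ^ m))).
Proof.
  induction m as [|m IH].
  - intros eps Heps. exists (1 / 2). split; [ lra | ]. intros r Hr.
    rewrite (Series_ext _ (fun n => 0 * (fun _ => 0) n)) by (intros; simpl; ring).
    rewrite Series_scal_l, Rmult_0_l, Rabs_R0. lra.
  - apply (abel_negligible_plus _ _ _ IH (karamata_pow m 0)).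
    intros r Hr.
    rewrite (Series_ext _ (fun n => e n * (1 - (1 - r ^ n) ^ m)
                                    + e n * ((r ^ n) ^ 1 * (1 - r ^ n) ^ m)))
      by (intros n; simpl; ring).
    rewrite Series_plus;
      [ apply Rabs_triang | apply karamata_step_ex; exact Hr | apply karamata_pow_ex; exact Hr ].
Qed.

Lemma sum_inv_sqrt_le (n : nat) :
  sum_n (fun k => / sqrt (INR k + 1)) n <= 2 * sqrt (INR n + 1).
Proof.
  induction n as [|n IH].
  - rewrite sum_O. simpl. rewrite Rplus_0_l, sqrt_1. lra.
  - rewrite sum_n_R_S, S_INR. pose proof (pos_INR n).
    set (x := sqrt (INR n + 1)) in *. set (y := sqrt (INR n + 1 + 1)).
    assert (Hx : x * x = INR n + 1) by (apply sqrt_sqrt; lra).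
    assert (Hy : y * y = INR n + 1 + 1) by (apply sqrt_sqrt; lra).
    assert (0 < y) by (apply sqrt_lt_R0; lra).
    assert (0 < x) by (apply sqrt_lt_R0; lra).
    (* Because 1 = y^2 - x^2 = (y - x)(y + x) <= 2 y (y - x). *)
    assert (/ y <= 2 * (y - x)); [ | lra ].
    apply (Rmult_le_reg_r y); [ lra | ]. rewrite Rinv_l by lra. nra.
Qed.

Lemma sum_pow_sub_le (r : R) (n : nat) :
  0 <= r < 1 -> sum_n (fun k => r ^ (n - k)) n <= / (1 - r).
Proof.
  intros Hr. induction n as [|n IH].
  - rewrite sum_O. simpl. rewrite <- Rinv_1 at 1. apply Rinv_le_contravar; lra.
  - rewrite sum_n_R_S, Nat.sub_diag.
    rewrite (sum_n_R_ext _ (fun k => r * r ^ (n - k))).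
    2: { intros k Hk. rewrite Nat.sub_succ_l by lia. reflexivity. }
    rewrite sum_n_R_mult_l. simpl.
    replace (/ (1 - r)) with (r * / (1 - r) + 1) by (field; lra).
    apply Rplus_le_compat_r, Rmult_le_compat_l; [ lra | exact IH ].
Qed.

(* With [r ^ n = 1 / m], [1 - (1 - r ^ k) ^ m] is within [r ^ |n - k|] of the
   indicator of [k <= n]. *)
Lemma karamata_step_error (m n : nat) (r : R) :
  (1 <= m)%nat -> 0 < r < 1 -> r ^ n * INR m = 1 ->
  Rabs (sum_n e n - Series (fun k => e k * (1 - (1 - r ^ k) ^ m)))
  <= C * (2 * sqrt (INR n + 1) / sqrt (INR m) + 3 / (sqrt (INR n + 1) * (1 - r))).
Proof.
  intros Hm Hr Hrn.
  pose proof karamata_const_nonneg as HC.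
  assert (Hm1 : 1 <= INR m) by (apply (le_INR 1); exact Hm).
  pose proof (pos_INR n) as Hn.
  assert (Sm : 0 < sqrt (INR m)) by (apply sqrt_lt_R0; lra).
  assert (Sn : 0 < sqrt (INR n + 1)) by (apply sqrt_lt_R0; lra).
  assert (P : forall k, 0 < r ^ k <= 1).
  { intros k. split; [ apply pow_lt; lra | apply pow_unit_interval; lra ]. }
  rewrite (Series_split _ n) by (apply karamata_step_ex; exact Hr).
  set (T := Series _).
  (* Beyond [n], Bernoulli gives 1 - (1 - r^k)^m <= m r^k = r^(k-n), a geometric tail. *)
  assert (HT : Rabs T <= C / sqrt (INR n + 1) / (1 - r)).
  { apply Rabs_Series_geom_bound; [ lra | ].
    intros k. rewrite Rabs_mult.
    pose proof (pow_unit_interval (1 - r ^ (S n + k)) m) as Q.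
    specialize (P (S n + k)%nat) as P'. specialize (Q ltac:(lra)).
    apply Rmult_le_compat; try apply Rabs_pos.
    - eapply Rle_trans; [ apply He | ].
      apply Rmult_le_compat_l; [ exact HC | ].
      apply Rinv_le_contravar; [ exact Sn | ]. apply sqrt_le_1_alt.
      rewrite plus_INR, S_INR. pose proof (pos_INR k). lra.
    - rewrite Rabs_pos_eq by lra.
      eapply Rle_trans; [ apply one_sub_pow_le; lra | ].
      replace (S n + k)%nat with (n + (1 + k))%nat by lia. rewrite pow_add.
      replace (INR m * (r ^ n * r ^ (1 + k))) with (r ^ n * INR m * r ^ (1 + k)) by ring.
      rewrite Hrn. simpl. specialize (P k). nra. }
  assert (HS : Rabs (sum_n e n - sum_n (fun k => e k * (1 - (1 - r ^ k) ^ m)) n)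
               <= C * (2 * sqrt (INR n + 1) / sqrt (INR m) + 2 / (sqrt (INR n + 1) * (1 - r)))).
  { replace (sum_n e n - sum_n (fun k => e k * (1 - (1 - r ^ k) ^ m)) n)
      with (sum_n (fun k => e k * (1 - r ^ k) ^ m) n).
    2: { rewrite (sum_n_R_ext e (fun k => e k * (1 - r ^ k) ^ m + e k * (1 - (1 - r ^ k) ^ m)))
           by (intros; simpl; ring).
         rewrite sum_n_R_plus. apply Rminus_diag_uniq. ring. }
    eapply Rle_trans; [ apply Rabs_sum_n_le | ].
    (* The first summand covers 2k <= n, where r^(n-k) <= r^(n/2) = 1/sqrt(m); the second covers 2k
       > n, where 1/sqrt(k+1) <= 2/sqrt(n+1). *)
    apply Rle_trans with
      (sum_n (fun k => C / sqrt (INR m) * / sqrt (INR k + 1)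
                       + 2 * C / sqrt (INR n + 1) * r ^ (n - k)) n).
    - apply sum_n_le_compat. intros k Hk.
      pose proof (pos_INR k) as Hk0.
      assert (Sk : 0 < sqrt (INR k + 1)) by (apply sqrt_lt_R0; lra).
      pose proof (pow_unit_interval (1 - r ^ k) m ltac:(specialize (P k); lra)) as Q.
      assert (D : (1 - r ^ k) ^ m <= r ^ (n - k)).
      { pose proof (one_sub_pow_mul_le (r ^ k) m ltac:(specialize (P k); lra)) as B.
        assert (E : r ^ n = r ^ (n - k) * r ^ k) by (rewrite <- pow_add; f_equal; lia).
        rewrite E in Hrn. pose proof (P k) as Pk.
        assert (0 < r ^ k * INR m) by nra.
        apply (Rmult_le_reg_r (r ^ k * INR m)); [ assumption | ]. lra. }
      rewrite Rabs_mult, (Rabs_pos_eq ((1 - r ^ k) ^ m)) by lra.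
      apply Rle_trans with (C / sqrt (INR k + 1) * r ^ (n - k)).
      { apply Rmult_le_compat; try apply Rabs_pos; try apply He; lra. }
      pose proof (P (n - k)%nat) as Pd.
      assert (0 <= C / sqrt (INR k + 1)) by (apply Rdiv_le_0_compat; lra).
      assert (0 <= C / sqrt (INR n + 1)) by (apply Rdiv_le_0_compat; lra).
      destruct (Nat.le_gt_cases (2 * k) n) as [Hk2 | Hk2].
      + assert (r ^ (n - k) <= / sqrt (INR m)).
        { apply (Rmult_le_reg_r (sqrt (INR m))); [ exact Sm | ]. rewrite Rinv_l by lra.
          apply Rsqr_incr_0_var; [ | lra ]. unfold Rsqr.
          replace (r ^ (n - k) * sqrt (INR m) * (r ^ (n - k) * sqrt (INR m)))
            with (r ^ (n - k) * r ^ (n - k) * (sqrt (INR m) * sqrt (INR m))) by ring.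
          rewrite sqrt_sqrt, <- pow_add by lra. rewrite Rmult_1_l, <- Hrn at 1.
          apply Rmult_le_compat_r; [ lra | ].
          replace (n - k + (n - k))%nat with (n + (n - 2 * k))%nat by lia.
          rewrite pow_add. pose proof (P n). pose proof (P (n - 2 * k)%nat). nra. }
        assert (0 <= 2 * C / sqrt (INR n + 1) * r ^ (n - k)).
        { apply Rmult_le_pos; [ | lra ]. apply Rdiv_le_0_compat; lra. }
        replace (C / sqrt (INR m) * / sqrt (INR k + 1))
          with (C / sqrt (INR k + 1) * / sqrt (INR m)) by (field; lra).
        pose proof (Rmult_le_compat_l (C / sqrt (INR k + 1)) _ _ ltac:(assumption) H1). lra.
      + assert (0 <= C / sqrt (INR m) * / sqrt (INR k + 1)).
        { apply Rmult_le_pos; [ apply Rdiv_le_0_compat; lra | ].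
          left; apply Rinv_0_lt_compat; lra. }
        assert (C / sqrt (INR k + 1) <= 2 * C / sqrt (INR n + 1)).
        { assert (sqrt (INR n + 1) <= 2 * sqrt (INR k + 1)).
          { rewrite <- (sqrt_square 2), <- sqrt_mult by lra. apply sqrt_le_1_alt.
            apply lt_INR in Hk2. rewrite mult_INR in Hk2. simpl (INR 2) in Hk2. lra. }
          apply Rle_div_l; [ exact Sk | ].
          replace (2 * C / sqrt (INR n + 1) * sqrt (INR k + 1))
            with (C * (2 * sqrt (INR k + 1)) / sqrt (INR n + 1)) by (field; lra).
          apply Rle_div_r; [ exact Sn | ]. apply Rmult_le_compat_l; lra. }
        assert (C / sqrt (INR k + 1) * r ^ (n - k) <= 2 * C / sqrt (INR n + 1) * r ^ (n - k))
          by (apply Rmult_le_compat_r; lra).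
        lra.
    - rewrite sum_n_R_plus, !sum_n_R_mult_l.
      pose proof (sum_inv_sqrt_le n) as B1.
      pose proof (sum_pow_sub_le r n ltac:(lra)) as B2.
      assert (0 <= C / sqrt (INR m)) by (apply Rdiv_le_0_compat; lra).
      assert (0 <= 2 * C / sqrt (INR n + 1)) by (apply Rdiv_le_0_compat; lra).
      apply (Rmult_le_compat_l _ _ _ H) in B1. apply (Rmult_le_compat_l _ _ _ H0) in B2.
      replace (C * (2 * sqrt (INR n + 1) / sqrt (INR m) + 2 / (sqrt (INR n + 1) * (1 - r))))
        with (C / sqrt (INR m) * (2 * sqrt (INR n + 1))
              + 2 * C / sqrt (INR n + 1) * / (1 - r)) by (field; lra).
      lra. }
  replace (sum_n e n - (sum_n (fun k => e k * (1 - (1 - r ^ k) ^ m)) n + T))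
    with (sum_n e n - sum_n (fun k => e k * (1 - (1 - r ^ k) ^ m)) n + - T) by ring.
  eapply Rle_trans; [ apply Rabs_triang | rewrite Rabs_Ropp ].
  replace (C * (2 * sqrt (INR n + 1) / sqrt (INR m) + 3 / (sqrt (INR n + 1) * (1 - r))))
    with (C * (2 * sqrt (INR n + 1) / sqrt (INR m) + 2 / (sqrt (INR n + 1) * (1 - r)))
          + C / sqrt (INR n + 1) / (1 - r)) by (field; lra).
  lra.
Qed.

(** The order of choices matters: [m] depends on [eps] alone and fixes the polynomial; only then is
    [n] taken large, with [r] tied to it by r^n = 1/m. *)
Lemma karamata_sum (eps : R) :
  0 < eps -> exists N, forall n, (N <= n)%nat -> Rabs (sum_n e n) <= eps * sqrt (INR n + 1).
Proof.
  intros Heps. pose proof karamata_const_nonneg as HC.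
  (* m > 1/q^2 bounds 2/sqrt(m) by 2q and ln m > 1/q bounds the other error by 6q; the total 8 C q
     is at most eps/2, the other half being left for the Abel mean. *)
  set (q := eps / (16 * (C + 1))).
  assert (Hq : 0 < q) by (apply Rdiv_lt_0_compat; lra).
  assert (HCq : 16 * C * q <= eps).
  { unfold q. replace (16 * C * (eps / (16 * (C + 1)))) with (eps * C / (C + 1)) by (field; lra).
    apply Rle_div_l; nra. }
  destruct (nfloor_ex (Rmax (/ (q * q)) (exp (/ q)))) as [m' [_ Hm']].
  { eapply Rle_trans; [ | apply Rmax_r ]. left; apply exp_pos. }
  set (m := S m').
  assert (Hmq : / (q * q) < INR m /\ exp (/ q) < INR m).
  { unfold m. rewrite S_INR.
    pose proof (Rmax_l (/ (q * q)) (exp (/ q))). pose proof (Rmax_r (/ (q * q)) (exp (/ q))). lra. }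
  destruct Hmq as [Hmq1 Hmq2]. clear Hm'.
  set (s := ln (INR m)).
  assert (Hs : / q < s).
  { unfold s. rewrite <- (ln_exp (/ q)). apply ln_increasing; [ apply exp_pos | exact Hmq2 ]. }
  assert (Hs0 : 0 < s) by (pose proof (Rinv_0_lt_compat q Hq); lra).
  assert (Hm0 : 0 < INR m) by (apply lt_0_INR; unfold m; lia).
  destruct (karamata_step m (eps / 2 * sqrt (s / 4))) as [d [Hd Hsm]].
  { apply Rmult_lt_0_compat; [ lra | ]. apply sqrt_lt_R0; lra. }
  destruct (nfloor_ex (s / d)) as [N [_ HN]]; [ apply Rdiv_le_0_compat; lra | ].
  exists (S N). intros n Hn.
  assert (Hn1 : s / d < INR n) by (apply le_INR in Hn; rewrite S_INR in Hn; lra).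
  assert (Hsd : s <= s / d) by (apply Rle_div_r; nra).
  assert (Hn0 : 0 < INR n) by lra.
  assert (Hu : 0 < s / INR n < d).
  { split; [ apply Rdiv_lt_0_compat; lra | ]. apply Rlt_div_l; [ exact Hn0 | ].
    apply Rlt_div_l in Hn1; lra. }
  (* Then r^n = exp(-s) = 1/m, and 1 - r lies between s/(2n) and s/n, so that sqrt(1 - r) sqrt(n +
     1) is at least sqrt(s/4), a constant fixed together with m. *)
  set (r := exp (- (s / INR n))).
  assert (Hr1 : 1 - r <= s / INR n) by (pose proof (exp_ineq1_le (- (s / INR n))); unfold r; lra).
  assert (Hr2 : s / INR n / 2 <= 1 - r).
  { pose proof (exp_neg_le (s / INR n) ltac:(lra)). unfold r. lra. }
  assert (Hr0 : 0 < r) by apply exp_pos.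
  assert (Hrn : r ^ n * INR m = 1).
  { unfold r. rewrite <- (exp_ln (INR m)) by exact Hm0. fold s.
    rewrite <- Rpower_pow by apply exp_pos. unfold Rpower. rewrite ln_exp, <- exp_plus.
    replace (INR n * - (s / INR n) + s) with 0 by (field; lra). apply exp_0. }
  pose proof (karamata_step_error m n r ltac:(unfold m; lia) ltac:(lra) Hrn) as E.
  specialize (Hsm r ltac:(lra)).
  set (W := Series _) in *.
  set (x := sqrt (INR n + 1)) in *.
  assert (Hx : x * x = INR n + 1) by (apply sqrt_sqrt; lra).
  assert (Hx0 : 0 < x) by (apply sqrt_lt_R0; lra).
  assert (HW : Rabs W <= eps / 2 * x).
  { assert (Q : sqrt (s / 4) <= x * sqrt (1 - r)).
    { unfold x. rewrite <- sqrt_mult by lra. apply sqrt_le_1_alt.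
      assert (s / INR n / 2 * INR n = s / 2) by (field; lra). nra. }
    assert (Q0 : 0 < sqrt (1 - r)) by (apply sqrt_lt_R0; lra).
    apply (Rmult_le_reg_l (sqrt (1 - r))); [ exact Q0 | ].
    eapply Rle_trans; [ exact Hsm | ]. nra. }
  assert (E1 : 2 * x / sqrt (INR m) <= 2 * x * q).
  { apply Rmult_le_compat_l; [ lra | ].
    rewrite <- (Rinv_inv q). apply Rinv_le_contravar; [ apply Rinv_0_lt_compat; lra | ].
    rewrite <- (sqrt_square (/ q)) by (left; apply Rinv_0_lt_compat; lra).
    apply sqrt_le_1_alt. rewrite <- Rinv_mult. lra. }
  assert (E2 : 3 / (x * (1 - r)) <= 6 * x / s).
  { apply Rle_div_l; [ nra | ].
    replace (6 * x / s * (x * (1 - r))) with (6 * (x * x) * (1 - r) / s) by (field; lra).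
    apply Rle_div_r; [ lra | ]. rewrite Hx.
    assert (s / INR n / 2 * INR n = s / 2) by (field; lra). nra. }
  assert (E3 : 6 * x / s <= 6 * x * q).
  { apply Rmult_le_compat_l; [ lra | ].
    rewrite <- (Rinv_inv q). apply Rinv_le_contravar; [ apply Rinv_0_lt_compat; lra | lra ]. }
  pose proof (Rabs_triang (sum_n e n - W) W) as Tr.
  replace (sum_n e n - W + W) with (sum_n e n) in Tr
    by (apply Rminus_diag_uniq; ring).
  assert (C * (2 * x / sqrt (INR m) + 3 / (x * (1 - r))) <= C * (8 * x * q))
    by (apply Rmult_le_compat_l; lra).
  assert (x * (16 * C * q) <= x * eps) by (apply Rmult_le_compat_l; lra).
  lra.
Qed.

End KaramataSums.

(** * From partial sums back to terms *)

Lemma sum_n_decr_bounds (u : nat -> R) (n h : nat) :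
  (forall k, u (S k) <= u k) ->
  INR h * u (n + h)%nat <= sum_n u (n + h) - sum_n u n <= INR h * u n.
Proof.
  intros Hu.
  assert (D : forall k, u (n + k)%nat <= u n).
  { induction k as [|k IH]; [ rewrite Nat.add_0_r; lra | ].
    rewrite Nat.add_succ_r. specialize (Hu (n + k)%nat). lra. }
  induction h as [|h IH].
  - rewrite Nat.add_0_r. simpl. lra.
  - rewrite Nat.add_succ_r, sum_n_R_S, S_INR.
    pose proof (Hu (n + h)%nat). pose proof (D (S h)) as D'. rewrite Nat.add_succ_r in D'.
    pose proof (pos_INR h). nra.
Qed.

(** Each step loses exactly [wallis k / (2 * INR k + 2)], which decreases in k. Over a window of
    length h the comparison sequence thus varies by a fraction of order h/n. *)
Lemma wallis_sub_le (n h : nat) :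
  wallis n - wallis (n + h) <= INR h * (wallis n / (2 * INR n + 2)).
Proof.
  assert (D : forall k, wallis (n + k) <= wallis n).
  { induction k as [|k IH]; [ rewrite Nat.add_0_r; lra | ].
    rewrite Nat.add_succ_r. pose proof (wallis_S_le (n + k)). lra. }
  pose proof (wallis_pos n). pose proof (pos_INR n).
  induction h as [|h IH].
  - rewrite Nat.add_0_r. simpl. lra.
  - rewrite Nat.add_succ_r, S_INR.
    assert (wallis (n + h) - wallis (S (n + h)) <= wallis n / (2 * INR n + 2)); [ | lra ].
    replace (wallis (n + h) - wallis (S (n + h)))
      with (wallis (n + h) / (2 * INR (n + h) + 2)).
    2: { simpl. field. pose proof (pos_INR (n + h)). lra. }
    pose proof (wallis_pos (n + h)). pose proof (pos_INR h).
    apply Rmult_le_compat; [ lra | left; apply Rinv_0_lt_compat | apply D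
                           | apply Rinv_le_contravar ];
      rewrite ?plus_INR; lra.
Qed.

Lemma is_lim_seq_sqrt_wallis : is_lim_seq (fun n => sqrt (INR n) * wallis n) (1 / sqrt PI).
Proof.
  pose proof PI_RGT_0 as HPI.
  replace (1 / sqrt PI) with (sqrt (/ PI)) by (rewrite sqrt_inv; field; apply Rgt_not_eq, sqrt_lt_R0; lra).
  apply (is_lim_seq_ext (fun n => sqrt (INR n * (wallis n * wallis n)))).
  { intros n. rewrite sqrt_mult_alt by apply pos_INR.
    rewrite sqrt_square; [ reflexivity | left; apply wallis_pos ]. }
  apply is_lim_seq_continuous; [ apply sqrt_continuity_pt, Rinv_0_lt_compat; lra | ].
  apply (is_lim_seq_le_le (fun n => / PI - / PI * / (INR n + 1)) _ (fun _ => / PI)).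
  - intros n. destruct (wallis_sqr_bounds n) as [L U]. pose proof (pos_INR n).
    assert (HP : 0 < / PI) by (apply Rinv_0_lt_compat; lra).
    set (w := wallis n * wallis n) in *.
    split.
    + assert (U' : / PI <= (INR n + 1) * w).
      { apply (Rmult_le_reg_l PI); [ lra | ]. rewrite Rinv_r by lra.
        assert (0 <= w) by (apply Rle_0_sqr). nra. }
      apply (Rmult_le_reg_r (INR n + 1)); [ lra | ].
      replace ((/ PI - / PI * / (INR n + 1)) * (INR n + 1)) with (INR n * / PI) by (field; lra).
      nra.
    + apply (Rmult_le_reg_l PI); [ lra | ]. rewrite Rinv_r by lra. lra.
  - replace (Finite (/ PI)) with (Finite (/ PI - / PI * 0)) by (f_equal; ring).
    apply is_lim_seq_minus'; [ apply is_lim_seq_const | ].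
    apply is_lim_seq_mult'; [ apply is_lim_seq_const | ].
    apply (is_lim_seq_ext (fun n => / INR (S n))); [ intros; rewrite S_INR; reflexivity | ].
    apply -> (is_lim_seq_incr_1 (fun n => / INR n)).
    replace (Finite 0) with (Rbar_inv p_infty) by reflexivity.
    apply is_lim_seq_inv; [ apply is_lim_seq_INR | discriminate ].
  - apply is_lim_seq_const.
Qed.

(** Monotonicity is the Tauberian condition and acts twice: it yields the a priori bound
    O(n^(-1/2)), and it recovers a term from the sums over neighbouring windows. Since [c * wallis]
    has the same Abel asymptotics, only the difference [e] has to be estimated. *)
Lemma karamata_half (b : nat -> R) (c : R) :
  0 <= c -> (forall n, 0 <= b n) -> (forall n, b (S n) <= b n) ->
  filterlim (fun z => sqrt (1 - z) * Series (fun n => b n * z ^ n)) (at_left 1) (locally c) ->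
  is_lim_seq (fun n => sqrt (INR n) * b n) (c / sqrt PI).
Proof.
  intros Hc Hb Hdecr Hlim.
  assert (Hb0 : forall n, b n <= b O).
  { induction n as [|n IH]; [ lra | specialize (Hdecr n); lra ]. }
  assert (Hexb : forall z, 0 < z < 1 -> ex_series (fun n => b n * z ^ n)).
  { intros z Hz. apply (ex_series_geom_bound _ (b O) z); [ lra | ].
    intros n. pose proof (pow_unit_interval z n ltac:(lra)).
    rewrite Rabs_pos_eq by (apply Rmult_le_pos; [ apply Hb | lra ]).
    apply Rmult_le_compat_r; [ lra | apply Hb0 ]. }
  assert (Hexw : forall z, 0 < z < 1 -> ex_series (fun n => wallis n * z ^ n)).
  { intros z Hz. apply (ex_series_geom_bound _ 1 z); [ lra | ].
    intros n. pose proof (pow_unit_interval z n ltac:(lra)). pose proof (wallis_pos n).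
    rewrite Rabs_pos_eq by (apply Rmult_le_pos; lra).
    apply Rmult_le_compat_r; [ lra | apply wallis_le_1 ]. }
  assert (Hloc : forall eps, 0 < eps -> exists d, 0 < d < 1 /\ forall z, 1 - d < z < 1 ->
            Rabs (sqrt (1 - z) * Series (fun n => b n * z ^ n) - c) < eps).
  { intros eps Heps.
    destruct (proj1 (filterlim_locally _ _) Hlim (mkposreal eps Heps)) as [d Hd].
    exists (Rmin d (1 / 2)). pose proof (cond_pos d) as Hd0.
    pose proof (Rmin_l d (1 / 2)). pose proof (Rmin_r d (1 / 2)).
    assert (0 < Rmin d (1 / 2)) by (unfold Rmin; destruct Rle_dec; lra).
    split; [ lra | ]. intros z Hz. apply Hd; [ | lra ].
    unfold ball; simpl; unfold AbsRing_ball, abs, minus, plus, opp; simpl.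
    apply Rabs_lt_between; lra. }
  (* At z = exp(-1/(n+1)) each of the first n + 1 terms is at least [b n * exp (- 1)], while 1 - z
     is of order 1/(n+1). The first summand of the constant handles the indices up to [N], whose z
     is too far from 1. *)
  assert (HC : exists C, 0 < C /\ forall n, b n <= C / sqrt (INR n + 1)).
  { destruct (Hloc 1 Rlt_0_1) as [d [Hd H]].
    destruct (nfloor_ex (/ d)) as [N [_ HN]]; [ left; apply Rinv_0_lt_compat; lra | ].
    pose proof (Hb O) as Hb00. pose proof (exp_pos 1) as He1.
    assert (0 <= sqrt (INR N + 1)) by apply sqrt_pos.
    exists (b O * sqrt (INR N + 1) + 2 * exp 1 * (c + 1)).
    assert (P1 : 0 <= b O * sqrt (INR N + 1)) by (apply Rmult_le_pos; lra).
    assert (P2 : 0 < 2 * exp 1 * (c + 1)) by (apply Rmult_lt_0_compat; lra).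
    split; [ lra | ]. intros n. pose proof (pos_INR n) as Hn.
    assert (Sn : 0 < sqrt (INR n + 1)) by (apply sqrt_lt_R0; lra).
    apply Rle_div_r; [ exact Sn | ].
    destruct (Rle_lt_dec (INR n) (INR N)) as [Hle | Hlt].
    - apply Rle_trans with (b O * sqrt (INR N + 1)); [ | lra ].
      apply Rmult_le_compat; [ apply Hb | lra | apply Hb0 | apply sqrt_le_1_alt; lra ].
    - apply Rle_trans with (2 * exp 1 * (c + 1)); [ | lra ].
      apply INR_lt in Hlt. assert (INR N + 1 <= INR n) by (rewrite <- S_INR; apply le_INR; lia).
      set (u := / (INR n + 1)).
      assert (Hu : 0 < u < d).
      { split; [ apply Rinv_0_lt_compat; lra | ]. rewrite <- (Rinv_inv d).
        apply Rinv_lt_contravar; [ | lra ]. apply Rmult_lt_0_compat; [ | lra ].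
        apply Rinv_0_lt_compat; lra. }
      assert (Hun : u * (INR n + 1) = 1) by (unfold u; field; lra).
      set (z := exp (- u)).
      assert (Hz1 : 1 - z <= u) by (pose proof (exp_ineq1_le (- u)); unfold z; lra).
      assert (Hz2 : u / 2 <= 1 - z) by (pose proof (exp_neg_le u ltac:(lra)); unfold z; lra).
      assert (Hz0 : 0 < z) by apply exp_pos.
      specialize (H z ltac:(lra)). apply Rabs_lt_between in H.
      assert (Low : b n * (INR n + 1) * exp (- 1) <= Series (fun n => b n * z ^ n)).
      { rewrite (Series_split _ n) by (apply Hexb; lra).
        assert (0 <= Series (fun k => b (S n + k)%nat * z ^ (S n + k))).
        { apply Series_ge_0. intros k. apply Rmult_le_pos; [ apply Hb | apply pow_le; lra ]. }
        apply Rle_trans with (sum_n (fun k => b k * z ^ k) n); [ | lra ].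
        apply Rle_trans with (sum_n (fun _ => b n * exp (- 1)) n).
        - right. rewrite sum_n_const, S_INR. ring.
        - apply sum_n_le_compat. intros k Hk.
          assert (Hkb : b n <= b k).
          { clear - Hk Hdecr. induction Hk as [|m Hk IH]; [ lra | specialize (Hdecr m); lra ]. }
          apply Rmult_le_compat; [ apply Hb | left; apply exp_pos | exact Hkb | ].
          unfold z. rewrite <- Rpower_pow by apply exp_pos. unfold Rpower. rewrite ln_exp.
          assert (INR k * u <= 1).
          { rewrite <- Hun. rewrite Rmult_comm. apply Rmult_le_compat_l; [ lra | ].
            apply le_INR in Hk. lra. }
          apply exp_le. lra. }
      set (F := Series _) in *.
      assert (Hexp : exp (- 1) * exp 1 = 1)
        by (rewrite <- exp_plus; replace (- 1 + 1) with 0 by ring; apply exp_0).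
      set (x := sqrt (INR n + 1)) in *.
      assert (Hx : x * x = INR n + 1) by (apply sqrt_sqrt; lra).
      assert (Q : / x / 2 <= sqrt (1 - z)).
      { apply Rle_trans with (sqrt (u / 4)).
        - right. unfold u. rewrite <- Hx.
          replace (/ (x * x) / 4) with ((/ x / 2) * (/ x / 2)) by (field; lra).
          rewrite sqrt_square; [ reflexivity | ].
          pose proof (Rinv_0_lt_compat x Sn); lra.
        - apply sqrt_le_1_alt. lra. }
      assert (HF : / x / 2 * F <= c + 1).
      { assert (0 <= F).
        { eapply Rle_trans; [ | exact Low ].
          repeat apply Rmult_le_pos; [ apply Hb | lra | left; apply exp_pos ]. }
        apply Rle_trans with (sqrt (1 - z) * F); [ apply Rmult_le_compat_r; lra | lra ]. }
      assert (HF2 : / x / 2 * (b n * (INR n + 1) * exp (- 1)) <= c + 1).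
      { eapply Rle_trans; [ | exact HF ]. apply Rmult_le_compat_l; [ | exact Low ].
        pose proof (Rinv_0_lt_compat x Sn); lra. }
      rewrite <- Hx in HF2.
      replace (/ x / 2 * (b n * (x * x) * exp (-1))) with (b n * x * exp (- 1) / 2) in HF2
        by (field; lra).
      replace (b n * x) with (2 * exp 1 * (b n * x * exp (- 1) / 2))
        by (transitivity (b n * x * (exp (- 1) * exp 1)); [ field | rewrite Hexp; ring ]).
      apply Rmult_le_compat_l; lra. }
  destruct HC as [C [HC0 HC]].
  set (e := fun n => b n - c * wallis n).
  assert (He : forall n, Rabs (e n) <= (C + c) / sqrt (INR n + 1)).
  { intros n. unfold e. specialize (HC n). pose proof (wallis_le_inv_sqrt n) as W.
    pose proof (wallis_pos n). specialize (Hb n).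
    assert (0 <= c * wallis n) by (apply Rmult_le_pos; lra).
    apply (Rmult_le_compat_l c) in W; [ | exact Hc ].
    replace ((C + c) / sqrt (INR n + 1)) with (C / sqrt (INR n + 1) + c * (1 / sqrt (INR n + 1)))
      by (field; apply Rgt_not_eq, sqrt_lt_R0; pose proof (pos_INR n); lra).
    apply Rabs_le_between; lra. }
  assert (Hneg : abel_negligible (fun r => Series (fun n => e n * r ^ n))).
  { intros eps Heps. destruct (Hloc eps Heps) as [d [Hd H]]. exists d. split; [ exact Hd | ].
    intros r Hr. specialize (H r Hr).
    rewrite (Series_ext _ (fun n => b n * r ^ n - c * (wallis n * r ^ n)))
      by (intros; unfold e; ring).
    rewrite Series_minus.
    2: apply Hexb; lra.
    2: apply (ex_series_scal (V := R_NormedModule) c), Hexw; lra.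
    rewrite Series_scal_l. fold (PSeries wallis r). rewrite PSeries_wallis by lra.
    assert (S0 : 0 < sqrt (1 - r)) by (apply sqrt_lt_R0; lra).
    rewrite <- (Rabs_pos_eq (sqrt (1 - r))) at 1 by lra. rewrite <- Rabs_mult.
    left. eapply Rle_lt_trans; [ right | exact H ]. f_equal. field. lra. }
  assert (Hzero : is_lim_seq (fun n => sqrt (INR n) * e n) 0).
  { apply is_lim_seq_spec. intros [eps Heps]; simpl.
    (* [d] is the relative width of the window, [h] being the integer part of d n. The variation of
       [c * wallis] costs 2 c d <= eps/4; the partial sums, below 2 q sqrt(n), cost 4 q n =
       (eps/4)(d n/2) <= (eps/4) h. Together this is eps/2 < eps. *)
    set (d := eps / (8 * c + 4 * eps)).
    assert (Hden : 0 < 8 * c + 4 * eps) by lra.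
    assert (Hd0 : 0 < d) by (apply Rdiv_lt_0_compat; lra).
    assert (Hd1 : d <= 1 / 2) by (apply Rle_div_l; lra).
    assert (Hd2 : 2 * c * d <= eps / 4).
    { unfold d. replace (2 * c * (eps / (8 * c + 4 * eps)))
        with (2 * c * eps / (8 * c + 4 * eps)) by (field; lra).
      apply Rle_div_l; nra. }
    set (q := eps * d / 32).
    assert (Hq : 0 < q) by (apply Rdiv_lt_0_compat; [ apply Rmult_lt_0_compat; lra | lra ]).
    destruct (karamata_sum e (C + c) He Hneg q Hq) as [N0 HN0].
    destruct (nfloor_ex (2 / d + 2 * INR N0 + 1)) as [N1 [_ HN1]].
    { pose proof (pos_INR N0). assert (0 < 2 / d) by (apply Rdiv_lt_0_compat; lra). lra. }
    exists (S N1). intros n Hn.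
    assert (Hn1 : 2 / d + 2 * INR N0 + 1 < INR n) by (apply le_INR in Hn; rewrite S_INR in Hn; lra).
    pose proof (pos_INR N0) as HN00.
    assert (H2d : 0 < 2 / d) by (apply Rdiv_lt_0_compat; lra).
    assert (Hdn : 2 < d * INR n).
    { assert (2 / d < INR n) by lra. apply Rlt_div_l in H; lra. }
    destruct (nfloor_ex (d * INR n)) as [h Hh]; [ lra | ].
    assert (Hh1 : d * INR n / 2 <= INR h) by lra.
    assert (Hhn : 2 * INR h <= INR n) by nra.
    assert (Hhle : (h <= n)%nat) by (apply INR_le; pose proof (pos_INR h); lra).
    set (x := sqrt (INR n)).
    assert (Hx0 : 0 < x) by (apply sqrt_lt_R0; lra).
    assert (Hx : x * x = INR n) by (apply sqrt_sqrt; lra).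
    assert (Hsum : forall k, INR n / 2 <= INR k -> INR k <= 3 * INR n / 2 -> Rabs (sum_n e k) <= 2 * q * x).
    { intros k Hk1 Hk2. eapply Rle_trans; [ apply HN0 | ].
      - apply INR_le. lra.
      - replace (2 * q * x) with (q * (2 * x)) by ring. apply Rmult_le_compat_l; [ lra | ].
        unfold x. rewrite <- (sqrt_square 2), <- sqrt_mult by lra. apply sqrt_le_1_alt. lra. }
    assert (Hsplit : forall k, sum_n e k = sum_n b k - c * sum_n wallis k).
    { intros k. rewrite <- sum_n_R_mult_l.
      rewrite (sum_n_R_ext b (fun k => e k + c * wallis k)) by (intros; unfold e; ring).
      rewrite sum_n_R_plus. apply Rminus_diag_uniq. ring. }
    assert (Hw : forall k, INR n / 2 <= INR k -> INR h * (wallis k / (2 * INR k + 2)) <= 2 * d / x).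
    { intros k Hk.
      assert (wallis k <= 2 / x).
      { eapply Rle_trans; [ apply wallis_le_inv_sqrt | ].
        assert (0 < sqrt (INR k + 1)) by (apply sqrt_lt_R0; lra).
        apply Rle_div_l; [ assumption | ].
        replace (2 / x * sqrt (INR k + 1)) with (2 * sqrt (INR k + 1) / x) by (field; lra).
        apply Rle_div_r; [ exact Hx0 | ]. rewrite Rmult_1_l. unfold x.
        rewrite <- (sqrt_square 2), <- sqrt_mult by lra. apply sqrt_le_1_alt. lra. }
      pose proof (wallis_pos k).
      assert (INR h / (2 * INR k + 2) <= d) by (apply Rle_div_l; nra).
      assert (0 <= INR h / (2 * INR k + 2)) by (apply Rdiv_le_0_compat; [ apply pos_INR | lra ]).
      replace (INR h * (wallis k / (2 * INR k + 2))) with (INR h / (2 * INR k + 2) * wallis k)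
        by (field; lra).
      replace (2 * d / x) with (d * (2 / x)) by (field; lra).
      apply Rmult_le_compat; lra. }
    (* As [b] decreases, [INR h * b n] is at most the sum of [b] over the h indices ending at n and
       at least the sum over the h indices after n. *)
    assert (Hfin : Rabs (INR h * e n) <= INR h * (c * (2 * d / x)) + 4 * q * x).
    { assert (Hnh : INR (n - h) = INR n - INR h) by (apply minus_INR; exact Hhle).
      assert (Hnh' : INR (n + h) = INR n + INR h) by apply plus_INR.
      pose proof (pos_INR h) as Hh0.
      pose proof (Hsum n ltac:(lra) ltac:(lra)) as S1.
      pose proof (Hsum (n - h)%nat ltac:(lra) ltac:(lra)) as S2.
      pose proof (Hsum (n + h)%nat ltac:(lra) ltac:(lra)) as S3.
      apply Rabs_le_between in S1. apply Rabs_le_between in S2. apply Rabs_le_between in S3.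
      rewrite Hsplit in S1, S2, S3.
      pose proof (sum_n_decr_bounds b (n - h) h Hdecr) as B1.
      pose proof (sum_n_decr_bounds b n h Hdecr) as B2.
      pose proof (sum_n_decr_bounds wallis (n - h) h wallis_S_le) as W1.
      pose proof (sum_n_decr_bounds wallis n h wallis_S_le) as W2.
      pose proof (wallis_sub_le (n - h) h) as V1.
      pose proof (wallis_sub_le n h) as V2.
      rewrite Nat.sub_add in B1, W1, V1 by exact Hhle.
      pose proof (Hw n ltac:(lra)) as X2. pose proof (Hw (n - h)%nat ltac:(lra)) as X1.
      assert (V1' : INR h * (wallis (n - h) - wallis n) <= INR h * (2 * d / x))
        by (apply Rmult_le_compat_l; lra).
      assert (V2' : INR h * (wallis n - wallis (n + h)) <= INR h * (2 * d / x))
        by (apply Rmult_le_compat_l; lra).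
      apply (Rmult_le_compat_l c) in V1'; [ | exact Hc ].
      apply (Rmult_le_compat_l c) in V2'; [ | exact Hc ].
      pose proof (Rmult_le_compat_l c _ _ Hc (proj2 W1)) as W1'.
      pose proof (Rmult_le_compat_l c _ _ Hc (proj1 W2)) as W2'.
      unfold e. apply Rabs_le_between. split; nra. }
    rewrite Rminus_0_r.
    assert (Hh0 : 0 < INR h) by nra.
    rewrite Rabs_mult, (Rabs_pos_eq (INR h)) in Hfin by lra.
    rewrite Rabs_mult. fold x. rewrite (Rabs_pos_eq x) by lra.
    apply (Rmult_lt_reg_l (INR h)); [ exact Hh0 | ].
    replace (INR h * (x * Rabs (e n))) with (x * (INR h * Rabs (e n))) by ring.
    apply Rle_lt_trans with (x * (INR h * (c * (2 * d / x)) + 4 * q * x)).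
    { apply Rmult_le_compat_l; lra. }
    replace (x * (INR h * (c * (2 * d / x)) + 4 * q * x))
      with (INR h * (2 * c * d) + 4 * q * (x * x)) by (field; lra).
    rewrite Hx. unfold q.
    replace (4 * (eps * d / 32) * INR n) with (eps / 4 * (d * INR n / 2)) by field.
    assert (eps / 4 * (d * INR n / 2) <= eps / 4 * INR h) by (apply Rmult_le_compat_l; lra).
    nra. }
  apply (is_lim_seq_ext (fun n => sqrt (INR n) * e n + c * (sqrt (INR n) * wallis n))).
  { intros n. unfold e. ring. }
  replace (Finite (c / sqrt PI)) with (Finite (0 + c * (1 / sqrt PI)))
    by (f_equal; field; apply Rgt_not_eq, sqrt_lt_R0, PI_RGT_0).
  apply is_lim_seq_plus'; [ exact Hzero | ].
  apply is_lim_seq_mult'; [ apply is_lim_seq_const | apply is_lim_seq_sqrt_wallis ].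
Qed.

(** * Riemann integrals and derivatives *)

Lemma ex_RInt_eq_on_open (f : R -> R) (c a b : R) :
  a <= b -> (forall x, a < x < b -> f x = c) -> ex_RInt f a b.
Proof.
  intros Hab H. apply (ex_RInt_ext (fun _ => c)).
  - rewrite Rmin_left, Rmax_right by exact Hab. intros x Hx. symmetry. apply H, Hx.
  - apply ex_RInt_const.
Qed.

Lemma ex_RInt_decr_indicator (f : R -> R) (a b : R) :
  a <= b -> (forall x, f x = 0 \/ f x = 1) -> (forall x y, x <= y -> f y <= f x) ->
  ex_RInt f a b.
Proof.
  intros Hab H01 Hd.
  (* The supremum is the point of the jump; [a] is adjoined so that the set is nonempty even where
     [f] is 0 throughout. *)
  destruct (completeness (fun x => x = a \/ (a <= x <= b /\ f x = 1))) as [t [Hub Hlub]].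
  - exists b. intros x [-> | [[_ Hx] _]]; assumption.
  - exists a. left; reflexivity.
  - assert (Hat : a <= t) by (apply Hub; left; reflexivity).
    assert (Htb : t <= b) by (apply Hlub; intros x [-> | [[_ Hx] _]]; assumption).
    apply (ex_RInt_Chasles f a t b).
    + apply (ex_RInt_eq_on_open f 1); [ exact Hat | ]. intros x Hx.
      destruct (H01 x) as [H0 | H1]; [ exfalso | exact H1 ].
      apply (Rlt_irrefl x). apply Rlt_le_trans with t; [ lra | ].
      apply Hlub. intros y [-> | [_ Hy]]; [ lra | ].
      apply Rnot_lt_le. intros Hlt. specialize (Hd x y (Rlt_le _ _ Hlt)). lra.
    + apply (ex_RInt_eq_on_open f 0); [ exact Htb | ]. intros x Hx.
      destruct (H01 x) as [H0 | H1]; [ exact H0 | exfalso ].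
      assert (x <= t) by (apply Hub; right; split; [ lra | exact H1 ]). lra.
Qed.

Definition above (y c : R) : R := if Rlt_dec c y then 1 else 0.

(** The sum counts the integers j >= 0 below y: it is y rounded up. *)
Lemma sum_above_bounds (y : R) (n : nat) :
  0 <= y <= INR n + 1 -> y <= sum_n (fun j => above y (INR j)) n <= y + 1.
Proof.
  intros Hy.
  assert (P : (INR n + 1 <= y -> sum_n (fun j => above y (INR j)) n = INR n + 1) /\
              (y <= INR n + 1 -> y <= sum_n (fun j => above y (INR j)) n <= y + 1)).
  { clear - Hy. destruct Hy as [Hy _]. induction n as [|n [IH1 IH2]].
    - rewrite sum_O. unfold above. simpl. destruct Rlt_dec; split; intros; lra.
    - rewrite sum_n_R_S, S_INR.
      set (s := sum_n (fun j => above y (INR j)) n) in *.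
      unfold above. destruct Rlt_dec as [Hlt | Hge].
      + split; intros; rewrite IH1; lra.
      + split; intros; [ lra | ]. specialize (IH2 ltac:(lra)). lra. }
  apply P, Hy.
Qed.

Lemma ex_RInt_sum_n (f : nat -> R -> R) (a b : R) (n : nat) :
  (forall j, ex_RInt (f j) a b) -> ex_RInt (fun x => sum_n (fun j => f j x) n) a b.
Proof.
  intros H. induction n as [|n IH].
  - apply (ex_RInt_ext (f 0%nat)); [ intros; rewrite sum_O; reflexivity | apply H ].
  - apply (ex_RInt_ext (fun x => sum_n (fun j => f j x) n + f (S n) x)).
    + intros. rewrite sum_n_R_S. reflexivity.
    + apply (ex_RInt_plus (V := R_NormedModule)); [ exact IH | apply H ].
Qed.

(** Rounding (n+1) f up to an integer and dividing by n + 1 approximates f uniformly within 1/(n+1).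
    The rounded function is a sum of indicators of sets f > c, and each of these is an initial
    segment because f decreases. This makes m_0 integrable in time from its monotonicity. *)
Lemma ex_RInt_decr (f : R -> R) (B a b : R) :
  a <= b -> (forall x, 0 <= f x <= B) -> (forall x y, x <= y -> f y <= f x) ->
  ex_RInt f a b.
Proof.
  intros Hab HB Hd.
  assert (HB0 : 0 <= B) by (specialize (HB a); lra).
  set (N := fun n : nat => Z.to_nat (up (INR (S n) * B))).
  set (fn := fun n x => / INR (S n) * sum_n (fun j => above (INR (S n) * f x) (INR j)) (N n)).
  destruct (fun H1 => filterlim_RInt (V := R_CompleteNormedModule) fn a b eventually _ f
              (fun n => RInt (fn n) a b) H1) as [l [_ Hl]].
  - intros n. apply (RInt_correct (V := R_CompleteNormedModule)).
    apply (ex_RInt_scal (V := R_NormedModule) (fun x => sum_n (fun j => above (INR (S n) * f x) (INR j)) (N n))).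
    apply (ex_RInt_sum_n (fun j x => above (INR (S n) * f x) (INR j))).
    intros j. apply ex_RInt_decr_indicator; [ exact Hab | | ].
    + intros x. unfold above. destruct Rlt_dec; auto.
    + intros x y Hxy. specialize (Hd x y Hxy).
      assert (0 < INR (S n)) by apply lt_0_INR, Nat.lt_0_succ.
      assert (INR (S n) * f y <= INR (S n) * f x) by (apply Rmult_le_compat_l; lra).
      unfold above. destruct Rlt_dec; destruct Rlt_dec; lra.
  - apply (filterlim_locally (F := eventually) fn f). intros [eps Heps].
    destruct (nfloor_ex (/ eps)) as [n0 [_ Hn0]]; [ left; apply Rinv_0_lt_compat; lra | ].
    exists n0. intros n Hn x.
    assert (Hn1 : / eps < INR (S n)) by (apply le_INR in Hn; rewrite S_INR; lra).
    assert (Hn2 : 0 < INR (S n)) by (apply lt_0_INR; lia).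
    assert (Hbd : INR (S n) * f x <= sum_n (fun j => above (INR (S n) * f x) (INR j)) (N n)
                  <= INR (S n) * f x + 1).
    { apply sum_above_bounds. specialize (HB x). split; [ apply Rmult_le_pos; lra | ].
      assert (INR (S n) * f x <= INR (S n) * B) by (apply Rmult_le_compat_l; lra).
      destruct (archimed (INR (S n) * B)) as [A1 _].
      unfold N. rewrite (INR_IZR_INZ (Z.to_nat _)), Z2Nat.id; [ lra | ].
      apply le_IZR. assert (0 <= INR (S n) * B) by (apply Rmult_le_pos; lra). lra. }
    set (s := sum_n _ _) in Hbd.
    change (Rabs (/ INR (S n) * s - f x) < eps).
    assert (He : / INR (S n) < eps).
    { rewrite <- (Rinv_inv eps). apply Rinv_lt_contravar; [ | exact Hn1 ].
      apply Rmult_lt_0_compat; [ apply Rinv_0_lt_compat; lra | lra ]. }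
    replace (/ INR (S n) * s - f x) with (/ INR (S n) * (s - INR (S n) * f x)) by (field; lra).
    assert (0 < / INR (S n)) by (apply Rinv_0_lt_compat; lra).
    rewrite Rabs_pos_eq by (apply Rmult_le_pos; lra).
    apply Rle_lt_trans with (/ INR (S n)); [ | exact He ].
    rewrite <- (Rmult_1_r (/ INR (S n))) at 2. apply Rmult_le_compat_l; lra.
  - exists l. exact Hl.
Qed.

(** As f vanishes at x, the difference quotient of the product is that of f times g(x + h), so
    continuity of g suffices. *)
Lemma is_derive_mult_vanish (f g : R -> R) (x l : R) :
  f x = 0 -> is_derive f x l -> continuous g x -> is_derive (fun y => f y * g y) x (l * g x).
Proof.
  intros Hf Hd Hg.
  apply is_derive_Reals. apply is_derive_Reals in Hd. intros eps Heps.
  pose proof (Rabs_pos (g x)). pose proof (Rabs_pos l).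
  destruct (Hd (Rmin 1 (eps / (2 * (Rabs (g x) + 1))))) as [d1 H1].
  { apply Rmin_pos; [ lra | apply Rdiv_lt_0_compat; lra ]. }
  set (q := eps / (2 * (Rabs l + 1))).
  assert (Hq : 0 < q) by (apply Rdiv_lt_0_compat; lra).
  destruct (proj1 (filterlim_locally _ _) Hg (mkposreal q Hq)) as [d2 H2].
  assert (Hd12 : 0 < Rmin d1 d2) by (apply Rmin_pos; apply cond_pos).
  exists (mkposreal _ Hd12). intros h Hh Hhd. simpl in Hhd.
  pose proof (Rmin_l d1 d2). pose proof (Rmin_r d1 d2).
  specialize (H1 h Hh ltac:(lra)).
  assert (G : Rabs (g (x + h) - g x) < q).
  { apply H2. change (Rabs (x + h - x) < d2). replace (x + h - x) with h by ring. lra. }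
  rewrite Hf in *. rewrite Rminus_0_r in H1.
  pose proof (Rmin_l 1 (eps / (2 * (Rabs (g x) + 1)))).
  pose proof (Rmin_r 1 (eps / (2 * (Rabs (g x) + 1)))).
  set (D := f (x + h) / h) in *.
  replace ((f (x + h) * g (x + h) - 0 * g x) / h - l * g x)
    with ((D - l) * g x + D * (g (x + h) - g x)) by (unfold D; field; exact Hh).
  eapply Rle_lt_trans; [ apply Rabs_triang | ]. rewrite !Rabs_mult.
  assert (HD : Rabs D <= Rabs l + 1).
  { replace D with (D - l + l) by ring. eapply Rle_trans; [ apply Rabs_triang | lra ]. }
  assert (E1 : Rabs (D - l) * Rabs (g x) <= eps / (2 * (Rabs (g x) + 1)) * Rabs (g x))
    by (apply Rmult_le_compat_r; lra).
  assert (E2 : eps / (2 * (Rabs (g x) + 1)) * Rabs (g x) <= eps / 2).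
  { replace (eps / (2 * (Rabs (g x) + 1)) * Rabs (g x))
      with (eps / 2 * Rabs (g x) / (Rabs (g x) + 1)) by (field; lra).
    apply Rle_div_l; nra. }
  assert (E3 : Rabs D * Rabs (g (x + h) - g x) < eps / 2).
  { apply Rle_lt_trans with ((Rabs l + 1) * Rabs (g (x + h) - g x)).
    - apply Rmult_le_compat_r; [ apply Rabs_pos | exact HD ].
    - replace (eps / 2) with ((Rabs l + 1) * q) by (unfold q; field; lra).
      apply Rmult_lt_compat_l; lra. }
  lra.
Qed.

(** The increment of H is o(D y - D x), hence o(y - x). This chain rule will be applied to
    increments of M, which is Lipschitz but possibly not differentiable. *)
Lemma is_derive_comp_lipschitz_zero (H D : R -> R) (x L : R) :
  is_derive H (D x) 0 -> (forall y, Rabs (D y - D x) <= L * Rabs (y - x)) ->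
  is_derive (fun y => H (D y)) x 0.
Proof.
  intros HH HL. apply is_derive_Reals. apply is_derive_Reals in HH. intros eps Heps.
  assert (HL0 : 0 <= L).
  { specialize (HL (x + 1)). replace (x + 1 - x) with 1 in HL by ring.
    rewrite Rabs_R1 in HL. pose proof (Rabs_pos (D (x + 1) - D x)). lra. }
  destruct (HH (eps / (L + 1))) as [d Hd]; [ apply Rdiv_lt_0_compat; lra | ].
  pose proof (cond_pos d).
  assert (Hd' : 0 < d / (L + 1)) by (apply Rdiv_lt_0_compat; lra).
  exists (mkposreal _ Hd'). intros h Hh Hhd. simpl in Hhd.
  specialize (HL (x + h)). replace (x + h - x) with h in HL by ring.
  pose proof (Rabs_pos_lt h Hh).
  set (u := D (x + h) - D x) in *.
  replace (D (x + h)) with (D x + u) by (unfold u; ring).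
  destruct (Req_dec u 0) as [-> | Hu].
  - rewrite Rplus_0_r. replace ((H (D x) - H (D x)) / h - 0) with 0 by (field; exact Hh).
    rewrite Rabs_R0. exact Heps.
  - specialize (Hd u Hu).
    assert (Hud : Rabs u < d).
    { apply Rle_lt_trans with ((L + 1) * Rabs h); [ nra | ].
      apply Rlt_div_r in Hhd; lra. }
    specialize (Hd Hud). rewrite Rminus_0_r in *.
    replace ((H (D x + u) - H (D x)) / h) with ((H (D x + u) - H (D x)) / u * (u / h))
      by (field; split; assumption).
    rewrite Rabs_mult.
    assert (Huh : Rabs (u / h) <= L).
    { unfold Rdiv. rewrite Rabs_mult, Rabs_inv. apply Rle_div_l; lra. }
    apply Rle_lt_trans with (eps / (L + 1) * L).
    + apply Rmult_le_compat; try apply Rabs_pos; lra.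
    + replace (eps / (L + 1) * L) with (eps * L / (L + 1)) by (field; lra).
      apply Rlt_div_l; nra.
Qed.

(** * Series, convolutions and exponential inequalities *)

Lemma sum_n_le_Series (a : nat -> R) (n : nat) :
  (forall k, 0 <= a k) -> ex_series a -> sum_n a n <= Series a.
Proof.
  intros H E. rewrite (Series_split a n E).
  pose proof (Series_ge_0 (fun k => a (S n + k)%nat) (fun k => H _)). lra.
Qed.

Lemma term_le_Series (a : nat -> R) (n : nat) :
  (forall k, 0 <= a k) -> ex_series a -> a n <= Series a.
Proof.
  intros H E. eapply Rle_trans; [ | apply (sum_n_le_Series a n H E) ].
  destruct n as [|n]; [ rewrite sum_O; lra | ].
  rewrite sum_n_R_S. pose proof (sum_n_ge_0 a n H). lra.
Qed.

Lemma sum_n_first (f : nat -> R) (n : nat) :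
  sum_n f (S n) = f 0%nat + sum_n (fun k => f (S k)) n.
Proof.
  induction n as [|n IH].
  - rewrite sum_n_R_S, !sum_O. reflexivity.
  - rewrite sum_n_R_S, IH, (sum_n_R_S (fun k => f (S k))). apply Rplus_assoc.
Qed.

Lemma sum_n_rev (f : nat -> R) (n : nat) :
  sum_n (fun k => f (n - k)%nat) n = sum_n f n.
Proof.
  revert f. induction n as [|n IH]; intros f.
  - rewrite !sum_O. reflexivity.
  - rewrite sum_n_R_S, Nat.sub_diag, sum_n_first, Rplus_comm. f_equal.
    rewrite <- (IH (fun k => f (S k))). apply sum_n_R_ext.
    intros k Hk. f_equal. lia.
Qed.

Definition conv (u : nat -> R) (k : nat) : R := sum_n (fun l => u l * u (k - l)%nat) k.

(** Averaging with the reflection l -> k - l replaces the weight l by k/2. *)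
Lemma sum_weighted_conv (u : nat -> R) (k : nat) :
  sum_n (fun l => INR l * u l * u (k - l)%nat) k = INR k / 2 * conv u k.
Proof.
  assert (E : sum_n (fun l => INR l * u l * u (k - l)%nat) k
              = sum_n (fun l => (INR k - INR l) * (u l * u (k - l)%nat)) k).
  { rewrite <- sum_n_rev. apply sum_n_R_ext. intros l Hl.
    replace (k - (k - l))%nat with l by lia. rewrite minus_INR by exact Hl. ring. }
  assert (E2 : sum_n (fun l => INR l * u l * u (k - l)%nat) k
             + sum_n (fun l => (INR k - INR l) * (u l * u (k - l)%nat)) k = INR k * conv u k).
  { unfold conv. rewrite <- sum_n_R_plus, <- sum_n_R_mult_l. apply sum_n_R_ext.
    intros; ring. }
  rewrite <- E in E2. lra.
Qed.

(** A truncated form of (G^2/2)' = G' G: the convolution up to n pairs the index l with the partial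
    sum up to n - l. *)
Lemma sum_conv (u : nat -> R) (n : nat) :
  sum_n (fun k => INR k / 2 * conv u k) n = sum_n (fun l => INR l * u l * sum_n u (n - l)) n.
Proof.
  induction n as [|n IH].
  - rewrite !sum_O. simpl. unfold Rdiv. rewrite !Rmult_0_l. reflexivity.
  - rewrite sum_n_R_S, IH, <- sum_weighted_conv, !sum_n_R_S.
    rewrite Nat.sub_diag, sum_O, <- Rplus_assoc, <- sum_n_R_plus. f_equal.
    apply sum_n_R_ext. intros l Hl. replace (S n - l)%nat with (S (n - l)) by lia.
    rewrite sum_n_R_S. ring.
Qed.

Lemma conv_mult_pow (u : nat -> R) (z : R) (k : nat) :
  conv (fun l => u l * z ^ l) k = conv u k * z ^ k.
Proof.
  unfold conv. rewrite Rmult_comm, <- sum_n_R_mult_l. apply sum_n_R_ext. intros l Hl.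
  replace k with (l + (k - l))%nat at 3 by lia. rewrite pow_add. ring.
Qed.

Lemma is_derive_nonneg_le (f df : R -> R) (a b : R) :
  a <= b ->
  (forall x, a < x < b -> is_derive f x (df x)) ->
  (forall x, continuous f x) ->
  (forall x, a < x < b -> 0 <= df x) ->
  f a <= f b.
Proof.
  intros Hab Hd Hc Hp.
  destruct Hab as [Hab | ->]; [ | lra ].
  (* The mean value point may be an endpoint, where [df] has no known sign; the derivative passed on
     is therefore set to 0 outside the open interval. *)
  destruct (MVT_gen f a b (fun x => if Rle_lt_dec x a then 0 else
                                    if Rle_lt_dec b x then 0 else df x)) as [c [_ E]].
  - rewrite Rmin_left, Rmax_right by lra. intros x Hx.
    destruct Rle_lt_dec; [ lra | ]. destruct Rle_lt_dec; [ lra | ]. apply Hd, Hx.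
  - intros x _. apply continuity_pt_filterlim, Hc.
  - assert (0 <= f b - f a); [ | lra ]. rewrite E.
    apply Rmult_le_pos; [ | lra ].
    destruct Rle_lt_dec; [ lra | ]. destruct Rle_lt_dec; [ lra | ]. apply Hp; lra.
Qed.

Lemma is_derive_R_ext (f g : R -> R) (x l : R) :
  (forall t, f t = g t) -> is_derive f x l -> is_derive g x l.
Proof. apply (is_derive_ext (K := R_AbsRing) (V := R_NormedModule)). Qed.

Lemma is_derive_R_const (c x : R) : is_derive (fun _ : R => c) x 0.
Proof. exact (is_derive_const (K := R_AbsRing) (V := R_NormedModule) c x). Qed.

Lemma is_derive_R_plus (f g : R -> R) (x a b : R) :
  is_derive f x a -> is_derive g x b -> is_derive (fun y => f y + g y) x (a + b).
Proof. exact (is_derive_plus (K := R_AbsRing) (V := R_NormedModule) f g x a b). Qed.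

Lemma continuous_R_ext (f g : R -> R) (x : R) :
  (forall t, f t = g t) -> continuous f x -> continuous g x.
Proof. apply continuous_ext. Qed.

Lemma exp_pow (y : R) (n : nat) : exp y ^ n = exp (INR n * y).
Proof. rewrite <- Rpower_pow by apply exp_pos. unfold Rpower. rewrite ln_exp. reflexivity. Qed.

Lemma exp_neg_lt_1 (x : R) : 0 < x -> 0 < exp (- x) < 1.
Proof.
  intros Hx. split; [ apply exp_pos | ]. rewrite <- exp_0. apply exp_increasing. lra.
Qed.

Lemma INR_mul_exp_pow_le (x : R) (k : nat) : 0 < x -> INR k * exp (- x) ^ k <= / x.
Proof.
  intros Hx. rewrite exp_pow. pose proof (exp_ineq1_le (INR k * x)).
  apply (Rmult_le_reg_r (x * exp (INR k * x))).
  { apply Rmult_lt_0_compat; [ exact Hx | apply exp_pos ]. }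
  replace (INR k * exp (INR k * - x) * (x * exp (INR k * x)))
    with (INR k * x * (exp (INR k * - x) * exp (INR k * x))) by ring.
  rewrite <- exp_plus. replace (INR k * - x + INR k * x) with 0 by ring. rewrite exp_0.
  replace (/ x * (x * exp (INR k * x))) with (exp (INR k * x)) by (field; lra). lra.
Qed.

Lemma is_lim_INR_mul_exp_pow (x : R) :
  0 < x -> is_lim_seq (fun n => INR n * exp (- x) ^ n) 0.
Proof.
  intros Hx.
  apply (is_lim_seq_le_le (fun _ => 0) _ (fun n => / (x / 2) * exp (- (x / 2)) ^ n)).
  - intros n. pose proof (pos_INR n). pose proof (pow_lt (exp (- x)) n (exp_pos _)).
    split; [ apply Rmult_le_pos; lra | ].
    (* Half of the exponential decay absorbs the factor n, the other half tends to 0. *)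
    replace (exp (- x)) with (exp (- (x / 2)) * exp (- (x / 2)))
      by (rewrite <- exp_plus; f_equal; lra).
    rewrite Rpow_mult_distr, <- Rmult_assoc.
    apply Rmult_le_compat_r; [ left; apply pow_lt, exp_pos | ].
    apply INR_mul_exp_pow_le. lra.
  - apply is_lim_seq_const.
  - replace (Finite 0) with (Finite (/ (x / 2) * 0)) by (f_equal; ring).
    apply is_lim_seq_mult'; [ apply is_lim_seq_const | ].
    apply is_lim_seq_geom. pose proof (exp_pos (- (x / 2))).
    rewrite Rabs_pos_eq by lra. rewrite <- exp_0. apply exp_increasing. lra.
Qed.

(** Taylor remainder: the second derivative of the exponential of the opposite lies between
    [exp (- u)] and 1 on [0, u]. *)
Lemma exp_taylor2 (u : R) : 0 <= u -> exp (- u) * u ^ 2 / 2 <= exp (- u) - 1 + u <= u ^ 2 / 2.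
Proof.
  intros Hu. split.
  - enough (exp (- 0) - 1 + 0 - exp (- 0) * 0 ^ 2 / 2
            <= exp (- u) - 1 + u - exp (- u) * u ^ 2 / 2)
      by (rewrite Ropp_0, exp_0 in *; lra).
    apply (is_derive_nonneg_le (fun u => exp (- u) - 1 + u - exp (- u) * u ^ 2 / 2)
             (fun u => 1 - exp (- u) * (1 + u - u ^ 2 / 2)));
      [ exact Hu
      | intros y _; auto_derive; [ trivial | field ]
      | intros y; apply (ex_derive_continuous (V := R_NormedModule)); auto_derive; trivial
      | intros y Hy ].
    pose proof (exp_ineq1_le y). pose proof (exp_pos (- y)).
    assert (exp (- y) * exp y = 1) by (rewrite <- exp_plus, Rplus_opp_l; apply exp_0).
    nra.
  - enough (u ^ 2 / 2 - exp (- u) + 1 - u >= 0 ^ 2 / 2 - exp (- 0) + 1 - 0)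
      by (rewrite Ropp_0, exp_0 in *; lra).
    apply Rle_ge.
    apply (is_derive_nonneg_le (fun u => u ^ 2 / 2 - exp (- u) + 1 - u)
             (fun u => u + exp (- u) - 1)).
    + exact Hu.
    + intros y _. auto_derive; [ trivial | field ].
    + intros y. apply (ex_derive_continuous (V := R_NormedModule)). auto_derive. trivial.
    + intros y _. pose proof (exp_ineq1_le (- y)). lra.
Qed.

Lemma lipschitz_continuous (f : R -> R) (L : R) :
  (forall s t, Rabs (f t - f s) <= L * Rabs (t - s)) -> forall x, continuous f x.
Proof.
  intros H x. apply filterlim_locally. intros [eps Heps].
  assert (HL : 0 <= L).
  { specialize (H x (x + 1)). replace (x + 1 - x) with 1 in H by ring.
    rewrite Rabs_R1 in H. pose proof (Rabs_pos (f (x + 1) - f x)). lra. }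
  assert (Hd : 0 < eps / (L + 1)) by (apply Rdiv_lt_0_compat; lra).
  exists (mkposreal _ Hd). intros y Hy. change (Rabs (y - x) < eps / (L + 1)) in Hy.
  change (Rabs (f y - f x) < eps).
  eapply Rle_lt_trans; [ apply H | ].
  apply Rlt_div_r in Hy; [ | lra ]. pose proof (Rabs_pos (y - x)). nra.
Qed.

Lemma continuous_Rmax_l (a t : R) : continuous (Rmax a) t.
Proof.
  apply (lipschitz_continuous (Rmax a) 1). intros x y. rewrite Rmult_1_l.
  pose proof (Rle_abs (y - x)) as H1. pose proof (Rle_abs (- (y - x))) as H2.
  rewrite Rabs_Ropp in H2. apply Rabs_le_between.
  unfold Rmax. destruct Rle_dec; destruct Rle_dec; lra.
Qed.

(** * Critical solutions *)

(* The entry of index 0, which carries no meaning, is reset to 0, so that sums over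
   [k >= 1] become sums over all [k]. *)
Definition coef (u : nat -> R) (k : nat) : R :=
  match k with O => 0 | S _ => u k end.

(** The full convolution has the two extra terms l = 0 and l = k, which vanish since [coef u 0] is
    0. For k = 1 the sum from 1 to 0 is empty. *)
Lemma conv_coef (u : nat -> R) (k : nat) :
  (1 <= k)%nat ->
  sum_n_m (fun l => u l * u (k - l)%nat) 1 (k - 1) = conv (coef u) k.
Proof.
  intros Hk. destruct k as [|k]; [ lia | ].
  unfold conv. rewrite sum_n_R_S, Nat.sub_diag. simpl (coef u 0). rewrite Rmult_0_r, Rplus_0_r.
  replace (S k - 1)%nat with k by lia.
  destruct k as [|k].
  - rewrite sum_n_m_zero by lia. rewrite sum_O. simpl. unfold zero; simpl. ring.
  - rewrite sum_n_first. simpl (coef u 0). rewrite Rmult_0_l, Rplus_0_l.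
    unfold sum_n. rewrite (sum_n_m_S (fun l => coef u l * coef u (S (S k) - l)%nat) 0 k).
    apply (sum_n_m_ext_loc (G := R_AbelianMonoid)). intros l Hl.
    destruct l as [|l]; [ lia | ].
    destruct (S (S k) - S l)%nat as [|j] eqn:Ej; [ lia | reflexivity ].
Qed.

(** * Regularity in time of the mass and of the coefficients *)

Section CriticalSolution.

Variable v : R -> nat -> R.
Hypothesis Hsol : critical_solution v.
Hypothesis Hneg : forall t, t <= 0 -> v t = v 0.

Let w (t : R) (k : nat) : R := coef (v t) k.
Let mass (t : R) : R := m0 (v t).
Let M (t : R) : R := RInt mass 0 t.

Lemma sol_in_N (t : R) : in_N (v t).
Proof.
  destruct Hsol as [H _]. destruct (Rle_lt_dec 0 t); [ apply H; assumption | ].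
  rewrite Hneg by lra. apply H; lra.
Qed.

Lemma mass_decr (s t : R) : s <= t -> mass t <= mass s.
Proof.
  intros Hst. destruct Hsol as [_ [_ [H _]]]. unfold mass, Phi in *.
  destruct (Rle_lt_dec t 0).
  - rewrite (Hneg t), (Hneg s) by lra. lra.
  - destruct (Rle_lt_dec 0 s).
    + specialize (H s t ltac:(lra) Hst). lra.
    + specialize (H 0 t ltac:(lra) ltac:(lra)). rewrite (Hneg s) by lra. lra.
Qed.

Lemma mass_pos (t : R) : 0 < mass t.
Proof.
  destruct Hsol as [_ [_ [_ H]]]. unfold mass, Phi in *.
  destruct (Rle_lt_dec 0 t) as [Ht | Ht].
  - specialize (H t Ht). lra.
  - rewrite Hneg by lra. specialize (H 0 ltac:(lra)). lra.
Qed.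

Lemma mass_le (t : R) : mass t <= mass 0.
Proof.
  destruct (Rle_lt_dec 0 t); [ apply mass_decr; assumption | ].
  unfold mass. rewrite Hneg by lra. lra.
Qed.

Lemma w_ge_0 (t : R) (k : nat) : 0 <= w t k.
Proof.
  destruct (sol_in_N t) as [H _]. unfold w. destruct k; simpl; [ lra | apply H; lia ].
Qed.

Lemma ex_series_w (t : R) : ex_series (w t).
Proof. apply ex_series_incr_1. apply (sol_in_N t). Qed.

Lemma Series_w (t : R) : Series (w t) = mass t.
Proof. apply Series_incr_1_aux. reflexivity. Qed.

Lemma w_le_mass0 (t : R) (k : nat) : w t k <= mass 0.
Proof.
  eapply Rle_trans; [ apply (term_le_Series (w t) k (w_ge_0 t) (ex_series_w t)) | ].
  rewrite Series_w. apply mass_le.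
Qed.

Lemma ex_RInt_mass (a b : R) : ex_RInt mass a b.
Proof.
  assert (H : forall a b, a <= b -> ex_RInt mass a b).
  { intros x y Hxy. apply (ex_RInt_decr mass (mass 0)).
    - exact Hxy.
    - intros t. pose proof (mass_pos t). pose proof (mass_le t). lra.
    - apply mass_decr. }
  destruct (Rle_lt_dec a b); [ apply H; assumption | apply ex_RInt_swap, H; lra ].
Qed.

Lemma M_sub (s t : R) : M t - M s = RInt mass s t.
Proof.
  unfold M. pose proof (RInt_Chasles mass 0 s t (ex_RInt_mass 0 s) (ex_RInt_mass s t)) as E.
  unfold plus in E; simpl in E. lra.
Qed.

Lemma M_sub_bounds (s t : R) :
  s <= t -> (t - s) * mass t <= M t - M s <= (t - s) * mass s.
Proof.
  intros Hst. rewrite M_sub.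
  assert (Ec : forall c : R, RInt (fun _ => c) s t = (t - s) * c)
    by (intros c; rewrite RInt_const; reflexivity).
  rewrite <- !Ec. split; apply RInt_le; try assumption; try apply ex_RInt_mass;
    try apply ex_RInt_const; intros x Hx; apply mass_decr; lra.
Qed.

Lemma M_0 : M 0 = 0.
Proof. unfold M. apply (RInt_point (V := R_CompleteNormedModule)). Qed.

Lemma M_lipschitz (s t : R) : Rabs (M t - M s) <= mass 0 * Rabs (t - s).
Proof.
  assert (H : forall s t, s <= t -> Rabs (M t - M s) <= mass 0 * Rabs (t - s)).
  { clear s t. intros s t Hst. pose proof (M_sub_bounds s t Hst) as [L U].
    pose proof (mass_pos t). pose proof (mass_le s).
    rewrite !Rabs_pos_eq by nra. nra. }
  destruct (Rle_lt_dec s t); [ apply H; assumption | ].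
  rewrite Rabs_minus_sym, (Rabs_minus_sym t). apply H. lra.
Qed.

Let rhs (k : nat) (t : R) : R := INR k / 2 * conv (w t) k - INR k * w t k * mass t.

Lemma is_RInt_rhs (k : nat) (t : R) : 0 <= t -> is_RInt (rhs k) 0 t (w t k - w 0 k).
Proof.
  intros Ht. destruct k as [|k].
  - apply (is_RInt_ext (fun _ => 0)).
    + intros x _. unfold rhs. simpl. unfold Rdiv. ring.
    + replace (w t 0 - w 0 0) with (scal (t - 0) 0)
        by (unfold w; simpl; unfold scal; simpl; unfold mult; simpl; ring).
      apply (is_RInt_const (V := R_NormedModule)).
  - destruct Hsol as [_ [H _]].
    apply (is_RInt_ext (fun s => INR (S k) / 2 * sum_n_m (fun l => v s l * v s (S k - l)%nat) 1 (S k - 1)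
                - INR (S k) * v s (S k) * m0 (v s))).
    + intros x _. rewrite conv_coef by lia. reflexivity.
    + apply (H t (S k) Ht). lia.
Qed.

Lemma conv_w_bounds (t : R) (k : nat) : 0 <= conv (w t) k <= (INR k + 1) * (mass 0 * mass 0).
Proof.
  unfold conv. split.
  - apply sum_n_ge_0. intros l. apply Rmult_le_pos; apply w_ge_0.
  - rewrite <- S_INR, <- sum_n_const. apply sum_n_le_compat. intros l _.
    apply Rmult_le_compat; auto using w_ge_0, w_le_mass0.
Qed.

Lemma w_lipschitz (k : nat) :
  exists L, forall s t, Rabs (w t k - w s k) <= L * Rabs (t - s).
Proof.
  set (L := INR k / 2 * ((INR k + 1) * (mass 0 * mass 0)) + INR k * mass 0 * mass 0).
  exists L.
  pose proof (pos_INR k) as Hk. pose proof (mass_pos 0) as H0.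
  assert (HL : 0 <= L).
  { unfold L. apply Rplus_le_le_0_compat; repeat apply Rmult_le_pos; lra. }
  assert (HR : forall s, Rabs (rhs k s) <= L).
  { intros s. unfold rhs. pose proof (conv_w_bounds s k) as [C1 C2].
    pose proof (w_ge_0 s k). pose proof (w_le_mass0 s k).
    pose proof (mass_pos s). pose proof (mass_le s).
    unfold Rminus. eapply Rle_trans; [ apply Rabs_triang | rewrite Rabs_Ropp ].
    apply Rplus_le_compat; rewrite Rabs_pos_eq by (repeat apply Rmult_le_pos; lra).
    - apply Rmult_le_compat_l; lra.
    - rewrite !Rmult_assoc. apply Rmult_le_compat_l; [ lra | ].
      apply Rmult_le_compat; lra. }
  assert (H1 : forall s t, 0 <= s -> s <= t -> Rabs (w t k - w s k) <= L * Rabs (t - s)).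
  { intros s t Hs Hst.
    assert (I : is_RInt (rhs k) s t (w t k - w s k)).
    { replace (w t k - w s k) with (plus (opp (w s k - w 0 k)) (w t k - w 0 k))
        by (unfold plus, opp; simpl; ring).
      apply (is_RInt_Chasles (V := R_NormedModule) (rhs k) s 0 t).
      - apply (is_RInt_swap (V := R_NormedModule)), is_RInt_rhs; exact Hs.
      - apply is_RInt_rhs; lra. }
    pose proof (norm_RInt_le_const (V := R_NormedModule) (rhs k) s t _ L Hst (fun x _ => HR x) I) as N.
    rewrite (Rabs_pos_eq (t - s)) by lra. rewrite Rmult_comm. exact N. }
  assert (H2 : forall s t, s <= t -> Rabs (w t k - w s k) <= L * Rabs (t - s)).
  { intros s t Hst. destruct (Rle_lt_dec 0 s); [ apply H1; assumption | ].
    replace (w s k) with (w 0 k) by (unfold w; rewrite (Hneg s) by lra; reflexivity).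
    destruct (Rle_lt_dec 0 t).
    - eapply Rle_trans; [ apply H1; lra | ]. apply Rmult_le_compat_l; [ exact HL | ].
      rewrite !Rabs_pos_eq by lra. lra.
    - replace (w t k) with (w 0 k) by (unfold w; rewrite (Hneg t) by lra; reflexivity).
      rewrite Rminus_diag, Rabs_R0. apply Rmult_le_pos; [ exact HL | apply Rabs_pos ]. }
  intros s t. destruct (Rle_lt_dec s t); [ apply H2; assumption | ].
  rewrite Rabs_minus_sym, (Rabs_minus_sym t). apply H2. lra.
Qed.

Lemma continuous_w (k : nat) (t : R) : continuous (fun s => w s k) t.
Proof. destruct (w_lipschitz k) as [L HL]. exact (lipschitz_continuous _ L HL t). Qed.

Lemma continuous_M (t : R) : continuous M t.
Proof. exact (lipschitz_continuous M _ M_lipschitz t). Qed.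

Lemma continuous_conv (k : nat) (t : R) : continuous (fun s => conv (w s) k) t.
Proof.
  unfold conv.
  assert (H : forall n, continuous (fun s => sum_n (fun l => w s l * w s (k - l)%nat) n) t).
  { induction n as [|n IH].
    - apply (continuous_R_ext (fun s => w s 0%nat * w s (k - 0)%nat));
        [ intros; rewrite sum_O; reflexivity | ].
      apply (continuous_mult (K := R_AbsRing)); apply continuous_w.
    - apply (continuous_R_ext (fun s => sum_n (fun l => w s l * w s (k - l)%nat) n
                                      + w s (S n) * w s (k - S n)%nat));
        [ intros; rewrite sum_n_R_S; reflexivity | ].
      apply (continuous_plus (V := R_NormedModule)); [ exact IH | ].
      apply (continuous_mult (K := R_AbsRing)); apply continuous_w. }
  apply H.
Qed.

(* Adding [k v_k(t) M] cancels the possibly discontinuous factor [m0] of the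
   integrand at the point [t]. *)
Lemma is_derive_w_shift (k : nat) (t : R) :
  0 < t -> is_derive (fun s => w s k + INR k * w t k * M s) t (INR k / 2 * conv (w t) k).
Proof.
  intros Ht.
  set (f := fun s => rhs k s + INR k * w t k * mass s).
  assert (Ef : f t = INR k / 2 * conv (w t) k) by (unfold f, rhs; ring).
  rewrite <- Ef.
  apply (is_derive_R_ext (fun s => w 0 k + ((w s k - w 0 k) + INR k * w t k * M s))).
  { intros s. ring. }
  rewrite <- (Rplus_0_l (f t)).
  apply (is_derive_R_plus (fun _ => w 0 k)); [ apply is_derive_R_const | ].
  apply (is_derive_RInt (V := R_NormedModule) f _ 0).
  - exists (mkposreal t Ht). intros y Hy. change (Rabs (y - t) < t) in Hy.
    apply Rabs_lt_between in Hy.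
    apply (is_RInt_plus (V := R_NormedModule) (rhs k) (fun s => INR k * w t k * mass s)).
    + apply is_RInt_rhs. lra.
    + apply (is_RInt_scal (V := R_NormedModule) mass 0 y (INR k * w t k)).
      apply (RInt_correct (V := R_CompleteNormedModule)), ex_RInt_mass.
  - apply (continuous_R_ext (fun s => INR k / 2 * conv (w s) k + INR k * ((w t k - w s k) * mass s))).
    { intros s. unfold f, rhs. ring. }
    apply (continuous_plus (V := R_NormedModule)).
    + apply (continuous_scal_r (V := R_NormedModule) (INR k / 2) (fun s => conv (w s) k)).
      apply continuous_conv.
    + apply (continuous_scal_r (V := R_NormedModule) (INR k) (fun s => (w t k - w s k) * mass s)).
      destruct (w_lipschitz k) as [L HL].
      apply filterlim_locally. intros [eps Heps].
      rewrite Rminus_diag, Rmult_0_l.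
      assert (HL0 : 0 <= L).
      { specialize (HL t (t + 1)). replace (t + 1 - t) with 1 in HL by ring.
        rewrite Rabs_R1 in HL. pose proof (Rabs_pos (w (t + 1) k - w t k)). lra. }
      pose proof (mass_pos 0) as Hm0.
      assert (Hd : 0 < eps / (L * mass 0 + 1)) by (apply Rdiv_lt_0_compat; nra).
      exists (mkposreal _ Hd). intros y Hy. change (Rabs (y - t) < eps / (L * mass 0 + 1)) in Hy.
      change (Rabs ((w t k - w y k) * mass y - 0) < eps).
      rewrite Rminus_0_r, Rabs_mult, (Rabs_pos_eq (mass y)) by (left; apply mass_pos).
      specialize (HL y t). rewrite (Rabs_minus_sym t) in HL.
      apply Rlt_div_r in Hy; [ | nra ].
      pose proof (mass_pos y). pose proof (mass_le y). pose proof (Rabs_pos (w t k - w y k)).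
      pose proof (Rabs_pos (y - t)).
      apply Rle_lt_trans with (L * Rabs (y - t) * mass 0); [ | nra ].
      apply Rmult_le_compat; lra.
Qed.

(** exp(k M) is the integrating factor of the loss term -k v_k m_0. The usual product rule would
    need the derivative of M at t. *)
Lemma is_derive_w_exp (k : nat) (t : R) :
  0 < t ->
  is_derive (fun s => w s k * exp (INR k * (M s - M t))) t (INR k / 2 * conv (w t) k).
Proof.
  intros Ht.
  (* [A] vanishes at t and has a derivative there by [is_derive_w_shift], so its exponential factor
     need only be continuous. What remains is [H (M s - M t)] with H'(0) = 0, so that M need only be
     Lipschitz. *)
  set (A := fun s => w s k + INR k * w t k * (M s - M t) - w t k).
  set (H := fun u => w t k * ((1 - INR k * u) * exp (INR k * u))).
  apply (is_derive_R_ext (fun s => A s * exp (INR k * (M s - M t)) + H (M s - M t))).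
  { intros s. unfold A, H. ring. }
  replace (INR k / 2 * conv (w t) k) with (INR k / 2 * conv (w t) k * exp (INR k * (M t - M t)) + 0)
    by (rewrite Rminus_diag, Rmult_0_r, exp_0; ring).
  apply is_derive_R_plus.
  - apply (is_derive_mult_vanish A (fun s => exp (INR k * (M s - M t)))).
    + unfold A. ring.
    + unfold A. apply (is_derive_R_ext (fun s => (w s k + INR k * w t k * M s)
                                               + (- (INR k * w t k * M t) - w t k))).
      { intros s. ring. }
      rewrite <- (Rplus_0_r (INR k / 2 * conv (w t) k)).
      apply (is_derive_R_plus); [ | apply is_derive_R_const ].
      apply is_derive_w_shift, Ht.
    + apply (continuous_comp (fun s => INR k * (M s - M t)) exp).
      * apply (continuous_scal_r (V := R_NormedModule) (INR k) (fun s => M s - M t)).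
        apply (continuous_minus (V := R_NormedModule)); [ apply continuous_M | apply continuous_const ].
      * apply (ex_derive_continuous (V := R_NormedModule)). auto_derive. trivial.
  - apply (is_derive_comp_lipschitz_zero H (fun s => M s - M t) t (mass 0)).
    + rewrite Rminus_diag. unfold H. auto_derive; [ trivial | ].
      rewrite Rmult_0_r, exp_0. ring.
    + intros y. replace (M y - M t - (M t - M t)) with (M y - M t) by ring. apply M_lipschitz.
Qed.

(** Splitting M s as M t + (M s - M t) moves the rough part of the exponential onto [w s k], where
    [is_derive_w_exp] applies; the other factor is smooth in s. *)
Lemma is_derive_characteristic (k : nat) (X g t : R) :
  0 < t ->
  is_derive (fun s => w s k * exp (- X + (M s - g * s)) ^ k) t
    (INR k / 2 * conv (fun l => w t l * exp (- X + (M t - g * t)) ^ l) k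
     - INR k * g * (w t k * exp (- X + (M t - g * t)) ^ k)).
Proof.
  intros Ht.
  apply (is_derive_R_ext (fun s => (w s k * exp (INR k * (M s - M t)))
                                 * exp (INR k * (- X + (M t - g * s))))).
  { intros s. rewrite Rmult_assoc, <- exp_plus, exp_pow. do 2 f_equal. ring. }
  evar_last.
  { apply (is_derive_mult (fun s => w s k * exp (INR k * (M s - M t)))
             (fun s => exp (INR k * (- X + (M t - g * s))))).
    - apply is_derive_w_exp, Ht.
    - instantiate (1 := - (INR k * g) * exp (INR k * (- X + (M t - g * t)))).
      auto_derive; [ trivial | unfold Rminus; ring ].
    - intros; apply Rmult_comm. }
  unfold plus, mult; simpl. rewrite conv_mult_pow, exp_pow.
  rewrite Rminus_diag, Rmult_0_r, exp_0. ring.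
Qed.

(** * The generating function in the variable z = exp(-x) *)

Let gen (t z : R) : R := Series (fun k => w t k * z ^ k).

Lemma ex_series_gen (t z : R) : 0 <= z <= 1 -> ex_series (fun k => w t k * z ^ k).
Proof.
  intros Hz. apply (ex_series_le (V := R_CompleteNormedModule) _ (w t)); [ | apply ex_series_w ].
  intros k. change (Rabs (w t k * z ^ k) <= w t k).
  pose proof (w_ge_0 t k). pose proof (pow_unit_interval z k Hz).
  rewrite Rabs_pos_eq; nra.
Qed.

Lemma gen_term_ge_0 (t z : R) (k : nat) : 0 <= z -> 0 <= w t k * z ^ k.
Proof. intros Hz. apply Rmult_le_pos; [ apply w_ge_0 | apply pow_le, Hz ]. Qed.

Lemma gen_bounds (t z : R) : 0 <= z <= 1 -> 0 <= gen t z <= mass t.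
Proof.
  intros Hz. unfold gen. split.
  - apply Series_ge_0. intros k. apply gen_term_ge_0, Hz.
  - rewrite <- Series_w. apply Series_le; [ | apply ex_series_w ].
    intros k. split; [ apply gen_term_ge_0, Hz | ].
    pose proof (w_ge_0 t k). pose proof (pow_unit_interval z k Hz). nra.
Qed.

Lemma gen_tail_bounds (t r z : R) (n : nat) :
  0 <= z <= r -> r <= 1 ->
  0 <= gen t z - sum_n (fun k => w t k * z ^ k) n <= mass 0 * r ^ n.
Proof.
  intros Hz Hr. unfold gen.
  rewrite (Series_split _ n) by (apply ex_series_gen; lra).
  set (T := Series _). set (S0 := sum_n _ _).
  replace (S0 + T - S0) with T by ring. unfold T. split.
  - apply Series_ge_0. intros k. apply gen_term_ge_0; lra.
  - assert (Ex : ex_series (fun k => w t (S n + k)%nat)).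
    { apply (ex_series_incr_n (w t) (S n)), ex_series_w. }
    apply Rle_trans with (r ^ n * Series (fun k => w t (S n + k)%nat)).
    + rewrite <- Series_scal_l. apply Series_le.
      * intros k. split; [ apply gen_term_ge_0; lra | ].
        rewrite Rmult_comm. apply Rmult_le_compat_r; [ apply w_ge_0 | ].
        replace (S n + k)%nat with (n + S k)%nat by lia. rewrite pow_add.
        pose proof (pow_unit_interval z (S k) ltac:(lra)).
        pose proof (pow_incr z r n Hz). pose proof (pow_le z n ltac:(lra)). nra.
      * apply (ex_series_scal (V := R_NormedModule) (r ^ n)). exact Ex.
    + rewrite Rmult_comm. apply Rmult_le_compat_r; [ apply pow_le; lra | ].
      eapply Rle_trans; [ | apply (mass_le t) ]. rewrite <- (Series_w t).
      rewrite (Series_split (w t) n) by apply ex_series_w.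
      pose proof (sum_n_ge_0 (w t) n (w_ge_0 t)). lra.
Qed.

(** * The backward characteristic through (t, x) *)

Section Characteristic.

Variables t x : R.
Hypothesis Ht : 0 <= t.
Hypothesis Hx : 0 < x.

Let g := gen t (exp (- x)).
(** Here z = exp(-X), with X(s) = x + (M t - M s) - g (t - s): the characteristic that is at x at
    time t and carries the constant value [g]. *)
Let z (s : R) : R := exp (- (x + M t - g * t) + (M s - g * s)).
Let part (s : R) (n : nat) : R := sum_n (fun k => w s k * z s ^ k) n.

Lemma char_z_end : z t = exp (- x).
Proof. unfold z. f_equal. ring. Qed.

(* [gen] is at most [m0], which decreases, so following the characteristic
   backwards from time [t] stays in the domain of convergence. *)
Lemma char_z_bounds (s : R) : s <= t -> 0 <= z s <= exp (- x).
Proof.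
  intros Hs. split; [ left; apply exp_pos | ]. apply exp_le.
  pose proof (M_sub_bounds s t Hs) as [L _].
  pose proof (gen_bounds t (exp (- x)) ltac:(pose proof (exp_neg_lt_1 x Hx); lra)) as [_ U].
  fold g in U. nra.
Qed.

Lemma char_is_lim (s : R) : s <= t -> is_lim_seq (part s) (gen s (z s)).
Proof.
  intros Hs. apply (Series_correct (fun k => w s k * z s ^ k)), ex_series_gen.
  pose proof (char_z_bounds s Hs). pose proof (exp_neg_lt_1 x Hx). lra.
Qed.

(** The gain and loss terms combine, through [sum_conv], into a truncation of (G - g) times the sum
    of l u_l, with u_l = w_l z^l. This factor G - g is what makes a Gronwall argument possible. *)
Lemma char_is_derive (n : nat) (s : R) :
  0 < s ->
  is_derive (fun r => part r n) s
    (sum_n (fun l => INR l * (w s l * z s ^ l) * (part s (n - l) - g)) n).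
Proof.
  intros Hs.
  replace (sum_n (fun l => INR l * (w s l * z s ^ l) * (part s (n - l) - g)) n)
    with (sum_n (fun k => INR k / 2 * conv (fun l => w s l * z s ^ l) k
                          - INR k * g * (w s k * z s ^ k)) n).
  - apply (is_derive_sum_n (K := R_AbsRing) (V := R_NormedModule) (fun k r => w r k * z r ^ k)).
    intros k _. apply is_derive_characteristic, Hs.
  - transitivity (sum_n (fun k => INR k / 2 * conv (fun l => w s l * z s ^ l) k) n
                  + sum_n (fun k => - (INR k * g * (w s k * z s ^ k))) n).
    { rewrite <- sum_n_R_plus. apply sum_n_R_ext. intros; ring. }
    rewrite sum_conv, <- sum_n_R_plus. apply sum_n_R_ext. intros l _.
    unfold part. ring.
Qed.

Lemma char_continuous (n : nat) (s : R) : continuous (fun r => part r n) s.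
Proof.
  assert (Hz : continuous z s).
  { unfold z. apply (continuous_comp (fun r => - (x + M t - g * t) + (M r - g * r)) exp).
    - apply (continuous_plus (V := R_NormedModule)); [ apply continuous_const | ].
      apply (continuous_minus (V := R_NormedModule)); [ apply continuous_M | ].
      apply (continuous_scal_r (V := R_NormedModule) g (fun r => r)). apply continuous_id.
    - apply (ex_derive_continuous (V := R_NormedModule)). auto_derive. trivial. }
  assert (Ha : forall k, continuous (fun r => w r k * z r ^ k) s).
  { intros k. apply (continuous_mult (K := R_AbsRing)); [ apply continuous_w | ].
    apply (continuous_comp z (fun y => y ^ k)); [ exact Hz | ].
    apply (ex_derive_continuous (V := R_NormedModule)). auto_derive. trivial. }
  unfold part. induction n as [|n IH].
  - apply (continuous_R_ext (fun r => w r 0%nat * z r ^ 0)); [ | apply Ha ].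
    intros; rewrite sum_O; reflexivity.
  - apply (continuous_R_ext (fun r => sum_n (fun k => w r k * z r ^ k) n + w r (S n) * z r ^ S n)).
    + intros; rewrite sum_n_R_S; reflexivity.
    + apply (continuous_plus (V := R_NormedModule)); [ exact IH | apply Ha ].
Qed.

(** Each factor [part s (n - l) - g] is at most |G - g| plus a tail of order r^(n-l), where r =
    exp(-x). The first is summed with l r^l <= 1/x; in the second, r^l r^(n-l) = r^n does not depend
    on l, whence an error of order n r^n, which tends to 0. *)
Lemma char_derive_bound (n : nat) (s : R) :
  s <= t ->
  Rabs (sum_n (fun l => INR l * (w s l * z s ^ l) * (part s (n - l) - g)) n)
  <= mass 0 / x * Rabs (gen s (z s) - g) + mass 0 * mass 0 * (INR n * exp (- x) ^ n).
Proof.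
  intros Hs. pose proof (char_z_bounds s Hs) as Hz. pose proof (exp_neg_lt_1 x Hx) as He.
  pose proof (mass_pos 0) as Hm.
  set (d := Rabs (gen s (z s) - g)). set (r := exp (- x)) in *.
  assert (Hd : 0 <= d) by apply Rabs_pos.
  eapply Rle_trans; [ apply Rabs_sum_n_le | ].
  apply Rle_trans with (sum_n (fun l => (d / x + mass 0 * (INR n * r ^ n)) * w s l) n).
  - apply sum_n_le_compat. intros l Hl.
    pose proof (w_ge_0 s l) as Hw. pose proof (pos_INR l).
    pose proof (pow_le (z s) l (proj1 Hz)) as Hz0. pose proof (pow_incr _ _ l Hz) as Hz1.
    pose proof (gen_tail_bounds s r (z s) (n - l) Hz ltac:(lra)) as Tl.
    fold (part s (n - l)) in Tl.
    assert (Hp : Rabs (part s (n - l) - g) <= d + mass 0 * r ^ (n - l)).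
    { replace (part s (n - l) - g)
        with ((gen s (z s) - g) + - (gen s (z s) - part s (n - l))) by ring.
      eapply Rle_trans; [ apply Rabs_triang | ]. rewrite Rabs_Ropp.
      rewrite (Rabs_pos_eq (gen s (z s) - part s (n - l))) by lra. unfold d. lra. }
    rewrite Rabs_mult, (Rabs_pos_eq (INR l * (w s l * z s ^ l)))
      by (repeat apply Rmult_le_pos; lra).
    apply Rle_trans with (INR l * (w s l * r ^ l) * (d + mass 0 * r ^ (n - l))).
    { apply Rmult_le_compat; try apply Rabs_pos; try exact Hp.
      - repeat apply Rmult_le_pos; lra.
      - apply Rmult_le_compat_l; [ lra | ]. apply Rmult_le_compat_l; lra. }
    replace (INR l * (w s l * r ^ l) * (d + mass 0 * r ^ (n - l)))
      with ((INR l * r ^ l * d + mass 0 * (INR l * (r ^ l * r ^ (n - l)))) * w s l) by ring.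
    rewrite <- pow_add. replace (l + (n - l))%nat with n by lia.
    apply Rmult_le_compat_r; [ exact Hw | ].
    apply Rplus_le_compat.
    + unfold Rdiv. rewrite (Rmult_comm d). apply Rmult_le_compat_r; [ exact Hd | ].
      apply INR_mul_exp_pow_le, Hx.
    + apply Rmult_le_compat_l; [ lra | ].
      apply Rmult_le_compat_r; [ apply pow_le; lra | apply le_INR; exact Hl ].
  - rewrite sum_n_R_mult_l.
    pose proof (sum_n_le_Series (w s) n (w_ge_0 s) (ex_series_w s)) as Q.
    rewrite Series_w in Q. pose proof (mass_le s).
    apply Rle_trans with ((d / x + mass 0 * (INR n * r ^ n)) * mass 0).
    + apply Rmult_le_compat_l; [ | lra ].
      apply Rplus_le_le_0_compat; [ apply Rdiv_le_0_compat; lra | ].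
      apply Rmult_le_pos; [ lra | ].
      apply Rmult_le_pos; [ apply pos_INR | apply pow_le; lra ].
    + right. field. lra.
Qed.

(** Gronwall in a weighted norm: integrating the rate b = [mass 0 / x] against exp(2 b (t - s))
    gains the factor 1/2. The comparison is made on the truncations by monotonicity, for both signs
    [sg], and n tends to infinity afterwards; continuity takes care of s = 0, since derivatives are
    available only at positive times. *)
Lemma char_halving (c : R) :
  (forall s, 0 <= s <= t -> Rabs (gen s (z s) - g) <= c * exp (2 * (mass 0 / x) * (t - s))) ->
  (forall s, 0 <= s <= t -> Rabs (gen s (z s) - g) <= c / 2 * exp (2 * (mass 0 / x) * (t - s))).
Proof.
  intros H s Hs. pose proof (mass_pos 0) as Hm.
  set (b := mass 0 / x) in *.
  set (eps := fun n => mass 0 * mass 0 * (INR n * exp (- x) ^ n)).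
  assert (Hc : 0 <= c).
  { specialize (H t ltac:(lra)). rewrite Rminus_diag, Rmult_0_r, exp_0 in H.
    pose proof (Rabs_pos (gen t (z t) - g)). lra. }
  set (E := fun r => c / 2 * exp (2 * b * (t - r))).
  assert (K : forall sg n, sg = 1 \/ sg = -1 ->
            sg * (part s n - part t n) <= E s - E t + eps n * (t - s)).
  { intros sg n Hsg.
    enough (sg * part s n - E s + eps n * s <= sg * part t n - E t + eps n * t) by lra.
    apply (is_derive_nonneg_le (fun r => sg * part r n - E r + eps n * r)
             (fun r => sg * sum_n (fun l => INR l * (w r l * z r ^ l) * (part r (n - l) - g)) n
                       + b * c * exp (2 * b * (t - r)) + eps n)).
    - lra.
    - intros r Hr.
      apply (is_derive_R_ext (fun r => sg * part r n + (eps n * r - E r)));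
        [ intros; ring | ].
      rewrite Rplus_assoc. apply is_derive_R_plus.
      + apply (is_derive_scal (fun r => part r n)). apply char_is_derive. lra.
      + unfold E. auto_derive; [ trivial | ]. unfold Rminus. field.
    - intros r.
      apply (continuous_plus (V := R_NormedModule) (fun r => sg * part r n - E r)).
      + apply (continuous_minus (V := R_NormedModule) (fun r => sg * part r n) E).
        * apply (continuous_scal_r (V := R_NormedModule) sg (fun r => part r n)).
          apply char_continuous.
        * apply (ex_derive_continuous (V := R_NormedModule)). unfold E. auto_derive. trivial.
      + apply (ex_derive_continuous (V := R_NormedModule)). auto_derive. trivial.
    - intros r Hr. pose proof (char_derive_bound n r ltac:(lra)) as B.
      fold b in B. fold (eps n) in B. specialize (H r ltac:(lra)).
      assert (Hb : 0 <= b) by (unfold b; apply Rdiv_le_0_compat; lra).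
      apply (Rmult_le_compat_l b) in H; [ | exact Hb ].
      apply Rabs_le_between in B. destruct Hsg as [-> | ->]; lra. }
  assert (L : forall sg, sg = 1 \/ sg = -1 -> sg * (gen s (z s) - gen t (z t)) <= E s - E t).
  { intros sg Hsg.
    assert (LL : is_lim_seq (fun n => sg * (part s n - part t n)) (sg * (gen s (z s) - gen t (z t)))).
    { apply is_lim_seq_mult'; [ apply is_lim_seq_const | ].
      apply is_lim_seq_minus'; apply char_is_lim; lra. }
    assert (LR : is_lim_seq (fun n => E s - E t + eps n * (t - s)) (E s - E t + mass 0 * mass 0 * 0 * (t - s))).
    { apply is_lim_seq_plus'; [ apply is_lim_seq_const | ].
      apply is_lim_seq_mult'; [ | apply is_lim_seq_const ].
      apply is_lim_seq_mult'; [ apply is_lim_seq_const | apply is_lim_INR_mul_exp_pow, Hx ]. }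
    pose proof (is_lim_seq_le _ _ _ _ (fun n => K sg n Hsg) LL LR) as LE. simpl in LE. lra. }
  rewrite char_z_end in L. fold g in L.
  pose proof (L 1 (or_introl eq_refl)). pose proof (L (-1) (or_intror eq_refl)).
  assert (0 <= E t) by (unfold E; apply Rmult_le_pos; [ lra | left; apply exp_pos ]).
  fold (E s). apply Rabs_le_between. lra.
Qed.

Lemma gen_characteristic : gen 0 (exp (- (x + M t - t * gen t (exp (- x))))) = gen t (exp (- x)).
Proof.
  pose proof (exp_neg_lt_1 x Hx) as He. pose proof (mass_pos 0) as Hm.
  (* The trivial bound by [mass 0] starts the iteration; halving it indefinitely forces G = g along
     the characteristic. *)
  assert (P : forall n s, 0 <= s <= t ->
            Rabs (gen s (z s) - g) <= mass 0 * (1 / 2) ^ n * exp (2 * (mass 0 / x) * (t - s))).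
  { induction n as [|n IH].
    - intros s Hs. simpl. rewrite Rmult_1_r.
      pose proof (char_z_bounds s ltac:(lra)).
      pose proof (gen_bounds s (z s) ltac:(lra)). pose proof (mass_le s).
      pose proof (gen_bounds t (exp (- x)) ltac:(lra)) as Hg. fold g in Hg. pose proof (mass_le t).
      assert (1 <= exp (2 * (mass 0 / x) * (t - s))).
      { rewrite <- exp_0. apply exp_le.
        assert (0 <= mass 0 / x) by (apply Rdiv_le_0_compat; lra). nra. }
      apply Rle_trans with (mass 0); [ apply Rabs_le_between; lra | nra ].
    - intros s Hs.
      replace (mass 0 * (1 / 2) ^ S n) with (mass 0 * (1 / 2) ^ n / 2) by (simpl; field).
      apply char_halving; assumption. }
  assert (E : gen 0 (z 0) - g = 0).
  { apply Rabs_eq_0. apply Rle_antisym; [ | apply Rabs_pos ].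
    set (c := exp (2 * (mass 0 / x) * (t - 0))).
    assert (L : is_lim_seq (fun n => mass 0 * (1 / 2) ^ n * c) (mass 0 * 0 * c)).
    { apply is_lim_seq_mult'; [ | apply is_lim_seq_const ].
      apply is_lim_seq_mult'; [ apply is_lim_seq_const | ].
      apply is_lim_seq_geom. rewrite Rabs_pos_eq; lra. }
    pose proof (is_lim_seq_le _ _ _ _ (fun n => P n 0 (conj (Rle_refl 0) Ht))
                  (is_lim_seq_const _) L) as LE.
    simpl in LE. lra. }
  assert (Ez : z 0 = exp (- (x + M t - t * g))) by (unfold z; rewrite M_0; f_equal; ring).
  rewrite Ez in E. unfold g in *. lra.
Qed.

End Characteristic.

Lemma sum_n_w_le_mass (t : R) (n : nat) : sum_n (w t) n <= mass t.
Proof. rewrite <- Series_w. apply sum_n_le_Series; [ apply w_ge_0 | apply ex_series_w ]. Qed.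

(** Abel's theorem at z = 1: truncate where the tail is below eps/2, then use exp(-k x) >= 1 - k x
    on the finite part. *)
Lemma gen_near_1 (t eps : R) :
  0 < eps -> exists d, 0 < d /\ forall x, 0 < x < d -> mass t - gen t (exp (- x)) < eps.
Proof.
  intros Heps. pose proof (mass_pos t) as Hm.
  assert (L : is_lim_seq (sum_n (w t)) (mass t))
    by (rewrite <- Series_w; exact (Series_correct _ (ex_series_w t))).
  apply is_lim_seq_spec in L.
  destruct (L (mkposreal (eps / 2) ltac:(lra))) as [n Hn]. specialize (Hn n (le_n n)).
  simpl in Hn. apply Rabs_lt_between in Hn.
  pose proof (pos_INR n) as Hn0.
  exists (eps / (2 * ((INR n + 1) * mass t))). split.
  { apply Rdiv_lt_0_compat; [ exact Heps | ]. apply Rmult_lt_0_compat; [ lra | nra ]. }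
  intros x [Hx Hxd].
  assert (Hz : 0 <= exp (- x) <= 1).
  { split; [ left; apply exp_pos | ]. rewrite <- exp_0. apply exp_le. lra. }
  apply Rlt_div_r in Hxd; [ | apply Rmult_lt_0_compat; [ lra | nra ] ].
  pose proof (sum_n_le_Series (fun k => w t k * exp (- x) ^ k) n
                (fun k => gen_term_ge_0 t _ k (proj1 Hz)) (ex_series_gen t _ Hz)) as Q.
  fold (gen t (exp (- x))) in Q.
  assert (Q2 : (1 - INR n * x) * sum_n (w t) n <= sum_n (fun k => w t k * exp (- x) ^ k) n).
  { rewrite <- sum_n_R_mult_l. apply sum_n_le_compat. intros k Hk.
    rewrite Rmult_comm. apply Rmult_le_compat_l; [ apply w_ge_0 | ].
    rewrite exp_pow. pose proof (exp_ineq1_le (INR k * - x)).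
    apply le_INR in Hk. nra. }
  pose proof (sum_n_w_le_mass t n). pose proof (sum_n_ge_0 (w t) n (w_ge_0 t)).
  assert (INR n * x * sum_n (w t) n <= INR n * x * mass t)
    by (apply Rmult_le_compat_l; [ apply Rmult_le_pos; lra | lra ]).
  assert (0 <= x * mass t) by (apply Rmult_le_pos; lra).
  lra.
Qed.

(** * The initial generating function as a finite exponential sum *)

Variable N : nat.
Hypothesis Hfin : forall k, (N <= k)%nat -> v 0 k = 0.

(* [(-1)^j] times the [j]-th derivative of [y |-> gen 0 (exp (- y))]; being a finite
   sum it makes sense for every real [y]. *)
Let E (j : nat) (y : R) : R := sum_n (fun k => INR k ^ j * w 0 k * exp (- (INR k * y))) N.

Lemma w0_large (k : nat) : (N < k)%nat -> w 0 k = 0.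
Proof. intros Hk. unfold w. destruct k; [ reflexivity | apply Hfin; lia ]. Qed.

Lemma E_coef_ge_0 (j k : nat) : 0 <= INR k ^ j * w 0 k.
Proof. apply Rmult_le_pos; [ apply pow_le, pos_INR | apply w_ge_0 ]. Qed.

Lemma gen_0_exp (y : R) : 0 <= y -> gen 0 (exp (- y)) = E 0 y.
Proof.
  intros Hy. unfold gen, E.
  assert (Hz : 0 <= exp (- y) <= 1).
  { split; [ left; apply exp_pos | ]. rewrite <- exp_0. apply exp_le. lra. }
  rewrite (Series_split _ N) by (apply ex_series_gen, Hz).
  rewrite (Series_ext (fun k => w 0 (S N + k) * exp (- y) ^ (S N + k)) (fun k => 0 * (fun _ => 0) k)).
  - rewrite Series_scal_l, Rmult_0_l, Rplus_0_r. apply sum_n_R_ext. intros k _.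
    rewrite exp_pow. simpl. rewrite Rmult_1_l. do 2 f_equal. ring.
  - intros k. rewrite w0_large by lia. ring.
Qed.

Lemma mass_0 : mass 0 = E 0 0.
Proof.
  rewrite <- gen_0_exp by lra. rewrite Ropp_0, exp_0. unfold gen. rewrite <- Series_w.
  apply Series_ext. intros k. rewrite pow1. ring.
Qed.

(** All terms are nonnegative, so otherwise every [w 0 k] would vanish, and with them the positive
    initial mass. The index 0, where [INR k ^ j] may be 0, has weight 0 anyway. *)
Lemma E_pos (j : nat) (y : R) : 0 < E j y.
Proof.
  destruct (Rle_lt_dec (E j y) 0) as [Hle | Hlt]; [ exfalso | exact Hlt ].
  assert (Z : forall k, w 0 k = 0).
  { intros k. destruct (Nat.le_gt_cases k N) as [Hk | Hk]; [ | apply w0_large, Hk ].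
    destruct k as [|k]; [ reflexivity | ].
    destruct (w_ge_0 0 (S k)) as [Hp | He]; [ exfalso | symmetry; exact He ].
    assert (B : forall n, (S k <= n)%nat ->
              INR (S k) ^ j * w 0 (S k) * exp (- (INR (S k) * y))
              <= sum_n (fun k => INR k ^ j * w 0 k * exp (- (INR k * y))) n).
    { assert (Nn : forall i, 0 <= INR i ^ j * w 0 i * exp (- (INR i * y))).
      { intros i. apply Rmult_le_pos; [ apply E_coef_ge_0 | left; apply exp_pos ]. }
      intros n Hn. induction Hn as [|n Hn IH].
      - rewrite sum_n_R_S.
        pose proof (sum_n_ge_0 (fun i => INR i ^ j * w 0 i * exp (- (INR i * y))) k Nn). lra.
      - rewrite sum_n_R_S. specialize (Nn (S n)). lra. }
    specialize (B N Hk). fold (E j y) in B.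
    assert (0 < INR (S k) ^ j * w 0 (S k) * exp (- (INR (S k) * y))).
    { apply Rmult_lt_0_compat; [ | apply exp_pos ].
      apply Rmult_lt_0_compat; [ apply pow_lt, lt_0_INR; lia | exact Hp ]. }
    lra. }
  pose proof (mass_pos 0) as Hm. rewrite <- Series_w in Hm.
  rewrite (Series_ext _ (fun k => 0 * (fun _ => 0) k)) in Hm
    by (intros; rewrite Z; ring).
  rewrite Series_scal_l in Hm. lra.
Qed.

Lemma is_derive_E (j : nat) (y : R) : is_derive (E j) y (- E (S j) y).
Proof.
  replace (- E (S j) y)
    with (sum_n (fun k => INR k ^ j * w 0 k * (- INR k * exp (- (INR k * y)))) N).
  - apply (is_derive_sum_n (K := R_AbsRing) (V := R_NormedModule)
             (fun k y => INR k ^ j * w 0 k * exp (- (INR k * y)))).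
    intros k _. auto_derive; [ trivial | ring ].
  - unfold E. replace (- sum_n (fun k => INR k ^ S j * w 0 k * exp (- (INR k * y))) N)
      with (-1 * sum_n (fun k => INR k ^ S j * w 0 k * exp (- (INR k * y))) N) by ring.
    rewrite <- sum_n_R_mult_l. apply sum_n_R_ext. intros; simpl; ring.
Qed.

Lemma continuous_E (j : nat) (y : R) : continuous (E j) y.
Proof.
  apply (ex_derive_continuous (V := R_NormedModule)). eexists. apply is_derive_E.
Qed.

(** Convexity, term by term from exp(u) >= 1 + u; it holds for a and b in either order. *)
Lemma E_tangent (j : nat) (a b : R) : E j a - E (S j) a * (b - a) <= E j b.
Proof.
  unfold E. replace (sum_n (fun k => INR k ^ j * w 0 k * exp (- (INR k * a))) N -
    sum_n (fun k => INR k ^ S j * w 0 k * exp (- (INR k * a))) N * (b - a))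
    with (sum_n (fun k => INR k ^ j * w 0 k * exp (- (INR k * a))) N +
      (a - b) * sum_n (fun k => INR k ^ S j * w 0 k * exp (- (INR k * a))) N) by ring.
  rewrite <- sum_n_R_mult_l, <- sum_n_R_plus. apply sum_n_le_compat. intros k _.
  replace (INR k ^ j * w 0 k * exp (- (INR k * a)) +
           (a - b) * (INR k ^ S j * w 0 k * exp (- (INR k * a))))
    with (INR k ^ j * w 0 k * (exp (- (INR k * a)) * (1 + INR k * (a - b)))) by (simpl; ring).
  apply Rmult_le_compat_l; [ apply E_coef_ge_0 | ].
  replace (- (INR k * b)) with (- (INR k * a) + INR k * (a - b)) by ring.
  rewrite exp_plus. apply Rmult_le_compat_l; [ left; apply exp_pos | apply exp_ineq1_le ].
Qed.

Lemma E_lt (j : nat) (a b : R) : a < b -> E j b < E j a.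
Proof.
  intros H. pose proof (E_tangent j b a). pose proof (E_pos (S j) b). nra.
Qed.

Lemma E_le (j : nat) (a b : R) : a <= b -> E j b <= E j a.
Proof. intros [H | ->]; [ left; apply E_lt, H | lra ]. Qed.

(** [exp_taylor2] at u = k d for each exponential. The factor exp(-u) of its lower bound moves the
    second derivative from a to a + d. *)
Lemma E_taylor2 (a d : R) :
  0 <= d ->
  E 2 (a + d) * d ^ 2 / 2 <= E 0 (a + d) - E 0 a + E 1 a * d <= E 2 a * d ^ 2 / 2.
Proof.
  intros Hd.
  assert (Em : E 0 (a + d) - E 0 a + E 1 a * d
    = sum_n (fun k => w 0 k * exp (- (INR k * a)) * (exp (- (INR k * d)) - 1 + INR k * d)) N).
  { replace (E 0 (a + d) - E 0 a + E 1 a * d) with (E 0 (a + d) + -1 * E 0 a + d * E 1 a) by ring.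
    unfold E. rewrite <- !sum_n_R_mult_l, <- !sum_n_R_plus. apply sum_n_R_ext. intros k _.
    replace (- (INR k * (a + d))) with (- (INR k * a) + - (INR k * d)) by ring.
    rewrite exp_plus. simpl. ring. }
  rewrite Em. unfold E.
  assert (Es : forall y, sum_n (fun k => INR k ^ 2 * w 0 k * exp (- (INR k * y))) N * d ^ 2 / 2
     = sum_n (fun k => d ^ 2 / 2 * (INR k ^ 2 * w 0 k * exp (- (INR k * y)))) N)
    by (intros y; rewrite sum_n_R_mult_l; field).
  rewrite !Es.
  split; apply sum_n_le_compat; intros k _;
    pose proof (exp_taylor2 (INR k * d) ltac:(apply Rmult_le_pos; [ apply pos_INR | exact Hd ])) as [L U];
    pose proof (w_ge_0 0 k); pose proof (exp_pos (- (INR k * a))).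
  - replace (- (INR k * (a + d))) with (- (INR k * a) + - (INR k * d)) by ring.
    rewrite exp_plus.
    replace (d ^ 2 / 2 * (INR k ^ 2 * w 0 k * (exp (- (INR k * a)) * exp (- (INR k * d)))))
      with (w 0 k * exp (- (INR k * a)) * (exp (- (INR k * d)) * (INR k * d) ^ 2 / 2)) by (field).
    apply Rmult_le_compat_l; [ apply Rmult_le_pos; lra | exact L ].
  - replace (d ^ 2 / 2 * (INR k ^ 2 * w 0 k * exp (- (INR k * a))))
      with (w 0 k * exp (- (INR k * a)) * ((INR k * d) ^ 2 / 2)) by field.
    apply Rmult_le_compat_l; [ apply Rmult_le_pos; lra | exact U ].
Qed.

(** * The foot of the characteristic arriving at x = 0 *)

Let theta (t : R) : R := M t - t * mass t.
(** [eta t x] is the position at time 0 of the characteristic that is at x at time t; [theta t] is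
    its limit as x tends to 0. *)
Let eta (t x : R) : R := x + M t - t * gen t (exp (- x)).

Lemma theta_ge_0 (t : R) : 0 <= t -> 0 <= theta t.
Proof.
  intros Ht. pose proof (M_sub_bounds 0 t Ht). rewrite M_0 in *. unfold theta. lra.
Qed.

Lemma gen_exp_le_mass (t x : R) : 0 < x -> 0 <= gen t (exp (- x)) <= mass t.
Proof.
  intros Hx. apply gen_bounds. pose proof (exp_neg_lt_1 x Hx). lra.
Qed.

Lemma eta_bounds (t x : R) : 0 <= t -> 0 < x -> theta t + x <= eta t x.
Proof.
  intros Ht Hx. pose proof (gen_exp_le_mass t x Hx). unfold theta, eta. nra.
Qed.

Lemma gen_eta (t x : R) : 0 <= t -> 0 < x -> gen t (exp (- x)) = E 0 (eta t x).
Proof.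
  intros Ht Hx. rewrite <- gen_0_exp.
  - symmetry. apply gen_characteristic; assumption.
  - pose proof (eta_bounds t x Ht Hx). pose proof (theta_ge_0 t Ht). lra.
Qed.

Lemma eta_near_0 (t eps : R) :
  0 <= t -> 0 < eps -> exists d, 0 < d /\ forall x, 0 < x < d -> eta t x - theta t < eps.
Proof.
  intros Ht Heps.
  assert (H0 : 0 < eps / (2 * (t + 1))) by (apply Rdiv_lt_0_compat; lra).
  destruct (gen_near_1 t _ H0) as [d [Hd H]].
  exists (Rmin d (eps / 2)). split; [ apply Rmin_pos; lra | ].
  intros x Hx. pose proof (Rmin_l d (eps / 2)). pose proof (Rmin_r d (eps / 2)).
  specialize (H x ltac:(lra)). apply Rlt_div_r in H; [ | lra ].
  pose proof (gen_exp_le_mass t x ltac:(lra)).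
  unfold eta, theta. nra.
Qed.

(** The limit x -> 0 in [gen_eta]; the tangent inequality bounds the variation of [E 0] between
    [theta] and [eta] by [E 1 (theta t)] times their distance. *)
Lemma mass_theta (t : R) : 0 <= t -> mass t = E 0 (theta t).
Proof.
  intros Ht. apply Rminus_diag_uniq.
  assert (H : forall eps, 0 < eps -> Rabs (mass t - E 0 (theta t)) <= eps * (1 + E 1 (theta t))).
  { intros eps Heps.
    destruct (eta_near_0 t eps Ht Heps) as [d1 [Hd1 H1]].
    destruct (gen_near_1 t eps Heps) as [d2 [Hd2 H2]].
    set (x := Rmin d1 d2 / 2).
    pose proof (Rmin_l d1 d2). pose proof (Rmin_r d1 d2).
    assert (0 < Rmin d1 d2) by (apply Rmin_pos; lra).
    assert (Hx : 0 < x) by (unfold x; lra).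
    specialize (H1 x ltac:(unfold x; lra)). specialize (H2 x ltac:(unfold x; lra)).
    pose proof (eta_bounds t x Ht Hx) as Hb.
    pose proof (E_le 0 (theta t) (eta t x) ltac:(lra)).
    pose proof (E_tangent 0 (theta t) (eta t x)).
    pose proof (E_pos 1 (theta t)).
    pose proof (gen_exp_le_mass t x Hx).
    rewrite gen_eta in * by assumption.
    apply Rabs_le_between. nra. }
  pose proof (E_pos 1 (theta t)) as HE.
  apply Rabs_eq_0. apply Rle_antisym; [ | apply Rabs_pos ].
  apply Rnot_lt_le. intros Hlt. set (a := Rabs _) in *.
  specialize (H (a / (2 * (1 + E 1 (theta t))))).
  assert (0 < a / (2 * (1 + E 1 (theta t)))) by (apply Rdiv_lt_0_compat; lra).
  specialize (H ltac:(assumption)).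
  replace (a / (2 * (1 + E 1 (theta t))) * (1 + E 1 (theta t))) with (a / 2) in H
    by (field; lra).
  lra.
Qed.

(** The characteristic leaving y at time 0 with value [E 0 y] is at [h t y - M t] at time t. For t
    >= 0 this map is convex in y. *)
Let h (t y : R) : R := y + t * E 0 y.

Lemma h_theta (t : R) : 0 <= t -> h t (theta t) = M t.
Proof. intros Ht. unfold h. rewrite <- mass_theta by exact Ht. unfold theta. ring. Qed.

Lemma h_eta (t x : R) : 0 <= t -> 0 < x -> h t (eta t x) = M t + x.
Proof.
  intros Ht Hx. unfold h. rewrite <- gen_eta by assumption. unfold eta. ring.
Qed.

Lemma h_tangent (t a b : R) : 0 <= t -> h t a + (1 - t * E 1 a) * (b - a) <= h t b.
Proof.
  intros Ht. pose proof (E_tangent 0 a b). unfold h. nra.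
Qed.

(** Some [eta t x] lies strictly between [theta t] and y, and there h equals M t + x > h(theta). By
    convexity the slope of h at that point is positive, so h is still larger at y. *)
Lemma h_theta_le_right (t y : R) : 0 <= t -> theta t <= y -> M t <= h t y.
Proof.
  intros Ht [Hy | <-]; [ | rewrite h_theta by exact Ht; lra ].
  destruct (eta_near_0 t (y - theta t) Ht ltac:(lra)) as [d [Hd H]].
  specialize (H (d / 2) ltac:(lra)).
  pose proof (eta_bounds t (d / 2) Ht ltac:(lra)) as Hb.
  pose proof (h_eta t (d / 2) Ht ltac:(lra)) as He.
  pose proof (h_theta t Ht) as Hth.
  set (z := eta t (d / 2)) in *.
  pose proof (h_tangent t z (theta t) Ht). pose proof (h_tangent t z y Ht).
  assert (0 < 1 - t * E 1 z) by nra. nra.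
Qed.

(* [s |-> h s y - M s] is nonnegative while [theta s <= y], and nondecreasing
   once [theta s > y], where [M' = m0 = E 0 (theta s) < E 0 y]. *)
Lemma M_le_h (t y : R) : 0 <= t -> 0 <= y -> M t <= h t y.
Proof.
  intros Ht Hy.
  destruct (Rle_lt_dec (theta t) y) as [Hle | Hgt]; [ apply h_theta_le_right; assumption | ].
  destruct (completeness (fun s => 0 <= s <= t /\ theta s <= y)) as [sg [Hub Hlub]].
  - exists t. intros s [[_ Hs] _]. exact Hs.
  - exists 0. split; [ lra | ]. unfold theta. rewrite M_0. lra.
  - set (F := fun s => h s y - M s).
    pose proof (E_pos 0 y) as HE. pose proof (mass_pos 0) as Hm.
    assert (HF : forall s r, s <= r -> F s - F r <= (E 0 y + mass 0) * (r - s)).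
    { intros s r Hsr. pose proof (M_sub_bounds s r Hsr). pose proof (mass_le s).
      unfold F, h. nra. }
    assert (Hsg0 : 0 <= sg).
    { apply Hub. split; [ lra | ]. unfold theta. rewrite M_0. lra. }
    assert (Hsgt : sg <= t) by (apply Hlub; intros s [[_ Hs] _]; exact Hs).
    apply Rnot_lt_le. intros Hlt.
    (* [theta] may jump at [sg], so the two regimes are joined through points s1 and s2 at most 2e
       apart; by [HF] the loss in between is at most half of the assumed gap [M t - h t y]. *)
    set (e := (M t - h t y) / (4 * (E 0 y + mass 0))).
    assert (He : 0 < e) by (apply Rdiv_lt_0_compat; lra).
    assert (Hex : exists s1, (0 <= s1 <= t /\ theta s1 <= y) /\ sg - e < s1).
    { apply NNPP. intros Hno.
      assert (sg <= sg - e); [ | lra ].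
      apply Hlub. intros s Hs. apply Rnot_lt_le. intros Hs2. apply Hno. exists s. auto. }
    destruct Hex as [s1 [[Hs1 Hth1] Hs1e]].
    assert (Hs1sg : s1 <= sg) by (apply Hub; auto).
    assert (F1 : 0 <= F s1).
    { unfold F. pose proof (h_theta_le_right s1 y ltac:(lra) Hth1). lra. }
    set (s2 := Rmin t (sg + e)).
    pose proof (Rmin_l t (sg + e)) as M1. pose proof (Rmin_r t (sg + e)) as M2.
    fold s2 in M1, M2.
    assert (Hs12 : s1 <= s2) by (unfold s2; apply Rmin_glb; lra).
    assert (F2 : F s2 <= F t).
    { destruct (Req_dec s2 t) as [-> | Hne]; [ lra | ].
      assert (Hs2sg : sg < s2).
      { unfold s2 in *. unfold Rmin in *. destruct Rle_dec; lra. }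
      assert (Hth2 : y < theta s2).
      { apply Rnot_le_lt. intros Hc.
        assert (s2 <= sg) by (apply Hub; split; [ lra | exact Hc ]). lra. }
      apply (E_lt 0) in Hth2. rewrite <- mass_theta in Hth2 by lra.
      pose proof (M_sub_bounds s2 t M1). unfold F, h. nra. }
    specialize (HF s1 s2 Hs12).
    assert ((E 0 y + mass 0) * (s2 - s1) <= (E 0 y + mass 0) * (2 * e))
      by (apply Rmult_le_compat_l; lra).
    assert ((E 0 y + mass 0) * (2 * e) = (M t - h t y) / 2) by (unfold e; field; lra).
    unfold F in *. lra.
Qed.

(** Otherwise h has the negative slope 1 - t E_1 at [theta] and drops, just to the right, below its
    minimum M t. *)
Lemma theta_stationary_le (t : R) : 0 <= t -> t * E 1 (theta t) <= 1.
Proof.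
  intros Ht. apply Rnot_lt_le. intros Hlt.
  pose proof (theta_ge_0 t Ht) as H0. pose proof (E_pos 2 (theta t)) as H2.
  set (c := t * E 1 (theta t) - 1) in *.
  (* Over a distance e, t E_1 decreases by at most e t E_2(theta) < c, so the slope of h is still
     negative at theta + e. *)
  set (e := c / (2 * (t * E 2 (theta t) + 1))).
  assert (Hden : 0 < t * E 2 (theta t) + 1) by nra.
  assert (He : 0 < e) by (apply Rdiv_lt_0_compat; unfold c; lra).
  pose proof (M_le_h t (theta t + e) Ht ltac:(lra)) as Hm. rewrite <- h_theta in Hm by exact Ht.
  pose proof (h_tangent t (theta t + e) (theta t) Ht) as Htg.
  pose proof (E_tangent 1 (theta t) (theta t + e)) as Hte.
  assert (Hle : t * E 1 (theta t + e) <= 1) by nra.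
  assert (t * (E 1 (theta t) - E 2 (theta t) * e) <= 1).
  { eapply Rle_trans; [ | exact Hle ]. apply Rmult_le_compat_l; [ exact Ht | ].
    replace (theta t + e - theta t) with e in Hte by ring. exact Hte. }
  assert (e * (t * E 2 (theta t) + 1) = c / 2) by (unfold e; field; lra).
  unfold c in *. nra.
Qed.

(** The mirror image, to the left of [theta]: positivity of [theta] leaves room inside y >= 0, and
    [E 2 0] bounds [E 2] there. *)
Lemma theta_stationary_ge (t : R) : 0 <= t -> 0 < theta t -> 1 <= t * E 1 (theta t).
Proof.
  intros Ht H0. apply Rnot_lt_le. intros Hlt.
  pose proof (E_pos 2 0) as H2.
  set (c := 1 - t * E 1 (theta t)) in *.
  set (e := Rmin (theta t) (c / (2 * (t * E 2 0 + 1)))).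
  assert (Hden : 0 < t * E 2 0 + 1) by nra.
  assert (He : 0 < e).
  { apply Rmin_pos; [ exact H0 | ]. apply Rdiv_lt_0_compat; unfold c; lra. }
  pose proof (Rmin_l (theta t) (c / (2 * (t * E 2 0 + 1)))) as L1. fold e in L1.
  pose proof (Rmin_r (theta t) (c / (2 * (t * E 2 0 + 1)))) as L2. fold e in L2.
  pose proof (M_le_h t (theta t - e) Ht ltac:(lra)) as Hm. rewrite <- h_theta in Hm by exact Ht.
  pose proof (h_tangent t (theta t - e) (theta t) Ht) as Htg.
  pose proof (E_tangent 1 (theta t - e) (theta t)) as Hte.
  pose proof (E_le 2 0 (theta t - e) ltac:(lra)) as H20.
  assert (Hle : 1 <= t * E 1 (theta t - e)) by nra.
  assert (Hup : E 1 (theta t - e) <= E 1 (theta t) + E 2 0 * e) by nra.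
  apply (Rmult_le_compat_l t) in Hup; [ | exact Ht ].
  apply Rle_div_r in L2; [ | lra ].
  unfold c in *. nra.
Qed.

(** * The critical time and the first moment before it *)

Let tg : R := / E 1 0.

Lemma tg_pos : 0 < tg.
Proof. apply Rinv_0_lt_compat, E_pos. Qed.

Lemma theta_subcritical (t : R) : 0 <= t <= tg -> theta t = 0.
Proof.
  intros [Ht Htg]. destruct (theta_ge_0 t Ht) as [Hp | He]; [ exfalso | symmetry; exact He ].
  pose proof (theta_stationary_ge t Ht Hp). pose proof (E_lt 1 0 (theta t) Hp).
  pose proof (E_pos 1 0). pose proof (E_pos 1 (theta t)).
  assert (t * E 1 0 <= 1).
  { apply (Rmult_le_compat_r (E 1 0)) in Htg; [ | lra ].
    unfold tg in Htg. rewrite Rinv_l in Htg by lra. exact Htg. }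
  nra.
Qed.

Lemma theta_supercritical (t : R) : tg <= t -> t * E 1 (theta t) = 1.
Proof.
  intros Htg. pose proof tg_pos as H0.
  apply Rle_antisym; [ apply theta_stationary_le; lra | ].
  destruct (theta_ge_0 t ltac:(lra)) as [Hp | He]; [ apply theta_stationary_ge; lra | ].
  rewrite <- He. pose proof (E_pos 1 0).
  apply (Rmult_le_compat_r (E 1 0)) in Htg; [ | lra ].
  unfold tg in Htg. rewrite Rinv_l in Htg by lra. exact Htg.
Qed.

Lemma sum_INR_mul_w (t : R) (n : nat) :
  sum_n (fun k => INR (S k) * v t (S k)) n = sum_n (fun k => INR k * w t k) (S n).
Proof.
  rewrite sum_n_first. simpl (INR 0). rewrite Rmult_0_l, Rplus_0_l. reflexivity.
Qed.

Lemma m1_0 : m1 (v 0) = Finite (E 1 0).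
Proof.
  unfold m1. apply is_lim_seq_unique.
  apply (is_lim_seq_ext_loc (fun _ => E 1 0)); [ | apply is_lim_seq_const ].
  assert (Es : E 1 0 = sum_n (fun k => INR k * w 0 k) N).
  { apply sum_n_R_ext. intros k _. rewrite Rmult_0_r, Ropp_0, exp_0. ring. }
  exists N. intros n Hn. rewrite sum_INR_mul_w, Es.
  assert (Hn' : (N <= S n)%nat) by lia. clear Hn.
  induction Hn' as [|m Hm IH]; [ reflexivity | ].
  rewrite sum_n_R_S, w0_large by lia. rewrite Rmult_0_r, Rplus_0_r. exact IH.
Qed.

(** With theta = 0, the difference A = m_0 - G satisfies A <= E_1(0) (x + t A) by the tangent at 0;
    before [tg] this can be solved for A. *)
Lemma mass_sub_gen_subcritical (t x : R) :
  0 <= t < tg -> 0 < x -> (mass t - gen t (exp (- x))) * (1 - t * E 1 0) <= E 1 0 * x.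
Proof.
  intros Ht Hx. pose proof (theta_subcritical t ltac:(lra)) as Hth.
  pose proof (mass_theta t ltac:(lra)) as Hm. rewrite Hth in Hm.
  pose proof (E_pos 1 0) as H1.
  assert (H2 : t * E 1 0 < 1).
  { destruct Ht as [_ Htg]. apply (Rmult_lt_compat_r (E 1 0)) in Htg; [ | lra ].
    unfold tg in Htg. rewrite Rinv_l in Htg by lra. exact Htg. }
  assert (He : eta t x = x + t * (mass t - gen t (exp (- x)))).
  { unfold eta. unfold theta in Hth. lra. }
  pose proof (E_tangent 0 0 (eta t x)) as Htan. rewrite <- gen_eta in Htan by lra.
  rewrite <- Hm, He in Htan. nra.
Qed.

(** The linear bound on m_0 - G becomes the bound [K] on m_1. On a finite sum, 1 - exp(-u) >= u -
    u^2/2 gives x times the partial first moment up to x^2 Q; divide by x and let x tend to 0. *)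
Lemma m1_subcritical (t : R) : 0 <= t < tg -> m1 (v t) <> p_infty.
Proof.
  intros Ht. pose proof (E_pos 1 0) as H1.
  assert (H2 : 0 < 1 - t * E 1 0).
  { destruct Ht as [_ Htg]. apply (Rmult_lt_compat_r (E 1 0)) in Htg; [ | lra ].
    unfold tg in Htg. rewrite Rinv_l in Htg by lra. lra. }
  set (K := E 1 0 / (1 - t * E 1 0)).
  assert (B : forall n, sum_n (fun k => INR k * w t k) n <= K).
  { intros n. set (Q := sum_n (fun k => INR k ^ 2 / 2 * w t k) n).
    assert (HQ : 0 <= Q).
    { apply sum_n_ge_0. intros k. apply Rmult_le_pos; [ | apply w_ge_0 ].
      apply Rmult_le_pos; [ apply pow_le, pos_INR | lra ]. }
    assert (Hx : forall x, 0 < x -> sum_n (fun k => INR k * w t k) n <= K + x * Q).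
    { intros x Hx.
      pose proof (mass_sub_gen_subcritical t x Ht Hx) as Hs.
      apply Rle_div_r in Hs; [ | exact H2 ].
      replace (E 1 0 * x / (1 - t * E 1 0)) with (x * K) in Hs by (unfold K; field; lra).
      pose proof (exp_neg_lt_1 x Hx) as Hz.
      assert (Hp : sum_n (fun k => w t k * (1 - exp (- x) ^ k)) n <= mass t - gen t (exp (- x))).
      { rewrite <- Series_w. unfold gen. rewrite <- Series_minus by
          (apply ex_series_w || apply ex_series_gen; lra).
        rewrite (Series_ext _ (fun k => w t k * (1 - exp (- x) ^ k))) by (intros; ring).
        apply sum_n_le_Series.
        - intros k. apply Rmult_le_pos; [ apply w_ge_0 | ].
          pose proof (pow_unit_interval (exp (- x)) k ltac:(lra)). lra.
        - apply (ex_series_ext (fun k => minus (w t k) (w t k * exp (- x) ^ k))).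
          + intros k. unfold minus, plus, opp; simpl. apply Rminus_diag_uniq. ring.
          + apply (ex_series_minus (V := R_NormedModule)); [ apply ex_series_w | ].
            apply ex_series_gen. lra. }
      assert (Hl : x * sum_n (fun k => INR k * w t k) n - x * x * Q
                   <= sum_n (fun k => w t k * (1 - exp (- x) ^ k)) n).
      { unfold Q. replace (x * sum_n (fun k => INR k * w t k) n -
          x * x * sum_n (fun k => INR k ^ 2 / 2 * w t k) n)
          with (x * sum_n (fun k => INR k * w t k) n +
                (- (x * x)) * sum_n (fun k => INR k ^ 2 / 2 * w t k) n) by ring.
        rewrite <- !sum_n_R_mult_l, <- sum_n_R_plus.
        apply sum_n_le_compat. intros k _.
        replace (x * (INR k * w t k) + - (x * x) * (INR k ^ 2 / 2 * w t k))
          with (w t k * (INR k * x - (INR k * x) ^ 2 / 2)) by field.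
        apply Rmult_le_compat_l; [ apply w_ge_0 | ].
        rewrite exp_pow.
        pose proof (exp_taylor2 (INR k * x)
          ltac:(apply Rmult_le_pos; [ apply pos_INR | lra ])) as [_ U].
        replace (INR k * - x) with (- (INR k * x)) by ring. lra. }
      apply (Rmult_le_reg_l x); [ exact Hx | ]. nra. }
    apply Rnot_lt_le. intros Hlt.
    set (P := sum_n (fun k => INR k * w t k) n) in *.
    specialize (Hx ((P - K) / (2 * (Q + 1)))).
    assert (Hp : 0 < (P - K) / (2 * (Q + 1))) by (apply Rdiv_lt_0_compat; lra).
    specialize (Hx Hp).
    assert ((P - K) / (2 * (Q + 1)) * Q <= (P - K) / 2).
    { replace ((P - K) / (2 * (Q + 1)) * Q) with ((P - K) / 2 * Q / (Q + 1)) by (field; lra).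
      apply Rle_div_l; nra. }
    lra. }
  intros Hinf.
  assert (Hle : Rbar_le (m1 (v t)) (Lim_seq (fun _ => K))).
  { apply Lim_seq_le_loc. exists O. intros n _. rewrite sum_INR_mul_w. apply B. }
  rewrite Hinf, Lim_seq_const in Hle. exact Hle.
Qed.

(** * Tails from the critical time on *)

Let tail (t : R) (n : nat) : R := mass t - sum_n (w t) n.

Lemma tail_ge_0 (t : R) (n : nat) : 0 <= tail t n.
Proof. unfold tail. pose proof (sum_n_w_le_mass t n). lra. Qed.

Lemma tail_S (t : R) (n : nat) : tail t (S n) = tail t n - w t (S n).
Proof. unfold tail. rewrite sum_n_R_S. ring. Qed.

Lemma tail_decr (t : R) (n : nat) : tail t (S n) <= tail t n.
Proof. rewrite tail_S. pose proof (w_ge_0 t (S n)). lra. Qed.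

Lemma tail_Series (t : R) (n : nat) : tail t n = Series (fun k => v t (S n + k)%nat).
Proof.
  unfold tail. rewrite <- Series_w, (Series_split (w t) n) by apply ex_series_w.
  rewrite (Series_ext (fun k => w t (S n + k)) (fun k => v t (S n + k)%nat))
    by reflexivity.
  ring.
Qed.

Lemma is_lim_sum_w (t : R) : is_lim_seq (sum_n (w t)) (mass t).
Proof. rewrite <- Series_w. exact (Series_correct _ (ex_series_w t)). Qed.

Lemma is_lim_tail (t : R) : is_lim_seq (tail t) 0.
Proof.
  unfold tail. replace (Finite 0) with (Finite (mass t - mass t)) by (f_equal; ring).
  apply is_lim_seq_minus'; [ apply is_lim_seq_const | apply is_lim_sum_w ].
Qed.

(** Summation by parts. It turns the behaviour of G near z = 1 into the Abel mean of a nonincreasing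
    sequence, as [karamata_half] requires. *)
Lemma Series_tail (t z : R) :
  0 < z < 1 -> (1 - z) * Series (fun n => tail t n * z ^ n) = mass t - gen t z.
Proof.
  intros Hz.
  assert (Ps : forall n, (1 - z) * sum_n (fun n => tail t n * z ^ n) n
            = mass t - sum_n (fun k => w t k * z ^ k) n - tail t n * z ^ S n).
  { induction n as [|n IH].
    - rewrite !sum_O. unfold tail. rewrite sum_O. unfold w. simpl. ring.
    - rewrite !sum_n_R_S, Rmult_plus_distr_l, IH, tail_S. simpl. ring. }
  assert (Hz0 : is_lim_seq (fun n => z ^ n) 0) by (apply is_lim_seq_geom; rewrite Rabs_pos_eq; lra).
  assert (L1 : is_lim_seq (fun n => (1 - z) * sum_n (fun n => tail t n * z ^ n) n)
                 ((1 - z) * Series (fun n => tail t n * z ^ n))).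
  { apply is_lim_seq_mult'; [ apply is_lim_seq_const | ].
    apply (Series_correct (fun n => tail t n * z ^ n)).
    apply (ex_series_geom_bound _ (mass t) z); [ lra | ].
    intros n. pose proof (pow_unit_interval z n ltac:(lra)). pose proof (tail_ge_0 t n).
    rewrite Rabs_pos_eq by (apply Rmult_le_pos; lra).
    apply Rmult_le_compat_r; [ lra | ]. unfold tail.
    pose proof (sum_n_ge_0 (w t) n (w_ge_0 t)). lra. }
  assert (L2 : is_lim_seq (fun n => mass t - sum_n (fun k => w t k * z ^ k) n - tail t n * z ^ S n)
                 (mass t - gen t z - 0 * 0)).
  { apply is_lim_seq_minus'.
    - apply is_lim_seq_minus'; [ apply is_lim_seq_const | ].
      apply (Series_correct (fun k => w t k * z ^ k)), ex_series_gen. lra.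
    - apply is_lim_seq_mult'; [ apply is_lim_tail | ].
      apply (is_lim_seq_incr_1 (fun n => z ^ n)). exact Hz0. }
  apply (is_lim_seq_ext _ _ _ Ps), is_lim_seq_unique in L1.
  apply is_lim_seq_unique in L2. rewrite L2 in L1. injection L1. lra.
Qed.

Lemma filterlim_eta (t : R) :
  0 <= t -> filterlim (fun z => eta t (- ln z) - theta t) (at_left 1) (locally 0).
Proof.
  intros Ht. apply filterlim_locally. intros [eps Heps].
  destruct (eta_near_0 t eps Ht Heps) as [d [Hd H]].
  pose proof (exp_neg_lt_1 d Hd) as He.
  exists (mkposreal (1 - exp (- d)) ltac:(lra)). intros z Hz Hz1.
  change (Rabs (z - 1) < 1 - exp (- d)) in Hz. apply Rabs_lt_between in Hz.
  change (Rabs (eta t (- ln z) - theta t - 0) < eps).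
  assert (Hl : - d < ln z) by (rewrite <- (ln_exp (- d)); apply ln_increasing; lra).
  assert (Hl0 : ln z < 0) by (rewrite <- ln_1; apply ln_increasing; lra).
  specialize (H (- ln z) ltac:(lra)).
  pose proof (eta_bounds t (- ln z) Ht ltac:(lra)).
  rewrite Rminus_0_r, Rabs_pos_eq by lra. exact H.
Qed.

(** Everything is expressed through d = eta - theta. As t E_1(theta) = 1, the first-order terms of x
    cancel, leaving x ~ t E_2 d^2 / 2, while m_0 - G ~ E_1 d; the quotient tends to 2 E_1^2 / (t
    E_2). The last two hypotheses keep the base of the lower bound and the denominator of the upper
    bound positive. *)
Lemma gen_sqr_bounds (t x d : R) :
  tg <= t -> 0 < x -> d = eta t x - theta t ->
  E 2 (theta t) * d < 2 * E 1 (theta t) -> t * E 2 (theta t) * d ^ 2 < 4 ->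
  2 * (E 1 (theta t) - E 2 (theta t) * d / 2) ^ 2 / (t * E 2 (theta t))
  <= (mass t - gen t (exp (- x))) ^ 2 / (1 - exp (- x))
  <= 2 * E 1 (theta t) ^ 2 / (t * E 2 (theta t + d) * (1 - t * E 2 (theta t) * d ^ 2 / 4)).
Proof.
  intros Ht Hx Hd Hd1 Hd2. pose proof tg_pos as H0.
  pose proof (eta_bounds t x ltac:(lra) Hx) as Hb.
  pose proof (theta_supercritical t Ht) as Hst.
  pose proof (E_taylor2 (theta t) d ltac:(lra)) as [TL TU].
  assert (Heta : eta t x = theta t + d) by lra.
  assert (HA : mass t - gen t (exp (- x)) = E 0 (theta t) - E 0 (theta t + d)).
  { rewrite gen_eta, mass_theta, Heta by lra. reflexivity. }
  rewrite HA. set (A := E 0 (theta t) - E 0 (theta t + d)) in *.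
  pose proof (E_tangent 0 (theta t) (theta t + d)) as Htan.
  assert (Hxe : x = t * (E 0 (theta t + d) - E 0 (theta t) + E 1 (theta t) * d)).
  { pose proof (h_eta t x ltac:(lra) Hx) as He. pose proof (h_theta t ltac:(lra)) as Hh.
    rewrite Heta in He. unfold h in He, Hh. nra. }
  pose proof (E_pos 2 (theta t)) as P2. pose proof (E_pos 2 (theta t + d)) as P2'.
  pose proof (E_pos 1 (theta t)) as P1.
  set (e1 := E 1 (theta t)) in *. set (e2 := E 2 (theta t)) in *.
  set (e2' := E 2 (theta t + d)) in *.
  assert (Hx1 : t * e2' * d ^ 2 / 2 <= x) by (rewrite Hxe; nra).
  assert (Hx2 : x <= t * e2 * d ^ 2 / 2) by (rewrite Hxe; nra).
  pose proof (exp_taylor2 x ltac:(lra)) as [_ Ux]. pose proof (exp_ineq1_le (- x)) as Lx.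
  pose proof (exp_neg_lt_1 x Hx) as Hz.
  set (y := 1 - exp (- x)) in *.
  assert (Hd0 : 0 < d) by lra.
  assert (HA1 : d * (e1 - e2 * d / 2) <= A) by (unfold A; nra).
  assert (HA2 : A <= e1 * d) by (unfold A; nra).
  assert (Hy1 : y <= t * e2 * d ^ 2 / 2) by (unfold y; lra).
  assert (Hy2 : t * e2' * d ^ 2 / 2 * (1 - t * e2 * d ^ 2 / 4) <= y).
  { apply Rle_trans with (x * (1 - x / 2)); [ | unfold y; nra ].
    apply Rmult_le_compat; [ | lra | exact Hx1 | lra ].
    assert (0 < d ^ 2) by (apply pow_lt; exact Hd0).
    assert (0 < t * e2') by (apply Rmult_lt_0_compat; lra). nra. }
  assert (Hy0 : 0 < y) by (unfold y; lra).
  assert (Hdd : 0 < d ^ 2) by (apply pow_lt; exact Hd0).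
  split.
  - apply -> Rle_div_r; [ | exact Hy0 ].
    apply Rle_trans with (2 * (e1 - e2 * d / 2) ^ 2 / (t * e2) * (t * e2 * d ^ 2 / 2)).
    + apply Rmult_le_compat_l; [ | exact Hy1 ].
      apply Rdiv_le_0_compat; [ | apply Rmult_lt_0_compat; lra ].
      apply Rmult_le_pos; [ lra | apply pow2_ge_0 ].
    + replace (2 * (e1 - e2 * d / 2) ^ 2 / (t * e2) * (t * e2 * d ^ 2 / 2))
        with ((d * (e1 - e2 * d / 2)) ^ 2) by (field; lra).
      apply pow_incr. split; [ apply Rmult_le_pos; lra | exact HA1 ].
  - apply <- Rle_div_l; [ | exact Hy0 ].
    apply Rle_trans with (2 * e1 ^ 2 / (t * e2' * (1 - t * e2 * d ^ 2 / 4))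
                          * (t * e2' * d ^ 2 / 2 * (1 - t * e2 * d ^ 2 / 4))).
    + replace (2 * e1 ^ 2 / (t * e2' * (1 - t * e2 * d ^ 2 / 4))
               * (t * e2' * d ^ 2 / 2 * (1 - t * e2 * d ^ 2 / 4))) with ((e1 * d) ^ 2)
        by (field; lra).
      apply pow_incr. split; [ | exact HA2 ].
      eapply Rle_trans; [ | exact HA1 ]. apply Rmult_le_pos; lra.
    + apply Rmult_le_compat_l; [ | exact Hy2 ].
      apply Rdiv_le_0_compat; [ apply Rmult_le_pos; [ lra | apply pow2_ge_0 ] | ].
      repeat apply Rmult_lt_0_compat; lra.
Qed.

(** The squares are squeezed between functions of d that are continuous at 0, and the root is taken
    at the end. Since E_1(theta) = 1/t, both bounds tend to 2 / (t^3 E_2). *)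
Lemma filterlim_tail_gf (t : R) :
  tg <= t ->
  filterlim (fun z => sqrt (1 - z) * Series (fun n => tail t n * z ^ n)) (at_left 1)
    (locally (sqrt (2 * / (t ^ 3 * E 2 (theta t))))).
Proof.
  intros Ht. pose proof tg_pos as H0.
  pose proof (E_pos 2 (theta t)) as P2. pose proof (E_pos 1 (theta t)) as P1.
  pose proof (theta_supercritical t Ht) as Hst.
  set (e1 := E 1 (theta t)) in *. set (e2 := E 2 (theta t)) in *.
  set (lo := fun d => 2 * (e1 - e2 * d / 2) ^ 2 / (t * e2)).
  set (up := fun d => 2 * e1 ^ 2 / (t * E 2 (theta t + d) * (1 - t * e2 * d ^ 2 / 4))).
  set (del := fun z => eta t (- ln z) - theta t).
  assert (Hdel : filterlim del (at_left 1) (locally 0)) by (apply filterlim_eta; lra).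
  assert (Ee1 : e1 = / t) by (apply (Rmult_eq_reg_l t); [ rewrite Rinv_r by lra; exact Hst | lra ]).
  assert (Hlo : filterlim (fun z => lo (del z)) (at_left 1) (locally (2 * / (t ^ 3 * e2)))).
  { apply (filterlim_comp _ _ _ del lo _ (locally 0)); [ exact Hdel | ].
    replace (2 * / (t ^ 3 * e2)) with (lo 0) by (unfold lo; rewrite Ee1; field; lra).
    apply (ex_derive_continuous (V := R_NormedModule)). unfold lo.
    auto_derive; repeat split; apply Rmult_integral_contrapositive_currified; lra. }
  assert (Hup : filterlim (fun z => up (del z)) (at_left 1) (locally (2 * / (t ^ 3 * e2)))).
  { apply (filterlim_comp _ _ _ del up _ (locally 0)); [ exact Hdel | ].
    replace (2 * / (t ^ 3 * e2)) with (up 0).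
    2: { unfold up. rewrite Rplus_0_r. fold e2. rewrite Ee1. field. lra. }
    apply (ex_derive_continuous (V := R_NormedModule)). unfold up.
    auto_derive. repeat split.
    - eexists. apply is_derive_E.
    - rewrite Rplus_0_r. fold e2.
      apply Rmult_integral_contrapositive_currified; [ | lra ].
      apply Rmult_integral_contrapositive_currified; lra. }
  assert (Hsq : filterlim (fun z => (mass t - gen t z) ^ 2 / (1 - z)) (at_left 1)
                  (locally (2 * / (t ^ 3 * e2)))).
  { apply (filterlim_le_le (F := at_left 1) (fun z => lo (del z)) _ (fun z => up (del z))
             (Finite (2 * / (t ^ 3 * e2)))); [ | exact Hlo | exact Hup ].
    (* d < e1/e2 gives the first side condition of [gen_sqr_bounds]; d < 1 and d < 1/(t e2) together
       give t e2 d^2 < 1, hence the second. *)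
    set (r := Rmin 1 (Rmin (e1 / e2) (/ (t * e2)))).
    assert (Hte : 0 < t * e2) by (apply Rmult_lt_0_compat; lra).
    assert (Hr : 0 < r).
    { apply Rmin_pos; [ lra | ]. apply Rmin_pos.
      - apply Rdiv_lt_0_compat; lra.
      - apply Rinv_0_lt_compat; exact Hte. }
    pose proof (proj1 (filterlim_locally _ _) Hdel (mkposreal r Hr)) as Hev.
    assert (Hev2 : at_left 1 (fun z => 0 < z < 1)).
    { exists (mkposreal 1 Rlt_0_1). intros z Hz Hz1. change (Rabs (z - 1) < 1) in Hz.
      apply Rabs_lt_between in Hz. lra. }
    generalize (filter_and _ _ Hev Hev2). apply filter_imp. intros z [Hb Hz].
    change (Rabs (del z - 0) < r) in Hb. rewrite Rminus_0_r in Hb.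
    assert (Hln : ln z < 0) by (rewrite <- ln_1; apply ln_increasing; lra).
    pose proof (eta_bounds t (- ln z) ltac:(lra) ltac:(lra)).
    rewrite Rabs_pos_eq in Hb by (unfold del; lra).
    assert (Hzz : exp (- - ln z) = z) by (rewrite Ropp_involutive; apply exp_ln; lra).
    pose proof (gen_sqr_bounds t (- ln z) (del z) Ht ltac:(lra) eq_refl) as G.
    rewrite Hzz in G. fold e1 e2 in G.
    pose proof (Rmin_l 1 (Rmin (e1 / e2) (/ (t * e2)))) as R1.
    pose proof (Rmin_r 1 (Rmin (e1 / e2) (/ (t * e2)))) as R2. fold r in R1, R2.
    pose proof (Rmin_l (e1 / e2) (/ (t * e2))) as R3.
    pose proof (Rmin_r (e1 / e2) (/ (t * e2))) as R4.
    assert (D0 : 0 < del z) by (unfold del; lra).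
    apply G.
    - assert (D1 : del z < e1 / e2) by lra. apply Rlt_div_r in D1; lra.
    - assert (D1 : del z < / (t * e2)) by lra.
      apply (Rmult_lt_compat_l (t * e2)) in D1; [ | exact Hte ].
      rewrite Rinv_r in D1 by lra. nra. }
  (* By [Series_tail], the squeezed quotient is (1 - z) times the square of the tail series, whose
     nonnegativity makes the root unambiguous. *)
  apply (filterlim_ext_loc (F := at_left 1) (fun z => sqrt ((mass t - gen t z) ^ 2 / (1 - z)))).
  - exists (mkposreal 1 Rlt_0_1). intros z Hz Hz1. change (Rabs (z - 1) < 1) in Hz.
    apply Rabs_lt_between in Hz.
    rewrite <- Series_tail by lra.
    assert (Hs : 0 <= Series (fun n => tail t n * z ^ n)).
    { apply Series_ge_0. intros n. apply Rmult_le_pos; [ apply tail_ge_0 | apply pow_le; lra ]. }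
    set (Q := Series _) in *.
    replace (((1 - z) * Q) ^ 2 / (1 - z)) with ((1 - z) * (Q * Q)) by (field; lra).
    rewrite sqrt_mult_alt, sqrt_square by lra. reflexivity.
  - apply (filterlim_comp _ _ _ (fun z => (mass t - gen t z) ^ 2 / (1 - z)) sqrt _ _ _ Hsq).
    apply continuity_pt_filterlim, sqrt_continuity_pt.
    apply Rmult_lt_0_compat; [ lra | ]. apply Rinv_0_lt_compat.
    apply Rmult_lt_0_compat; [ apply pow_lt; lra | exact P2 ].
Qed.

Lemma is_lim_tail_sqrt (t : R) :
  tg <= t ->
  is_lim_seq (fun n => sqrt (INR n) * tail t n) (sqrt (2 * / (t ^ 3 * E 2 (theta t)) / PI)).
Proof.
  intros Ht. pose proof tg_pos as H0.
  rewrite sqrt_div_alt by apply PI_RGT_0.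
  apply karamata_half.
  - apply sqrt_pos.
  - apply tail_ge_0.
  - apply tail_decr.
  - apply filterlim_tail_gf, Ht.
Qed.

(** [tail t n] starts at the index n + 1, so K = n + 1; replacing sqrt(n) by sqrt(n + 1) costs at
    most [tail t n], which tends to 0. *)
Lemma is_lim_Series_sqrt (t : R) :
  tg <= t ->
  is_lim_seq (fun K => sqrt (INR K) * Series (fun n => v t (K + n)%nat))
    (sqrt (2 * / (t ^ 3 * E 2 (theta t)) / PI)).
Proof.
  intros Ht. apply is_lim_seq_incr_1.
  apply (is_lim_seq_ext (fun n => sqrt (INR n) * tail t n
                                  + (sqrt (INR (S n)) - sqrt (INR n)) * tail t n)).
  { intros n. rewrite tail_Series. ring. }
  set (l := sqrt _).
  replace (Finite l) with (Finite (l + 0)) by (f_equal; ring).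
  apply is_lim_seq_plus'; [ apply is_lim_tail_sqrt, Ht | ].
  apply (is_lim_seq_le_le (fun _ => 0) _ (tail t)).
  - intros n. pose proof (tail_ge_0 t n) as Hn. pose proof (pos_INR n).
    rewrite S_INR.
    assert (sqrt (INR n) <= sqrt (INR n + 1)) by (apply sqrt_le_1_alt; lra).
    assert (sqrt (INR n + 1) <= sqrt (INR n) + 1).
    { pose proof (sqrt_pos (INR n)) as Hs. rewrite <- (sqrt_square (sqrt (INR n) + 1)) by lra.
      apply sqrt_le_1_alt. pose proof (sqrt_sqrt (INR n) ltac:(lra)). nra. }
    split; [ apply Rmult_le_pos; lra | ].
    rewrite <- (Rmult_1_l (tail t n)) at 2. apply Rmult_le_compat_r; lra.
  - apply is_lim_seq_const.
  - apply is_lim_tail.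
Qed.

Lemma INR_mul_sum_sub_le (t : R) (K n : nat) :
  (K <= n)%nat ->
  INR K * (sum_n (w t) n - sum_n (w t) K) <= sum_n (fun k => INR k * w t k) n.
Proof.
  intros Hn. induction Hn as [|n Hn IH].
  - rewrite Rminus_diag, Rmult_0_r. apply sum_n_ge_0.
    intros k. apply Rmult_le_pos; [ apply pos_INR | apply w_ge_0 ].
  - rewrite !sum_n_R_S. pose proof (w_ge_0 t (S n)).
    assert (INR K <= INR (S n)) by (apply le_INR; lia). nra.
Qed.

(** A tail of order n^(-1/2) makes n [tail t n] unbounded. Fix K with K [tail t K] > A + 1; partial
    sums reaching within 1/(K+1) of the mass lose at most 1, and K times the mass between K and n is
    a lower bound for the first moment. *)
Lemma m1_supercritical (t : R) : tg <= t -> m1 (v t) = p_infty.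
Proof.
  intros Ht. pose proof tg_pos as H0. pose proof (E_pos 2 (theta t)) as P2.
  set (l := sqrt (2 * / (t ^ 3 * E 2 (theta t)) / PI)).
  assert (Hl : 0 < l).
  { apply sqrt_lt_R0. apply Rdiv_lt_0_compat; [ | apply PI_RGT_0 ].
    apply Rmult_lt_0_compat; [ lra | ]. apply Rinv_0_lt_compat.
    apply Rmult_lt_0_compat; [ apply pow_lt; lra | exact P2 ]. }
  assert (L : is_lim_seq (fun n => sqrt (INR n) * (sqrt (INR n) * tail t n)) p_infty).
  { apply (is_lim_seq_mult _ _ p_infty l).
    - apply (filterlim_comp _ _ _ INR sqrt _ (Rbar_locally p_infty));
        [ apply is_lim_seq_INR | apply filterlim_sqrt_p ].
    - apply is_lim_tail_sqrt, Ht.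
    - apply is_Rbar_mult_p_infty_pos. exact Hl. }
  apply is_lim_seq_unique. apply is_lim_seq_spec. intros A.
  apply is_lim_seq_spec in L. destruct (L (A + 1)) as [K HK]. specialize (HK K (le_n K)).
  simpl in HK. rewrite <- Rmult_assoc, sqrt_sqrt in HK by apply pos_INR.
  pose proof (pos_INR K) as HK0.
  pose proof (is_lim_sum_w t) as Lw. apply is_lim_seq_spec in Lw.
  assert (Hq : 0 < / (INR K + 1)) by (apply Rinv_0_lt_compat; lra).
  destruct (Lw (mkposreal _ Hq)) as [n0 Hn0]. simpl in Hn0.
  exists (n0 + K)%nat. intros n Hn. rewrite sum_INR_mul_w.
  specialize (Hn0 (S n) ltac:(lia)). apply Rabs_lt_between in Hn0.
  pose proof (INR_mul_sum_sub_le t K (S n) ltac:(lia)) as B.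
  assert (INR K * / (INR K + 1) <= 1).
  { apply (Rmult_le_reg_r (INR K + 1)); [ lra | ].
    rewrite Rmult_assoc, Rinv_l by lra. lra. }
  unfold tail in HK. nra.
Qed.

Lemma t_gel_eq : t_gel v = Finite tg.
Proof.
  apply is_glb_Rbar_unique. pose proof tg_pos as H0. split.
  - intros t [Ht Hm]. simpl. apply Rnot_lt_le. intros Hlt.
    exact (m1_subcritical t (conj Ht Hlt) Hm).
  - intros b Hb. apply Hb. split; [ lra | ]. apply m1_supercritical. lra.
Qed.

(* Constant before [tg], so that continuity holds on both sides of [tg]. *)
Let thetax (t : R) : R := theta (Rmax tg t).
(** Formally, t E_1(theta) = 1 yields theta' = 1/(t^2 E_2), so that -m_0' = E_1 theta' = 1/(t^3
    E_2). *)
Let phi (t : R) : R := / (Rmax tg t ^ 3 * E 2 (thetax t)).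

Lemma thetax_stationary (t : R) : E 1 (thetax t) = / Rmax tg t.
Proof.
  pose proof (Rmax_l tg t). pose proof tg_pos.
  apply (Rmult_eq_reg_l (Rmax tg t)); [ | lra ]. rewrite Rinv_r by lra.
  apply theta_supercritical. assumption.
Qed.

Lemma E_lt_inv (j : nat) (a b : R) : E j b < E j a -> a < b.
Proof.
  intros H. apply Rnot_le_lt. intros Hc. pose proof (E_le j b a Hc). lra.
Qed.

(** [E 1] is strictly decreasing and its value at [thetax] is the continuous function 1 / max(tg,
    t); closeness of these values thus confines [thetax] itself. *)
Lemma continuous_thetax (t : R) : continuous thetax t.
Proof.
  apply filterlim_locally. intros [eps Heps].
  pose proof (Rmax_l tg t) as Hm. pose proof tg_pos as H0.
  pose proof (thetax_stationary t) as Hst.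
  assert (Hinv : continuous (fun s => / Rmax tg s) t).
  { apply (continuous_comp (Rmax tg) Rinv); [ apply continuous_Rmax_l | ].
    apply continuous_Rinv. lra. }
  pose proof (E_lt 1 (thetax t) (thetax t + eps) ltac:(lra)) as B1.
  pose proof (E_lt 1 (thetax t - eps) (thetax t) ltac:(lra)) as B2.
  assert (Hr : 0 < Rmin (E 1 (thetax t) - E 1 (thetax t + eps)) (E 1 (thetax t - eps) - E 1 (thetax t)))
    by (apply Rmin_pos; lra).
  generalize (proj1 (filterlim_locally _ _) Hinv (mkposreal _ Hr)). apply filter_imp.
  intros s Hs. change (Rabs (/ Rmax tg s - / Rmax tg t) < Rmin (E 1 (thetax t) - E 1 (thetax t + eps)) (E 1 (thetax t - eps) - E 1 (thetax t))) in Hs.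
  rewrite <- !thetax_stationary in Hs. apply Rabs_lt_between in Hs.
  pose proof (Rmin_l (E 1 (thetax t) - E 1 (thetax t + eps)) (E 1 (thetax t - eps) - E 1 (thetax t))).
  pose proof (Rmin_r (E 1 (thetax t) - E 1 (thetax t + eps)) (E 1 (thetax t - eps) - E 1 (thetax t))).
  change (Rabs (thetax s - thetax t) < eps).
  pose proof (E_lt_inv 1 (thetax s) (thetax t + eps) ltac:(lra)).
  pose proof (E_lt_inv 1 (thetax t - eps) (thetax s) ltac:(lra)).
  apply Rabs_lt_between. lra.
Qed.

Lemma phi_pos (t : R) : 0 < phi t.
Proof.
  pose proof (Rmax_l tg t). pose proof tg_pos.
  apply Rinv_0_lt_compat, Rmult_lt_0_compat; [ apply pow_lt; lra | apply E_pos ].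
Qed.

Lemma continuous_phi (t : R) : continuous phi t.
Proof.
  pose proof (phi_pos t) as Hp.
  apply (continuous_comp (fun t => Rmax tg t ^ 3 * E 2 (thetax t)) Rinv).
  - apply (continuous_mult (K := R_AbsRing)).
    + apply (continuous_comp (Rmax tg) (fun y => y ^ 3)); [ apply continuous_Rmax_l | ].
      apply (ex_derive_continuous (V := R_NormedModule)). auto_derive. trivial.
    + apply (continuous_comp thetax (E 2)); [ apply continuous_thetax | apply continuous_E ].
  - apply continuous_Rinv. intros Hz. unfold phi in Hp. rewrite Hz, Rinv_0 in Hp. lra.
Qed.

(* Substitution [t = 1 / E 1 y], the inverse of [theta]. *)
Lemma is_RInt_phi (t : R) : tg <= t -> is_RInt phi tg t (Phi v t).
Proof.
  intros Ht. pose proof tg_pos as H0.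
  pose proof (theta_ge_0 t ltac:(lra)) as Hth0.
  assert (Hex : ex_RInt phi tg t).
  { apply (ex_RInt_continuous (V := R_CompleteNormedModule)). intros; apply continuous_phi. }
  assert (Hgt : / E 1 (theta t) = t).
  { pose proof (thetax_stationary t) as Hs. unfold thetax in Hs.
    rewrite Rmax_right in Hs by exact Ht. rewrite Hs. apply Rinv_inv. }
  (* Substituting in this direction differentiates y -> 1 / E_1(y), which is smooth, instead of
     [theta]. *)
  assert (Hc : is_RInt (fun y => scal (E 2 y / E 1 y ^ 2) (phi (/ E 1 y))) 0 (theta t)
                 (RInt phi (/ E 1 0) (/ E 1 (theta t)))).
  { apply (is_RInt_comp (V := R_CompleteNormedModule) phi (fun y => / E 1 y)
             (fun y => E 2 y / E 1 y ^ 2)).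
    - intros; apply continuous_phi.
    - intros y _. pose proof (E_pos 1 y) as P1. split.
      + replace (E 2 y / E 1 y ^ 2) with (- (- E 2 y) / E 1 y ^ 2) by (field; lra).
        apply is_derive_inv; [ apply is_derive_E | lra ].
      + apply (ex_derive_continuous (V := R_NormedModule)).
        auto_derive. repeat split.
        * eexists. apply is_derive_E.
        * eexists. apply is_derive_E.
        * apply Rgt_not_eq. apply Rmult_lt_0_compat; lra. }
  (* On the image, phi(1/E_1) = E_1^3/E_2, so the integrand collapses to E_1, with primitive -E_0;
     the integral is E_0(0) - E_0(theta t) = m_0(0) - m_0(t). *)
  assert (Hi : is_RInt (fun y => scal (E 2 y / E 1 y ^ 2) (phi (/ E 1 y))) 0 (theta t)
                 (E 0 0 - E 0 (theta t))).
  { apply (is_RInt_ext (fun y => E 1 y)).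
    - rewrite Rmin_left, Rmax_right by lra. intros y Hy.
      pose proof (E_pos 1 y) as P1. pose proof (E_pos 2 y) as P2.
      assert (Hge : tg <= / E 1 y).
      { apply Rinv_le_contravar; [ exact P1 | apply E_le; lra ]. }
      assert (Hty : thetax (/ E 1 y) = y).
      { pose proof (thetax_stationary (/ E 1 y)) as Hs.
        rewrite Rmax_right, Rinv_inv in Hs by exact Hge.
        destruct (Rtotal_order (thetax (/ E 1 y)) y) as [Hl | [He | Hg]]; [ | exact He | ].
        - apply (E_lt 1) in Hl. lra.
        - apply (E_lt 1) in Hg. lra. }
      unfold phi. rewrite Hty, Rmax_right by exact Hge.
      unfold scal; simpl; unfold mult; simpl. field. lra.
    - replace (E 0 0 - E 0 (theta t)) with (minus (- E 0 (theta t)) (- E 0 0))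
        by (unfold minus, plus, opp; simpl; ring).
      apply (is_RInt_derive (V := R_CompleteNormedModule) (fun y => - E 0 y) (E 1)).
      + intros y _. rewrite <- (Ropp_involutive (E 1 y)).
        apply (is_derive_opp (V := R_NormedModule) (E 0)). apply is_derive_E.
      + intros; apply continuous_E. }
  apply (is_RInt_unique (V := R_CompleteNormedModule)) in Hc.
  apply (is_RInt_unique (V := R_CompleteNormedModule)) in Hi.
  rewrite Hi, Hgt in Hc. fold tg in Hc.
  replace (Phi v t) with (RInt phi tg t).
  - apply (RInt_correct (V := R_CompleteNormedModule)). exact Hex.
  - rewrite <- Hc, <- mass_theta, <- mass_0 by lra. reflexivity.
Qed.

(** Positivity of [tg] is part of the conclusion so that times t >= tg are nonnegative, where a
    solution coincides with its extension frozen at negative times. *)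
Lemma critical_solution_gelation :
  exists (M1 : R) (tg : R),
    m1 (v 0) = Finite M1 /\
    t_gel v = Finite tg /\
    tg = 1 / M1 /\ 0 < tg /\
    exists phi : R -> R,
      (forall t, tg <= t -> 0 < phi t) /\
      (forall t, tg <= t ->
         filterlim phi (within (fun s => tg <= s) (locally t)) (locally (phi t))) /\
      (forall t, tg <= t -> is_RInt phi tg t (Phi v t)) /\
      (forall t, tg <= t ->
         is_lim_seq (fun K => sqrt (INR K) * Series (fun n => v t (K + n)%nat))
                    (sqrt (2 * phi t / PI))).
Proof.
  exists (E 1 0), tg. split; [ exact m1_0 | ]. split; [ exact t_gel_eq | ].
  split; [ unfold tg; field; apply Rgt_not_eq, E_pos | ]. split; [ exact tg_pos | ].
  exists phi. split; [ intros; apply phi_pos | ]. split; [ | split ].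
  - intros t _. apply (filterlim_filter_le_1 (F := locally t)); [ apply filter_le_within | ].
    apply continuous_phi.
  - exact is_RInt_phi.
  - intros t Ht. unfold phi, thetax. rewrite Rmax_right by exact Ht.
    apply is_lim_Series_sqrt, Ht.
Qed.

End CriticalSolution.

(* The values of a solution at negative times are unconstrained; freezing them at the
   initial state makes every time function continuous at 0. *)
Lemma critical_solution_extend (v : R -> nat -> R) :
  critical_solution v -> critical_solution (fun t => v (Rmax 0 t)).
Proof.
  assert (R0 : forall s, 0 <= s -> Rmax 0 s = s) by (intros; apply Rmax_right; assumption).
  intros [H1 [H2 [H3 H4]]]. unfold Phi in *. split; [ | split; [ | split ] ].
  - intros t Ht. rewrite R0 by exact Ht. apply H1, Ht.
  - intros t k Ht Hk. rewrite (R0 t), (R0 0) by lra.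
    refine (is_RInt_ext _ _ 0 t _ _ (H2 t k Ht Hk)).
    rewrite Rmin_left, Rmax_right by exact Ht. intros s Hs. rewrite !R0 by lra. reflexivity.
  - intros s t Hs Hst. unfold Phi. rewrite (R0 s), (R0 t), (R0 0) by lra. apply H3; assumption.
  - intros t Ht. unfold Phi. rewrite (R0 t), (R0 0) by lra. apply H4, Ht.
Qed.

Theorem theorem5 (v : R -> nat -> R) :
  in_Nstar (v 0) ->
  critical_solution v ->
  exists (M1 : R) (tg : R),
    m1 (v 0) = Finite M1 /\
    t_gel v = Finite tg /\
    tg = 1 / M1 /\
    exists phi : R -> R,
      (forall t, tg <= t -> 0 < phi t) /\
      (forall t, tg <= t ->
         filterlim phi (within (fun s => tg <= s) (locally t)) (locally (phi t))) /\
      (forall t, tg <= t -> is_RInt phi tg t (Phi v t)) /\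
      (forall t, tg <= t ->
         is_lim_seq (fun K => sqrt (INR K) * Series (fun n => v t (K + n)%nat))
                    (sqrt (2 * phi t / PI))).
Proof.
  intros [_ [N HN]] Hsol.
  assert (R0 : forall s, 0 <= s -> Rmax 0 s = s) by (intros; apply Rmax_right; assumption).
  destruct (critical_solution_gelation (fun t => v (Rmax 0 t)) (critical_solution_extend v Hsol))
    with (N := N) as (M1 & tg & E1 & E2 & E3 & Htg & phi & P1 & P2 & P3 & P4).
  - intros t Ht. rewrite (Rmax_left 0 t), (R0 0) by lra. reflexivity.
  - intros k Hk. rewrite R0 by lra. apply HN, Hk.
  - exists M1, tg. rewrite R0 in E1 by lra.
    split; [ exact E1 | ]. split; [ | split; [ exact E3 | ] ].
    + rewrite <- E2. apply Glb_Rbar_eqset. intros t.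
      split; intros [Ht Hm]; split; try exact Ht; rewrite R0 in * by exact Ht; exact Hm.
    + exists phi. split; [ exact P1 | ]. split; [ exact P2 | ]. split.
      * intros t Ht. specialize (P3 t Ht). unfold Phi in *. rewrite !R0 in P3 by lra. exact P3.
      * intros t Ht. specialize (P4 t Ht). rewrite R0 in P4 by lra. exact P4.
Qed.
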